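(* Let $A\in\mathbb C^{n\times n}$; let $z_1,z_2,\dots,z_N\in\mathbb C$ be arbitrary (possibly repeated) points of interpolation; let $f$ be an analytic function defined on a neighborhood of the convex hull of the union of the spectrum $\sigma(A)$ and the set $\{z_1,\dots,z_N\}$; let $r=\frac uv$ be a rational function of degree $[L/M]$, with $L\le N-1$, that interpolates $f$ at the points $z_1,\dots,z_N$ (counted according to their multiplicities); and let $v(z_k)\ne0$ for $k=1,2,\dots,N$ and $v(\lambda)\neq0$ for all $\lambda\in\sigma(A)$. Put $\Omega(z)=\prod_{k=1}^N(z-z_k)$. Then for any $b\in\mathbb C^n$, with $\lVert\cdot\rVert_2$ the Euclidean norm on $\mathbb C^n$, $$\bigl\lVert\bigl(f(A)-r(A)\bigr)b\bigr\rVert_2\le\max_{\substack{t\in[0,1]\\ \mu\in\operatorname{co}\{z_1,z_2,\dots,z_N\}}}\biggl\lVert\Omega(A)[v(A)]^{-1}\frac{(vf)^{(N)}\bigl((1-t)\mu\mathbf 1+tA\bigr)}{N!}\,b\biggr\rVert_2.$$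
   Context: $\mathbf 1$ is the identity matrix and $\operatorname{co}M$ is the convex hull of $M\subset\mathbb C$. If $g$ is analytic on an open (possibly disconnected) set containing $\sigma(B)$, then $g(B)=\frac1{2\pi i}\int_\Gamma g(\lambda)(\lambda\mathbf 1-B)^{-1}d\lambda$, where the contour $\Gamma$ encloses $\sigma(B)$; $(vf)^{(N)}$ is the $N$-th complex derivative of the product $vf$, and it is applied to the matrix $(1-t)\mu\mathbf 1+tA$ in this sense. A rational function $r=u/v$ of degree $[L/M]$ means that $u,v$ are polynomials with $\deg u\le L$, $\deg v\le M$. ''$r$ interpolates $f$ at $z_1,\dots,z_N$ counted according to their multiplicities'' means: if $\zeta_1,\dots,\zeta_m$ are the distinct values in the list $z_1,\dots,z_N$ and $n_k$ is the number of occurrences of $\zeta_k$ in the list (so $N=\sum_k n_k$), then $r^{(j)}(\zeta_k)=f^{(j)}(\zeta_k)$ for $k=1,\dots,m$, $j=0,1,\dots,n_k-1$. *)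

(* Defs.v *)
From HB Require Import structures.
From mathcomp Require Import all_boot all_order all_algebra.
From mathcomp Require Import complex.
From mathcomp Require Import all_classical all_reals all_analysis.

Set Implicit Arguments.
Unset Strict Implicit.
Unset Printing Implicit Defensive.

Import Order.TTheory GRing.Theory Num.Theory.
Import numFieldNormedType.Exports.

Local Open Scope classical_set_scope.
Local Open Scope complex_scope.
Local Open Scope ring_scope.

(* The complex numbers R[i] as a normed module over themselves, so that the
   topology and [derive1n] (here: complex differentiation) apply to functions
   R[i] -> R[i]. *)
Section ComplexNormedModule.
Variable R : realType.
#[export, non_forgetful_inheritance]
HB.instance Definition _ := GRing.ComAlgebra.copy R[i] R[i]^o.
#[export, non_forgetful_inheritance]
HB.instance Definition _ := Vector.copy R[i] R[i]^o.
#[export, non_forgetful_inheritance]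
HB.instance Definition _ := NormedModule.copy R[i] R[i]^o.
End ComplexNormedModule.

Section Definitions.
Variable R : realType.

Definition analytic_at (g : R[i] -> R[i]) (w0 : R[i]) : Prop :=
  exists a : nat -> R[i],
    \forall w \near w0, series (fun k => a k * (w - w0) ^+ k) @ \oo --> g w.

(* [Rcomplex R] is R[i] with its structure of real vector space. *)
Definition conv_hull (S : set R[i]) : set R[i] :=
  smallest (@convex_set R (Rcomplex R)) S.

Definition spectrum n (A : 'M[R[i]]_n) : set R[i] :=
  [set lambda | eigenvalue A lambda].

Definition complex_integral (a b : R) (F : R -> R[i]) : R[i] :=
  (\int[lebesgue_measure]_(t in `[a, b]) complex.Re (F t)) +i*
  (\int[lebesgue_measure]_(t in `[a, b]) complex.Im (F t)).

(* Integral of h over the positively oriented circle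
   t |-> c + rho e^(it), t in [0, 2 pi]. *)
Definition circle_integral (h : R[i] -> R[i]) (c : R[i]) (rho : R) : R[i] :=
  complex_integral 0 (2 * pi) (fun t =>
    h (c + (rho * cos t) +i* (rho * sin t)) *
    ((- (rho * sin t)) +i* (rho * cos t))).

Definition open_disc (c : R[i]) (rho : R) : set R[i] :=
  [set w | `|w - c| < rho%:C].

Definition closed_disc (c : R[i]) (rho : R) : set R[i] :=
  [set w | `|w - c| <= rho%:C].

(* A contour is a finite family of positively oriented circles, given by
   centre and radius.  It encloses S inside D when the closed discs they bound
   are pairwise disjoint and contained in D and their interiors cover S;
   D need not be connected. *)
Definition encloses (Gamma : seq (R[i] * R)) (S D : set R[i]) : Prop :=
  [/\ forall p, p \in Gamma -> 0 < p.2,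
      uniq Gamma,
      forall p q, p \in Gamma -> q \in Gamma -> p != q ->
        closed_disc p.1 p.2 `&` closed_disc q.1 q.2 = set0,
      forall p, p \in Gamma -> closed_disc p.1 p.2 `<=` D
    & forall w, S w -> exists2 p, p \in Gamma & open_disc p.1 p.2 w].

(* g(B) = 1/(2 pi i) \int_Gamma g(lambda) (lambda 1 - B)^-1 d lambda, where
   Gamma is some contour enclosing the spectrum of B inside the (open) set of
   points at which g is analytic; by Cauchy's theorem the value does not
   depend on Gamma.  If no such contour exists, that is if g is not analytic
   on a neighborhood of the spectrum, Gamma is empty and the value is the
   junk value 0. *)
Definition matfun n (g : R[i] -> R[i]) (B : 'M[R[i]]_n) : 'M[R[i]]_n :=
  let Gamma := xget [::]
    [set Gamma | encloses Gamma (spectrum B) (analytic_at g)] in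
  (0 +i* (2 * pi))^-1 *:
  \matrix_(j, k) \sum_(p <- Gamma)
    circle_integral (fun lambda => g lambda * invmx (lambda%:M - B) j k)
      p.1 p.2.

(* The norm `| | of R[i] takes its values in R[i], hence the real part. *)
Definition norm2 n (b : 'cV[R[i]]_n) : R :=
  Num.sqrt (\sum_(k < n) complex.Re `|b k 0| ^+ 2).

Definition ratfun (u v : {poly R[i]}) : R[i] -> R[i] :=
  fun w => u.[w] / v.[w].

Definition interpolates N (r f : R[i] -> R[i]) (z : N.-tuple R[i]) : Prop :=
  forall zeta, zeta \in z -> forall j, (j < count_mem zeta z)%N ->
    derive1n j r zeta = derive1n j f zeta.

Definition Omega N (z : N.-tuple R[i]) : R[i] -> R[i] :=
  fun w => \prod_(k < N) (w - tnth z k).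

End Definitions.

(* Main.v *)
(** Put [g = v f] and [Omega w = (w - z_1) ... (w - z_N)], and let
    [g_k = g[z_1, ..., z_k, .]] be the iterated divided differences of [g].
    Newton's formula gives [v f = P + Omega g_N] identically, and interpolation
    forces [P = u]; hence [f(A) - r(A) = Omega(A) v(A)^-1 g_N(A)].  It remains to
    bound [g_N(A)] by [g^(N)/N!] at the matrices [(1 - t) mu 1 + t A], which is
    the Hermite-Genocchi formula; no integral is needed for it.  If
    [h w = h a + (w - a) k w], then
    [d/dt (t^(i+1) k^(i)(a + t (x - a))) = t^i h^(i+1)(a + t (x - a))], so a real
    linear functional that is at most [M] on all [h^(i+1)(a + t (x - a))] is at
    most [M / (i + 1)] on [k^(i)(x)], by the mean value theorem; iterate over the
    nodes and apply it to the functional that pairs with the error vector.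

    The functional calculus is reduced to polynomials: if [h = q + chi_B k] with
    [k] analytic, then [h(B) = q(B)], because [chi_B(w) (w 1 - B)^-1] is the
    polynomial adjugate and the contribution of [k] vanishes by Cauchy's theorem.
    Cauchy's theorem on discs follows from the mean value property, proved by
    differentiating the mean over the circle of radius [s] with respect to [s]. *)

Require Import Defs.
From HB Require Import structures.
From mathcomp Require Import all_boot all_order all_algebra.
From mathcomp Require Import complex ring lra.
From mathcomp Require Import all_classical all_reals all_analysis.

Import Order.TTheory GRing.Theory Num.Theory.
Import numFieldNormedType.Exports.

Local Open Scope classical_set_scope.
Local Open Scope complex_scope.
Local Open Scope ring_scope.

Import Normc.

Set Implicit Arguments.
Unset Strict Implicit.
Unset Printing Implicit Defensive.

(** * Complex numbers as a normed space *)

Section ComplexNorm.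
Variable R : realType.
Implicit Types x y : R[i].

(** The mean value theorem has no vector form, which is why real functionals appear. To use it one
    must differentiate [T (k (a + t (x - a)))] in [t], where [T h] is a combination of entries of
    [h(A)]. The definition of [matfun] hides how this depends on [t]: the contour is chosen anew for
    each function, anywhere in the set where that function is analytic, so not even linearity in [h]
    is visible. Newton interpolation at the eigenvalues turns each entry of [h(A)] into a fixed
    finite combination of derivatives of [h] at eigenvalues (a jet); linearity, the chain rule and
    continuity then become finite computations. The induction over the nodes closes because the maps
    [w |-> (1 - s) mu + s w], with [mu] in the hull of the nodes, are stable under contraction
    towards a node. This is why [mu] ranges over the whole hull. Repeated nodes and eigenvalues need
    no limiting argument, since divided differences are functions whose value at the node is filled
    in. *)

Lemma normcC x : `|x| = (normc x)%:C. Proof. by case: x. Qed.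

Lemma normc_ge0 x : 0 <= normc x.
Proof. by case: x => a b; exact: sqrtr_ge0. Qed.

Lemma normcD x y : normc (x + y) <= normc x + normc y.
Proof. exact: le_normcD. Qed.

Lemma normc_opp x : normc (- x) = normc x.
Proof. exact: normcN. Qed.

Lemma normcB x y : normc (x - y) <= normc x + normc y.
Proof. by rewrite -(normc_opp y); exact: normcD. Qed.

Lemma normc_distC x y : normc (x - y) = normc (y - x).
Proof. by rewrite -normc_opp opprB. Qed.

Lemma normc_eq0 x : (normc x == 0) = (x == 0).
Proof. by apply/eqP/eqP => [/eq0_normc//|->]; rewrite normc0. Qed.

Lemma normc_gt0 x : (0 < normc x) = (x != 0).
Proof. by rewrite lt_def normc_ge0 normc_eq0 andbT. Qed.

Lemma normcX x n : normc (x ^+ n) = normc x ^+ n.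
Proof.
elim: n => [|n IH]; first by rewrite !expr0 normc1.
by rewrite !exprS normcM IH.
Qed.

Lemma normc_real (r : R) : normc r%:C = `|r|.
Proof. by rewrite /= expr0n /= addr0 sqrtr_sqr. Qed.

Lemma normc_nat n : normc (n%:R : R[i]) = n%:R.
Proof. by rewrite -[n%:R](rmorph_nat (real_complex R)) normc_real ger0_norm. Qed.

Lemma normc_Re x : `|complex.Re x| <= normc x.
Proof. by rewrite -lecR -normcC; exact: normc_ge_Re. Qed.

Lemma normc_Im x : `|complex.Im x| <= normc x.
Proof.
case: x => a b /=; rewrite -sqrtr_sqr ler_sqrt ?lerDr ?sqr_ge0 //.
by rewrite addr_ge0 ?sqr_ge0.
Qed.

Lemma normc_ReIm x : normc x <= `|complex.Re x| + `|complex.Im x|.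
Proof.
have -> : x = (complex.Re x)%:C + (0 +i* 1) * (complex.Im x)%:C.
  exact: complexE.
apply: le_trans (normcD _ _) _; rewrite normcM !normc_real.
rewrite (_ : normc (0 +i* 1) = 1); last by rewrite /= expr0n /= add0r expr1n sqrtr1.
by case: x => a b; rewrite mul1r /= !(mul0r, mulr0, mul1r, addr0, subr0, add0r).
Qed.

Lemma normc_sum (I : Type) (s : seq I) (P : pred I) (F : I -> R[i]) :
  normc (\sum_(i <- s | P i) F i) <= \sum_(i <- s | P i) normc (F i).
Proof.
apply: (big_ind2 (fun a b => normc a <= b)) => //; first by rewrite normc0.
by move=> a b c d ab cd; apply: le_trans (normcD _ _) _; exact: lerD.
Qed.

Lemma nbhs_normcP (w : R[i]) (P : set R[i]) :
  (\forall x \near w, P x) <->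
  exists2 e : R, 0 < e & forall x, normc (x - w) < e -> P x.
Proof.
split.
  move/nbhs_normP => [e /= e0 H].
  have eE : e = (complex.Re e)%:C by rewrite RRe_real// gtr0_real.
  exists (complex.Re e); first by rewrite -ltcR -eE.
  by move=> x xe; apply: H; rewrite /ball_/= distrC normcC eE ltcR.
move=> [e e0 H]; apply/nbhs_normP; exists e%:C => /=; first by rewrite ltcR.
by move=> x /=; rewrite distrC normcC ltcR; exact: H.
Qed.

Lemma cvg_normcP (T : Type) (F : set_system T) {FF : Filter F} (f : T -> R[i]) l :
  f @ F --> l <-> forall e : R, 0 < e -> \forall t \near F, normc (f t - l) < e.
Proof.
split.
  move=> H e e0; apply: (H [set x | normc (x - l) < e]).
  by apply/nbhs_normcP; exists e.
by move=> H P /nbhs_normcP [e e0 eP]; have := H e e0; apply: filterS => t; exact: eP.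
Qed.

Lemma cvg_normc_le (T : Type) (F : set_system T) {FF : ProperFilter F}
    (f : T -> R[i]) l (B : R) :
  f @ F --> l -> (\forall t \near F, normc (f t) <= B) -> normc l <= B.
Proof.
move=> /cvg_normcP fl fB; apply/ler_addgt0Pr => e e0.
have [t [tB te]] : exists t, normc (f t) <= B /\ normc (f t - l) < e.
  by near F => t; exists t; split; near: t => //; exact: fl.
have -> : l = f t - (f t - l) by rewrite opprB addrC subrK.
by apply: le_trans (normcB _ _) _; apply: lerD => //; exact: ltW.
Unshelve. all: by end_near.
Qed.

Lemma cvg_Re (T : Type) (F : set_system T) {FF : Filter F} (f : T -> R[i]) l :
  f @ F --> l -> (fun t => complex.Re (f t)) @ F --> complex.Re l.
Proof.
move=> /cvg_normcP H; apply/cvgrPdist_lt => e e0; have := H e e0.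
apply: filterS => t; apply: le_lt_trans; rewrite distrC.
have -> : complex.Re (f t) - complex.Re l = complex.Re (f t - l).
  by case: (f t) => a b; case: (l) => c d.
exact: normc_Re.
Qed.

Lemma cvg_Im (T : Type) (F : set_system T) {FF : Filter F} (f : T -> R[i]) l :
  f @ F --> l -> (fun t => complex.Im (f t)) @ F --> complex.Im l.
Proof.
move=> /cvg_normcP H; apply/cvgrPdist_lt => e e0; have := H e e0.
apply: filterS => t; apply: le_lt_trans; rewrite distrC.
have -> : complex.Im (f t) - complex.Im l = complex.Im (f t - l).
  by case: (f t) => a b; case: (l) => c d.
exact: normc_Im.
Qed.

Lemma cvg_complex (T : Type) (F : set_system T) {FF : Filter F} (f g : T -> R) (a b : R) :
  f @ F --> a -> g @ F --> b -> (fun t => f t +i* g t) @ F --> a +i* b.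
Proof.
move=> /cvgrPdist_lt fa /cvgrPdist_lt gb; apply/cvg_normcP => e e0.
have e20 : 0 < e / 2 by rewrite divr_gt0.
have := fa _ e20; have := gb _ e20; apply: filterS2 => t gt ft.
apply: le_lt_trans (normc_ReIm _) _ => /=; rewrite [e]splitr.
by rewrite ltrD // distrC.
Qed.

Lemma cvg_real_complex (T : Type) (F : set_system T) {FF : Filter F} (f : T -> R) (a : R) :
  f @ F --> a -> (fun t => (f t)%:C) @ F --> a%:C.
Proof. by move=> fa; apply: (@cvg_complex _ F FF f (fun=> 0) a 0 fa); exact: cvg_cst. Qed.

Lemma cvg_mulc (T : Type) (F : set_system T) {FF : Filter F} (f g : T -> R[i])
    (a b : R[i]) :
  f @ F --> a -> g @ F --> b -> (fun t => f t * g t) @ F --> a * b.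
Proof. move=> fa gb; exact: (cvgM fa gb). Qed.

Lemma cvg_mulcl (b : R[i]) (T : Type) (F : set_system T) {FF : Filter F}
    (f : T -> R[i]) (a : R[i]) :
  f @ F --> a -> (fun t => b * f t) @ F --> b * a.
Proof. by move=> fa; exact: (cvg_mulc (cvg_cst b) fa). Qed.

Lemma cvg_addc (T : Type) (F : set_system T) {FF : Filter F} (f g : T -> R[i])
    (a b : R[i]) :
  f @ F --> a -> g @ F --> b -> (fun t => f t + g t) @ F --> a + b.
Proof. move=> fa gb; exact: (cvgD fa gb). Qed.

Lemma cvg_subc (T : Type) (F : set_system T) {FF : Filter F} (f g : T -> R[i])
    (a b : R[i]) :
  f @ F --> a -> g @ F --> b -> (fun t => f t - g t) @ F --> a - b.
Proof. move=> fa gb; exact: (cvgB fa gb). Qed.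

Lemma complex_series_cvg (u : nat -> R[i]) (M : R) :
  (forall k, normc (u k) <= M * 2^-1 ^+ k) ->
  exists l : R[i], (fun n => \sum_(i < n) u i) @ \oo --> l.
Proof.
move=> uM.
have real_cvg (v : nat -> R) : (forall k, `|v k| <= M * 2^-1 ^+ k) ->
    exists l : R, (fun n => \sum_(i < n) v i) @ \oo --> l.
  move=> vM.
  have : cvgn (series v).
    apply: normed_cvg.
    apply: (@series_le_cvg _ _ (geometric M 2^-1)).
    - by move=> n; exact: normr_ge0.
    - by move=> n; apply: le_trans (vM n).
    - exact: vM.
    - by apply: is_cvg_geometric_series; rewrite ger0_norm // invf_lt1 // ltr1n.
  move=> /cvg_ex [l vl]; exists l.
  suff -> : (fun n => \sum_(i < n) v i) = series v by [].
  by apply/funext => n; rewrite /series /= big_mkord.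
have [a ua] : exists l : R, (fun n => \sum_(i < n) complex.Re (u i)) @ \oo --> l.
  by apply: (real_cvg (fun k => complex.Re (u k))) => k; exact: le_trans (normc_Re _) (uM k).
have [b ub] : exists l : R, (fun n => \sum_(i < n) complex.Im (u i)) @ \oo --> l.
  by apply: (real_cvg (fun k => complex.Im (u k))) => k; exact: le_trans (normc_Im _) (uM k).
exists (a +i* b).
have -> : (fun n => \sum_(i < n) u i) =
    (fun n => (\sum_(i < n) complex.Re (u i)) +i* (\sum_(i < n) complex.Im (u i))).
  apply/funext => n; elim: n => [|n IH]; first by rewrite !big_ord0.
  by rewrite !big_ord_recr /= IH; case: (u n).
exact: cvg_complex.
Qed.

End ComplexNorm.
Arguments cvg_mulcl {R} b {T F FF f a}.

(** * Power series *)

Section Analytic.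
Variable R : realType.
Implicit Types (x y w a : R[i]) (g h : R[i] -> R[i]).

Lemma cvg_seqS (u v : nat -> R[i]) (l : R[i]) :
  (forall n, v n.+1 = u n) -> u @ \oo --> l -> v @ \oo --> l.
Proof.
move=> uv ul; rewrite -cvg_shiftS.
by rewrite (_ : (fun n => v n.+1) = u)//; exact/funext.
Qed.

Definition psum (c : nat -> R[i]) (x : R[i]) (n : nat) : R[i] :=
  \sum_(i < n) c i * x ^+ i.

(** Multiplying or dividing a power series by its variable thus becomes a shift of the
    coefficients. *)
Lemma psumS c x n :
  psum c x n.+1 = c 0 + x * psum (fun k => c k.+1) x n.
Proof.
rewrite /psum big_ord_recl expr0 mulr1 mulr_sumr; congr (_ + _).
by apply: eq_bigr => i _; rewrite lift0 exprS mulrCA.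
Qed.

Lemma analytic_atP g w0 : analytic_at g w0 <->
  exists c (e : R), 0 < e /\
    forall x, normc x < e -> psum c x @ \oo --> g (w0 + x).
Proof.
have E c w : series (fun k => c k * (w - w0) ^+ k) = psum c (w - w0).
  by apply/funext => n; rewrite /series /= big_mkord.
split=> [[c /nbhs_normcP [e e0 H]]|[c [e [e0 H]]]].
  exists c, e; split=> [//|x xe].
  by have := H (w0 + x); rewrite E [w0 + x]addrC addrK; apply.
exists c; apply/nbhs_normcP; exists e => // w we; rewrite E.
by have := H _ we; rewrite [w0 + _]addrC subrK.
Qed.

Lemma analytic_near_eq g h w0 :
  (\forall w \near w0, g w = h w) -> analytic_at g w0 -> analytic_at h w0.
Proof.
move=> gh [c H]; exists c; near=> w.
have <- : g w = h w by near: w.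
by near: w; exact: H.
Unshelve. all: by end_near.
Qed.

Lemma analytic_eq g h w0 : g =1 h -> analytic_at g w0 -> analytic_at h w0.
Proof. by move=> /funext ->. Qed.

Lemma analytic_cst a w0 : analytic_at (fun=> a) w0.
Proof.
apply/analytic_atP; exists (fun k => if k is 0 then a else 0), 1; split => // x _.
apply: (cvg_seqS (u := fun=> a)); last exact: cvg_cst.
by move=> n; rewrite psumS /psum big1 ?mulr0 ?addr0 // => i _; rewrite mul0r.
Qed.

Lemma analyticD g h w0 :
  analytic_at g w0 -> analytic_at h w0 -> analytic_at (fun w => g w + h w) w0.
Proof.
move=> /analytic_atP [c [e [e0 H]]] /analytic_atP [c' [e' [e'0 H']]].
apply/analytic_atP; exists (fun k => c k + c' k), (Num.min e e').
split; first by rewrite lt_min e0.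
move=> x; rewrite lt_min => /andP[xe xe'].
rewrite (_ : psum _ x = fun n => psum c x n + psum c' x n).
  exact: (cvg_addc (H _ xe) (H' _ xe')).
apply/funext => n; rewrite /psum -big_split /=.
by apply: eq_bigr => i _; rewrite mulrDl.
Qed.

Lemma analyticZ a g w0 : analytic_at g w0 -> analytic_at (fun w => a * g w) w0.
Proof.
move=> /analytic_atP [c [e [e0 H]]].
apply/analytic_atP; exists (fun k => a * c k), e; split=> [//|x xe].
rewrite (_ : psum _ x = fun n => a * psum c x n).
  exact: (cvg_mulcl a (H _ xe)).
by apply/funext => n; rewrite /psum mulr_sumr; apply: eq_bigr => i _; rewrite mulrA.
Qed.

Lemma analyticB g h w0 :
  analytic_at g w0 -> analytic_at h w0 -> analytic_at (fun w => g w - h w) w0.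
Proof.
move=> Hg Hh; apply: (@analytic_eq (fun w => g w + (-1) * h w)).
  by move=> w; rewrite mulN1r.
exact: (analyticD Hg (analyticZ (-1) Hh)).
Qed.

(** Writing [w - a] as [(w - w0) + (w0 - a)] leaves a shift of the coefficients and a scalar
    multiple. Iterated, this gives products with arbitrary polynomials. *)
Lemma analytic_mulXsub a g w0 :
  analytic_at g w0 -> analytic_at (fun w => (w - a) * g w) w0.
Proof.
move=> Hg; apply: (@analytic_eq (fun w => (w - w0) * g w + (w0 - a) * g w)).
  by move=> w; rewrite -mulrDl addrA subrK.
apply: (analyticD _ (analyticZ (w0 - a) Hg)).
move: Hg => /analytic_atP [c [e [e0 H]]].
apply/analytic_atP; exists (fun k => if k is k'.+1 then c k' else 0), e.
split=> [//|x xe]; rewrite [w0 + x]addrC addrK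
  [x + w0]addrC.
apply: (cvg_seqS (u := fun n => x * psum c x n)).
  by move=> n; rewrite psumS add0r.
exact: (cvg_mulcl x (H _ xe)).
Qed.

Lemma analytic_affine a x g w0 :
  analytic_at g (a + x * w0) -> analytic_at (fun w => g (a + x * w)) w0.
Proof.
move=> /analytic_atP [c [e [e0 H]]].
apply/analytic_atP; exists (fun k => c k * x ^+ k), (e / (normc x + 1)).
have x10 : 0 < normc x + 1 by rewrite ltr_wpDl ?normc_ge0.
split; first by rewrite divr_gt0.
move=> y; rewrite ltr_pdivlMr // => ye.
rewrite (_ : psum _ y = psum c (x * y)).
  rewrite mulrDr addrA; apply: H; apply: le_lt_trans ye.
  by rewrite normcM mulrC ler_wpM2l ?normc_ge0 // lerDl.
by apply/funext => n; apply: eq_bigr => i _; rewrite exprMn mulrA.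
Qed.

Lemma geometric_perturbed_cvg0 (q : R) (b d : nat -> R) :
  0 <= q < 1 -> (forall n, 0 <= b n) -> d @ \oo --> (0 : R) ->
  (forall n, b n.+1 <= q * b n + d n) -> b @ \oo --> (0 : R).
Proof.
move=> /andP[q0 q1] b0 d0 bS; apply/cvgrPdist_lt => e e0.
have q1' : 0 < 1 - q by rewrite subr_gt0.
(* [e / 2] is the fixed point of [x |-> q x + (1 - q) (e / 2)], so from [N] on the excess of [b]
   over it is at most multiplied by [q]. *)
have : \forall n \near \oo, `|0 - d n| < (1 - q) * (e / 2).
  by move/cvgrPdist_lt: d0; apply; rewrite mulr_gt0 // divr_gt0.
move=> [N _ dN].
have bnd k : b (N + k)%N <= q ^+ k * b N + e / 2.
  elim: k => [|k IH]; first by rewrite addn0 expr0 mul1r lerDl divr_ge0 // ltW.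
  rewrite addnS; apply: le_trans (bS _) _.
  have /ltW := dN (N + k)%N (leq_addr _ _); rewrite sub0r normrN => dk.
  have {}dk := le_trans (ler_norm _) dk.
  have := lerD (ler_wpM2l q0 IH) dk; move/le_trans; apply.
  by rewrite exprS le_eqVlt; apply/orP; left; apply/eqP; ring.
have : \forall k \near \oo, `|0 - q ^+ k * b N| < e / 2.
  have : (fun k => q ^+ k * b N) @ \oo --> (0 * b N : R).
    by apply: cvgM; [apply: cvg_expr; rewrite ger0_norm|exact: cvg_cst].
  by rewrite mul0r => /cvgrPdist_lt; apply; rewrite divr_gt0.
move=> [K _ HK]; exists (N + K)%N => // n /= Kn.
have -> : n = (N + (n - N))%N by rewrite subnKC // (leq_trans _ Kn) // leq_addr.
rewrite sub0r normrN ger0_norm //; apply: le_lt_trans (bnd _) _.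
rewrite [ltRHS]splitr ltrD2r.
have := HK (n - N)%N; rewrite sub0r normrN; move=> /(_ _)/(le_lt_trans (ler_norm _)); apply.
by rewrite /= leq_subRL // (leq_trans _ Kn) // leq_addr.
Qed.

(* The coefficients of [g w / (w - a)] at [w0] solve the recursion below;
   the partial sums then satisfy an exact identity, so no product of series
   is needed. *)
Lemma analytic_divXsub a g w0 : w0 != a ->
  analytic_at g w0 -> analytic_at (fun w => g w / (w - a)) w0.
Proof.
move=> w0a /analytic_atP [c [e [e0 H]]].
pose z := a - w0.
have z0 : z != 0 by rewrite subr_eq0 eq_sym.
(* Here [w - a = x - z], and comparing coefficients in [(x - z) * (sum of b_k x^k) = sum of c_k x^k]
   gives [c_k = b_(k-1) - z b_k]. *)
pose b := fix b k := if k is k'.+1 then (b k' - c k) / z else - c 0 / z.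
apply/analytic_atP; exists b, (Num.min e (normc z)); split.
  by rewrite lt_min e0 normc_gt0.
move=> x; rewrite lt_min => /andP[xe xz].
have xz0 : x - z != 0.
  by rewrite subr_eq0; apply/negP => /eqP xE; rewrite xE ltxx in xz.
have -> : w0 + x - a = x - z by rewrite /z; ring.
have id n : psum b x n.+1 = (psum c x n.+1 + b n * x ^+ n.+1) / (x - z).
  apply: (mulIf xz0); rewrite divfK //.
  elim: n => [|n IH].
    rewrite /psum !big_ord1 expr0 !mulr1 expr1 /=.
    by rewrite mulrBr mulrAC divfK // addrC mulNr opprK mulrC.
  rewrite /psum !(big_ord_recr n.+1) /= mulrDl -/(psum b x n.+1) IH.
  rewrite -/(psum c x n.+1) -[RHS]addrA -[LHS]addrA; congr (_ + _).
  have -> : (b n - c n.+1) / z * x ^+ n.+1 * (x - z) =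
      (b n - c n.+1) / z * x ^+ n.+2 - (b n - c n.+1) / z * z * x ^+ n.+1.
    by rewrite !exprS; ring.
  by rewrite divfK //; ring.
have cx0 : (fun n => c n * x ^+ n) @ \oo --> (0 : R[i]).
  have Hx := H _ xe.
  have HxS : (fun n => psum c x n.+1) @ \oo --> g (w0 + x) by rewrite cvg_shiftS.
  rewrite (_ : (fun n => _) = (fun n => psum c x n.+1 - psum c x n)).
    by rewrite -(subrr (g (w0 + x))); exact: (cvg_subc HxS Hx).
  by apply/funext => n; rewrite /psum big_ord_recr /= [X in X - _]addrC addrK.
(* The recursion bounds the term of index [n + 1] by [|x| / |z| < 1] times the previous one plus a
   null sequence. *)
have bx0 : (fun n => normc (b n * x ^+ n)) @ \oo --> (0 : R).
  apply: (@geometric_perturbed_cvg0 (normc x / normc z) _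
           (fun n => normc (c n.+1 * x ^+ n.+1) / normc z)).
  - by rewrite divr_ge0 ?normc_ge0 //= ltr_pdivrMr ?normc_gt0 // mul1r.
  - by move=> n; exact: normc_ge0.
  - rewrite -[0 : R](mul0r (normc z)^-1); apply: cvgM; last exact: cvg_cst.
    rewrite (cvg_shiftS (fun n => normc (c n * x ^+ n))).
    apply/cvgrPdist_lt => d d0; move/cvg_normcP: cx0 => /(_ d d0).
    by apply: filterS => n; rewrite subr0 sub0r normrN ger0_norm ?normc_ge0.
  - move=> n /=; rewrite !normcM normcV !normcX.
    have -> : normc x / normc z * (normc (b n) * normc x ^+ n) +
        normc (c n.+1) * normc x ^+ n.+1 / normc z =
        (normc (b n) + normc (c n.+1)) / normc z * normc x ^+ n.+1.
      by rewrite !exprS; ring.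
    rewrite ler_wpM2r ?exprn_ge0 ?normc_ge0 // ler_wpM2r ?invr_ge0 ?normc_ge0 //.
    exact: normcB.
have bx1 : (fun n => b n * x ^+ n.+1) @ \oo --> (0 : R[i]).
  apply/cvg_normcP => d d0.
  have : (fun n => normc (b n * x ^+ n) * normc x) @ \oo --> (0 * normc x : R).
    by apply: cvgM => //; exact: cvg_cst.
  rewrite mul0r => /cvgrPdist_lt /(_ d d0); apply: filterS => n.
  rewrite subr0 sub0r normrN ger0_norm ?mulr_ge0 ?normc_ge0 //.
  by rewrite exprSr mulrA [X in _ -> X < _]normcM.
have cS : (fun n => psum c x n.+1) @ \oo --> g (w0 + x).
  by rewrite cvg_shiftS; exact: H.
have := cvg_mulc (cvg_addc cS bx1) (cvg_cst (x - z)^-1).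
rewrite addr0 => K; exact: (cvg_seqS id (K _ _ _)).
Qed.

End Analytic.

(** * Termwise differentiation of power series *)

Section Derivative.
Variable R : realType.
Implicit Types (x y w a : R[i]) (g h : R[i] -> R[i]).

Lemma natr_le_exp2 k : k%:R <= 2 ^+ k :> R.
Proof. by rewrite -natrX ler_nat ltnW // ltn_expl. Qed.

(** The remainder [u] for exponent [k] becomes [y u + k x^(k-1) (y - x)^2] for [k + 1]. The factor
    [rho ^+ 2] on the left replaces [rho^(k-2)] on the right, so that small [k] are not
    exceptional. *)
Lemma exprB_tangent_le (rho : R) x y k : 0 < rho ->
  normc x <= rho -> normc y <= rho ->
  normc (y ^+ k - x ^+ k - k%:R * x ^+ k.-1 * (y - x)) * rho ^+ 2 <=
    k%:R ^+ 2 * rho ^+ k * normc (y - x) ^+ 2.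
Proof.
move=> rho0 xr yr.
elim: k => [|k IH].
  by rewrite !expr0 subrr sub0r !mulr0n expr0n /= !mul0r oppr0 normc0 !mul0r.
set u := (X in normc X) in IH.
have -> : y ^+ k.+1 - x ^+ k.+1 - k.+1%:R * x ^+ k.+1.-1 * (y - x) =
    y * u + k%:R * x ^+ k.-1 * (y - x) ^+ 2.
  rewrite /u; case: k {IH u} => [|k] /=; first by rewrite !expr1 !expr0; ring.
  by rewrite !exprS -[in LHS]natr1; ring.
apply: le_trans (ler_wpM2r (exprn_ge0 _ (ltW rho0)) (normcD _ _)) _.
rewrite mulrDl.
apply: le_trans (_ : rho * (k%:R ^+ 2 * rho ^+ k * normc (y - x) ^+ 2) +
   k%:R * rho ^+ k.+1 * normc (y - x) ^+ 2 <= _).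
  apply: lerD.
    rewrite normcM -[leLHS]mulrA; apply: ler_pM; rewrite ?normc_ge0 //.
    by rewrite mulr_ge0 ?normc_ge0 ?exprn_ge0 // ltW.
  rewrite !normcM !normcX normc_nat.
  case: k {IH u} => [|k] /=; first by rewrite !mul0r.
  have -> : k.+1%:R * normc x ^+ k * normc (y - x) ^+ 2 * rho ^+ 2 =
      k.+1%:R * rho ^+ 2 * normc (y - x) ^+ 2 * normc x ^+ k by ring.
  have -> : k.+1%:R * rho ^+ k.+2 * normc (y - x) ^+ 2 =
      k.+1%:R * rho ^+ 2 * normc (y - x) ^+ 2 * rho ^+ k by rewrite !exprS; ring.
  rewrite ler_wpM2l ?lerXn2r ?nnegrE ?normc_ge0 ?(ltW rho0) //.
  by rewrite !mulr_ge0 // ?exprn_ge0 ?normc_ge0 // ltW.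
rewrite -subr_ge0 [rho ^+ k.+1]exprS -[k.+1%:R]natr1.
set r := rho ^+ k; set n := normc (y - x) ^+ 2; set m := k%:R.
have -> : (m + 1) ^+ 2 * (rho * r) * n - (rho * (m ^+ 2 * r * n) + m * (rho * r) * n)
   = (m + 1) * (rho * r) * n by ring.
by rewrite !mulr_ge0 // ?exprn_ge0 ?normc_ge0 ?addr_ge0 ?ler0n // ltW.
Qed.

Lemma psum_terms_bounded (c : nat -> R[i]) x (l : R[i]) :
  psum c x @ \oo --> l -> exists M : R, forall k, normc (c k * x ^+ k) <= M.
Proof.
move=> H.
have HS : (fun n => psum c x n.+1) @ \oo --> l by rewrite cvg_shiftS.
have /cvg_normcP/(_ 1 ltr01) [N _ HN] :
  (fun n => psum c x n.+1 - psum c x n) @ \oo --> l - l by exact: (cvg_subc HS H).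
exists (1 + \sum_(k < N) normc (c k * x ^+ k)) => k.
have [kN|Nk] := ltnP k N.
  rewrite (bigD1 (Ordinal kN)) //= addrCA lerDl addr_ge0 // sumr_ge0 // => i _.
  exact: normc_ge0.
have := HN k Nk; rewrite /= subrr subr0 /psum big_ord_recr /= [X in X - _]addrC addrK.
move/ltW/le_trans; apply; rewrite lerDl sumr_ge0 // => i _; exact: normc_ge0.
Qed.

(* [d] is the termwise derivative of the power series and [D] its sum. *)
Lemma analytic_quadratic g w0 : analytic_at g w0 ->
  exists (d : nat -> R[i]) (D : R[i] -> R[i]) (rho K : R), [/\ 0 < rho,
    forall x, normc x <= rho -> psum d x @ \oo --> D x &
    forall x y, normc x <= rho -> normc y <= rho ->
      normc (g (w0 + y) - g (w0 + x) - (y - x) * D x) <= K * normc (y - x) ^+ 2].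
Proof.
move=> /analytic_atP [c [e [e0 H]]].
(* Convergence at [r] bounds [|c_k| r^k] by [M]. The further factor [1/8] pays for the polynomial
   factors: since [k <= 2^k], [k^2 (1/8)^k <= 2^(-k)], and the geometric series yields the constant
   [2 M / rho^2]. *)
pose r := e / 2; pose rho := r / 8.
have r0 : 0 < r by rewrite divr_gt0.
have rho0 : 0 < rho by rewrite divr_gt0.
have rhoe : rho < e by rewrite /rho /r; lra.
have [M Mb] : exists M, forall k, normc (c k) * r ^+ k <= M.
  have re : normc r%:C < e by rewrite normc_real gtr0_norm // /r; lra.
  have [M HM] := psum_terms_bounded (H _ re); exists M => k.
  by have := HM k; rewrite normcM normcX normc_real gtr0_norm.
have M0 : 0 <= M by apply: le_trans (Mb 0); rewrite mulr_ge0 ?normc_ge0 // exprn_ge0 // ltW.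
pose d k := k.+1%:R * c k.+1.
have dcvg x : normc x <= rho -> exists l : R[i], psum d x @ \oo --> l.
  move=> xr; apply: (@complex_series_cvg R (fun k => d k * x ^+ k) (2 * M / r)) => k.
  rewrite /d !normcM normcX normc_nat.
  have xk : normc x ^+ k <= rho ^+ k by rewrite lerXn2r ?nnegrE ?normc_ge0 // ltW.
  apply: le_trans (ler_wpM2l _ xk) _; first by rewrite mulr_ge0 ?normc_ge0.
  have -> : k.+1%:R * normc (c k.+1) * rho ^+ k =
     (k.+1%:R * (1 / 8) ^+ k) * (normc (c k.+1) * r ^+ k.+1 / r).
    rewrite exprS /rho [r / 8]mulrC div1r exprMn.
    by move: (_ ^+ k) (_ ^+ k) => p q; field; rewrite gt_eqF.
  have -> : 2 * M / r * 2^-1 ^+ k = (2 * 2^-1 ^+ k) * (M / r) by ring.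
  apply: ler_pM; rewrite ?mulr_ge0 ?normc_ge0 ?exprn_ge0 ?invr_ge0 // ?(ltW r0) //.
    have -> : (2^-1 : R) ^+ k = 2 ^+ k * (1 / 4) ^+ k by rewrite -exprMn; congr (_ ^+ _); field.
    rewrite mulrA -exprS; apply: ler_pM; rewrite ?exprn_ge0 //.
      exact: natr_le_exp2.
    by rewrite lerXn2r ?nnegrE //; lra.
  by rewrite ler_wpM2r ?invr_ge0 ?(ltW r0).
pose D x := lim (psum d x @ \oo).
exists d, D, rho, (2 * M / rho ^+ 2); split => //.
  by move=> x /dcvg [l xl]; apply: cvgP xl.
move=> x y xr yr.
have Dx : psum d x @ \oo --> D x by have [l xl] := dcvg _ xr; apply: cvgP xl.
have xe := le_lt_trans xr rhoe; have ye := le_lt_trans yr rhoe.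
have HxS : (fun n => psum c x n.+1) @ \oo --> g (w0 + x) by rewrite cvg_shiftS; exact: H.
have HyS : (fun n => psum c y n.+1) @ \oo --> g (w0 + y) by rewrite cvg_shiftS; exact: H.
have K := cvg_subc (cvg_subc HyS HxS) (cvg_mulcl (y - x) Dx).
apply: (cvg_normc_le (K _ _ _)); exists 0%N => // n _.
have -> : psum c y n.+1 - psum c x n.+1 - (y - x) * psum d x n =
   \sum_(k < n.+1) c k * (y ^+ k - x ^+ k - k%:R * x ^+ k.-1 * (y - x)).
  rewrite /psum !big_ord_recl /= !expr0 subrr sub0r !mul0r oppr0 mulr0 add0r !mulr1.
  rewrite opprD addrACA subrr add0r mulr_sumr -!sumrB.
  by apply: eq_bigr => i _; rewrite /bump /= add1n /d; ring.
apply: le_trans (normc_sum _ _ _) _.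
apply: le_trans (_ : \sum_(k < n.+1) (M / rho ^+ 2 * normc (y - x) ^+ 2) * 2^-1 ^+ k <= _).
  apply: ler_sum => k _; rewrite normcM.
  have B := exprB_tangent_le k rho0 xr yr.
  rewrite -ler_pdivlMr ?exprn_gt0 // in B.
  apply: le_trans (ler_wpM2l (normc_ge0 _) B) _.
  have -> : normc (c k) * (k%:R ^+ 2 * rho ^+ k * normc (y - x) ^+ 2 / rho ^+ 2) =
     (normc (c k) * r ^+ k) * (k%:R ^+ 2 * (1 / 8) ^+ k) * (normc (y - x) ^+ 2 / rho ^+ 2).
    by rewrite {1}/rho [r / 8]mulrC div1r exprMn; ring.
  have -> : M / rho ^+ 2 * normc (y - x) ^+ 2 * 2^-1 ^+ k =
     M * 2^-1 ^+ k * (normc (y - x) ^+ 2 / rho ^+ 2) by ring.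
  rewrite ler_wpM2r ?mulr_ge0 ?invr_ge0 ?exprn_ge0 ?normc_ge0 ?(ltW rho0) //.
  apply: ler_pM; rewrite ?mulr_ge0 ?exprn_ge0 ?normc_ge0 ?(ltW r0) //.
  have -> : (2^-1 : R) ^+ k = (2 ^+ k) ^+ 2 * (1 / 8) ^+ k.
    by rewrite -exprM mulnC exprM -exprMn; congr (_ ^+ _); field.
  by rewrite ler_wpM2r ?exprn_ge0 // lerXn2r ?nnegrE ?exprn_ge0 ?natr_le_exp2.
rewrite -mulr_sumr.
have -> : 2 * M / rho ^+ 2 * normc (y - x) ^+ 2 = (M / rho ^+ 2 * normc (y - x) ^+ 2) * 2 by ring.
rewrite ler_wpM2l ?mulr_ge0 ?invr_ge0 ?exprn_ge0 ?normc_ge0 ?(ltW rho0) //.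
have E m : \sum_(k < m) (2^-1 : R) ^+ k = 2 - 2 * 2^-1 ^+ m.
  elim: m => [|m IH]; first by rewrite big_ord0 expr0; ring.
  by rewrite big_ord_recr /= IH exprS; field.
by rewrite E lerBlDr lerDl mulr_ge0 ?exprn_ge0.
Qed.

Lemma derive1_cvgP g w (l : R[i]) :
  (fun t : R[i] => (g (t + w) - g w) / t) @ 0^' --> l -> derivable g w 1 /\ g^`()%classic w = l.
Proof.
move=> H.
have E : (fun t : R[i] => t^-1 *: (g (t + w) - g w)) = (fun t : R[i] => (g (t + w) - g w) / t).
  by apply/funext => t; rewrite mulrC.
split.
  apply/cvg_ex; exists l; move: H; rewrite -E.
  suff -> : (fun t : R[i] => t^-1 *: (g (t + w) - g w)) =
     (fun t : R[i] => t^-1 *: ((g \o shift w) (t *: 1) - g w)) by [].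
  by apply/funext => t /=; rewrite -[t *: 1]/(t * 1) mulr1.
rewrite /derive1 E; exact: (cvg_lim _ H).
Qed.

Lemma quadratic_derive1 g w (l : R[i]) (K e : R) : 0 < e ->
  (forall y, normc (y - w) < e ->
    normc (g y - g w - (y - w) * l) <= K * normc (y - w) ^+ 2) ->
  derivable g w 1 /\ g^`()%classic w = l.
Proof.
move=> e0 H; apply: derive1_cvgP; apply/cvg_normcP => d d0.
have K1 : 0 < `|K| + 1 by rewrite ltr_wpDl.
rewrite /dnbhs /within /=; apply/nbhs_normcP.
exists (Num.min e (d / (`|K| + 1))); first by rewrite lt_min e0 divr_gt0.
move=> x; rewrite subr0 lt_min => /andP[xe]; rewrite ltr_pdivlMr // => xd x0.
have := H (x + w); rewrite addrK => /(_ xe) Hx.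
have -> : (g (x + w) - g w) / x - l = (g (x + w) - g w - x * l) / x.
  by rewrite [RHS]mulrBl [x * l]mulrC mulfK.
rewrite normcM normcV ltr_pdivrMr ?normc_gt0 //; apply: le_lt_trans Hx _.
rewrite expr2 mulrA ltr_pM2r ?normc_gt0 //; apply: le_lt_trans xd.
rewrite mulrC ler_wpM2l ?normc_ge0 //; apply: le_trans (ler_norm _) _.
by rewrite lerDl.
Qed.

(** The estimate is uniform in both points, not only at the base point [w0]; the compactness
    argument on circles relies on this. *)
Lemma analytic_C1 g w0 : analytic_at g w0 ->
  exists (e K : R), 0 < e /\
   (forall w, normc (w - w0) < e -> derivable g w 1) /\
   forall x y, normc (x - w0) < e -> normc (y - w0) < e ->
     normc (g y - g x - (y - x) * g^`()%classic x) <= K * normc (y - x) ^+ 2.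
Proof.
move=> /analytic_quadratic [d [D [rho [K [rho0 Dcvg Q]]]]].
have Q' x y : normc (x - w0) < rho -> normc (y - w0) < rho ->
    normc (g y - g x - (y - x) * D (x - w0)) <= K * normc (y - x) ^+ 2.
  move=> /ltW xr /ltW yr; have := Q _ _ xr yr.
  by rewrite ![w0 + _]addrC !subrK opprB addrA subrK.
have DE w : normc (w - w0) < rho -> derivable g w 1 /\ g^`()%classic w = D (w - w0).
  move=> wr; apply: (@quadratic_derive1 _ _ _ K (rho - normc (w - w0))).
    by rewrite subr_gt0.
  move=> y; rewrite ltrBrDr => yr; apply: Q' => //; apply: le_lt_trans yr.
  by rewrite -[y in leLHS](subrK w) -addrA; exact: normcD.
exists rho, K; split => //; split; first by move=> w /DE [].
by move=> x y xr yr; have [_ ->] := DE _ xr; exact: Q'.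
Qed.

(** The quadratic estimate holds at every base point of a disc, so the sum [D] of the termwise
    derivative is the derivative on a whole neighborhood. *)
Lemma analytic_derive1 g w0 : analytic_at g w0 -> analytic_at g^`()%classic w0.
Proof.
move=> /analytic_quadratic [d [D [rho [K [rho0 Dcvg Q]]]]].
apply/analytic_atP; exists d, rho; split => // x xr.
suff -> : g^`()%classic (w0 + x) = D x by apply: Dcvg; exact: ltW.
suff [_ ->] : derivable g (w0 + x) 1 /\ g^`()%classic (w0 + x) = D x by [].
apply: (@quadratic_derive1 _ _ _ K (rho - normc x)); first by rewrite subr_gt0.
move=> y; rewrite ltrBrDr => yr.
have ywr : normc (y - w0) <= rho.
  have -> : y - w0 = (y - (w0 + x)) + x by ring.
  exact: le_trans (normcD _ _) (ltW yr).
have := Q x (y - w0) (ltW xr) ywr.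
by rewrite [w0 + (_ - _)]addrC subrK opprD addrA.
Qed.

End Derivative.

(* Keeps unification from unfolding these when it compares two functions. *)
#[local] Opaque analytic_at derive1.

(** * Complex differentiation *)

Section Holomorphic.
Variable R : realType.
Implicit Types (x y w a : R[i]) (g h : R[i] -> R[i]) (O : set R[i]).

(* A quadratic error suffices for analytic functions, and makes the rules of
   differentiation plain estimates. *)
Definition tangent g w (l : R[i]) : Prop := exists K : R,
  \forall y \near w, normc (g y - g w - (y - w) * l) <= K * normc (y - w) ^+ 2.

Lemma tangent_derive1 g w l : tangent g w l -> g^`()%classic w = l.
Proof.
move=> [K /nbhs_normcP [e e0 H]].
by have [] := @quadratic_derive1 R g w l K e e0 H.
Qed.

Lemma analytic_tangent g w : analytic_at g w -> tangent g w (g^`()%classic w).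
Proof.
move=> /analytic_C1 [e [K [e0 [_ H]]]]; exists K; apply/nbhs_normcP.
by exists e => // y ye; apply: H => //; rewrite subrr normc0.
Qed.

Lemma tangent_near_eq g h w l :
  (\forall y \near w, g y = h y) -> tangent g w l -> tangent h w l.
Proof.
move=> gh [K H]; exists K; have ghw := nbhs_singleton gh; near=> y.
rewrite -ghw; have <- : g y = h y by near: y.
by near: y; exact: H.
Unshelve. all: by end_near.
Qed.

Lemma tangentD g h w l m :
  tangent g w l -> tangent h w m -> tangent (fun y => g y + h y) w (l + m).
Proof.
move=> [K HK] [M HM]; exists (K + M); near=> y.
have -> : g y + h y - (g w + h w) - (y - w) * (l + m) =
   (g y - g w - (y - w) * l) + (h y - h w - (y - w) * m) by ring.
rewrite [leRHS]mulrDl; apply: le_trans (normcD _ _) _; apply: lerD; near: y.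
  exact: HK.
exact: HM.
Unshelve. all: by end_near.
Qed.

Lemma tangentZ c g w l :
  tangent g w l -> tangent (fun y => c * g y) w (c * l).
Proof.
move=> [K HK]; exists (normc c * K); near=> y.
have -> : c * g y - c * g w - (y - w) * (c * l) = c * (g y - g w - (y - w) * l) by ring.
rewrite normcM -mulrA ler_wpM2l ?normc_ge0 //; near: y; exact: HK.
Unshelve. all: by end_near.
Qed.

Lemma tangent_affine a x g w l :
  tangent g (a + x * w) l -> tangent (fun y => g (a + x * y)) w (x * l).
Proof.
move=> [K /nbhs_normcP [e e0 H]]; exists (K * normc x ^+ 2); apply/nbhs_normcP.
have x1 : 0 < normc x + 1 by rewrite ltr_wpDl ?normc_ge0.
exists (e / (normc x + 1)); first by rewrite divr_gt0.
move=> y; rewrite ltr_pdivlMr // => ye.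
have E : a + x * y - (a + x * w) = x * (y - w) by ring.
have := H (a + x * y); rewrite E normcM exprMn mulrA mulrA [x * (y - w)]mulrC.
rewrite -[(y - w) * x * l]mulrA; apply; apply: le_lt_trans ye.
by rewrite mulrC ler_wpM2l ?normc_ge0 // lerDl.
Qed.

Lemma tangent_mulXsub a g w l :
  tangent g w l -> tangent (fun y => (y - a) * g y) w (g w + (w - a) * l).
Proof.
move=> [K HK]; exists (normc (w - a) * K + (normc l + `|K|)); near=> y.
have H : normc (g y - g w - (y - w) * l) <= K * normc (y - w) ^+ 2.
  by near: y; exact: HK.
(* Within distance 1 the cubic error [(y - w) * (g y - ...)] is absorbed by the quadratic one. *)
have yw1 : normc (y - w) <= 1.
  by near: y; apply/nbhs_normcP; exists 1 => // y /ltW.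
have -> : (y - a) * g y - (w - a) * g w - (y - w) * (g w + (w - a) * l) =
  (w - a) * (g y - g w - (y - w) * l) +
  ((y - w) ^+ 2 * l + (y - w) * (g y - g w - (y - w) * l)) by ring.
rewrite ![leRHS]mulrDl; apply: le_trans (normcD _ _) _; apply: lerD.
  by rewrite normcM -mulrA ler_wpM2l ?normc_ge0.
rewrite [leRHS]mulrDl; apply: le_trans (normcD _ _) _.
apply: lerD; first by rewrite normcM normcX mulrC.
rewrite normcM -[leRHS]mul1r; apply: ler_pM; rewrite ?normc_ge0 //.
by apply: le_trans H _; rewrite ler_wpM2r ?exprn_ge0 ?normc_ge0 // ler_norm.
Unshelve. all: by end_near.
Qed.

Lemma analytic_continuous g w : analytic_at g w -> {for w, continuous g}.
Proof.
move=> /analytic_C1 [e [K [e0 [dg _]]]].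
apply: differentiable_continuous; apply/derivable1_diffP.
by apply: dg; rewrite subrr normc0.
Qed.

Definition holo O g : Prop := forall w, O w -> analytic_at g w.

Lemma holo_derive1n O g i : holo O g -> holo O (derive1n i g).
Proof.
elim: i g => [|i IH] g Hg w Ow; first exact: (Hg w Ow).
rewrite derive1Sn.
by apply: IH Ow => v Ov; exact/analytic_derive1/Hg.
Qed.

Lemma holo_near O w : open O -> O w -> \forall y \near w, O y.
Proof. by move=> oO Ow; apply: open_nbhs_nbhs. Qed.

(** Differentiation is local, so the induction carries the equality on all of the open set; equality
    at one point would not survive a derivative. *)
Lemma derive1n_eq O g h i : open O -> holo O g ->
  (forall w, O w -> g w = h w) ->
  forall w, O w -> derive1n i h w = derive1n i g w.
Proof.
move=> oO; elim: i g h => [|i IH] g h Hg gh w Ow; first exact/esym/gh.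
rewrite !derive1Sn; apply: (IH g^`()%classic _ _ _ w Ow).
  exact: (@holo_derive1n O _ 1).
move=> v Ov; symmetry; apply: tangent_derive1.
apply: (@tangent_near_eq g); last by apply: analytic_tangent; exact: Hg.
by apply: filterS (holo_near oO Ov) => y; exact: gh.
Qed.

Lemma derive1nD O g h i w : open O -> holo O g -> holo O h -> O w ->
  derive1n i (fun y => g y + h y) w = derive1n i g w + derive1n i h w.
Proof.
move=> oO; elim: i g h => [|i IH] g h Hg Hh Ow; first by [].
rewrite !derive1Sn -IH; [|exact: (@holo_derive1n O _ 1)..|by []].
apply: (@derive1n_eq O _ _ i oO _ _ w Ow) => v Ov.
  by apply: analyticD; exact: (@holo_derive1n O _ 1).
symmetry; apply/tangent_derive1/tangentD; apply/analytic_tangent; [exact: Hg|exact: Hh].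
Qed.

Lemma derive1nZ O c g i w : open O -> holo O g -> O w ->
  derive1n i (fun y => c * g y) w = c * derive1n i g w.
Proof.
move=> oO; elim: i g => [|i IH] g Hg Ow; first by [].
rewrite !derive1Sn -IH; [|exact: (@holo_derive1n O _ 1)..|by []].
apply: (@derive1n_eq O _ _ i oO _ _ w Ow) => v Ov.
  by apply: analyticZ; exact: (@holo_derive1n O _ 1).
symmetry; apply/tangent_derive1/tangentZ; apply/analytic_tangent; exact: Hg.
Qed.

Lemma open_affine_preimage O a x : open O -> open [set w | O (a + x * w)].
Proof.
move=> oO; rewrite openE => w Ow; have /nbhs_normcP [e e0 H] := holo_near oO Ow.
apply/nbhs_normcP; have x1 : 0 < normc x + 1 by rewrite ltr_wpDl ?normc_ge0.
exists (e / (normc x + 1)); first by rewrite divr_gt0.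
move=> y; rewrite ltr_pdivlMr // => ye; apply: H.
have -> : a + x * y - (a + x * w) = x * (y - w) by ring.
apply: le_lt_trans ye; rewrite normcM mulrC ler_wpM2l ?normc_ge0 //.
by rewrite lerDl.
Qed.

Lemma derive1n_affine O a x g i w : open O -> holo O g -> O (a + x * w) ->
  derive1n i (fun y => g (a + x * y)) w = x ^+ i * derive1n i g (a + x * w).
Proof.
move=> oO; elim: i g => [|i IH] g Hg Ow; first by rewrite expr0 mul1r.
have oO' := @open_affine_preimage O a x oO.
have Hg' : holo O g^`()%classic by exact: (@holo_derive1n O _ 1).
rewrite !derive1Sn exprS -mulrA -(IH _ Hg' Ow).
rewrite -(@derive1nZ [set w | O (a + x * w)] _ _ _ _ oO' _ Ow); last first.
  by move=> v Ov; apply: analytic_affine; exact: Hg'.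
apply: (@derive1n_eq [set w | O (a + x * w)] _ _ i oO' _ _ w Ow) => v Ov.
  by apply: analyticZ; apply: analytic_affine; exact: Hg'.
symmetry; apply/tangent_derive1/tangent_affine; apply/analytic_tangent; exact: Hg.
Qed.

(** Leibniz's rule stops after two terms because the second derivative of the linear factor is
    zero. *)
Lemma derive1n_mulXsub O a g i w : open O -> holo O g -> O w ->
  derive1n i.+1 (fun y => (y - a) * g y) w =
    i.+1%:R * derive1n i g w + (w - a) * derive1n i.+1 g w.
Proof.
move=> oO; elim: i g => [|i IH] g Hg Ow.
  rewrite mul1r; apply/tangent_derive1/tangent_mulXsub/analytic_tangent; exact: Hg.
have Hg' : holo O g^`()%classic by exact: (@holo_derive1n O _ 1).
rewrite derive1Sn.
rewrite (@derive1n_eq O (fun y => g y + (y - a) * g^`()%classic y) _ i.+1 oO _ _ w Ow).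
- rewrite (@derive1nD O _ _ _ _ oO Hg _ Ow); last first.
    by move=> v Ov; apply: analytic_mulXsub; exact: Hg'.
  rewrite (IH _ Hg' Ow) -!derive1Sn addrA; congr (_ + _).
  by rewrite -[in RHS]natr1 mulrDl mul1r addrC.
- by move=> v Ov; apply: analyticD; [exact: Hg|apply: analytic_mulXsub; exact: Hg'].
- move=> v Ov; symmetry; apply/tangent_derive1/tangent_mulXsub/analytic_tangent.
  exact: Hg.
Qed.

(* With the value [g'(a)] at [w = a], the identity [ddE] holds everywhere and
   [dd a g] is analytic wherever [g] is. *)
Definition dd a g : R[i] -> R[i] := fun w =>
  if w == a then g^`()%classic a else (g w - g a) / (w - a).

Lemma ddE a g w : g w = g a + (w - a) * dd a g w.
Proof.
rewrite /dd; have [->|wa] := eqVneq w a; first by rewrite subrr mul0r addr0.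
by rewrite mulrC divfK ?subr_eq0 // addrC subrK.
Qed.

(** Away from [a] this is a quotient. At [a] the shifted coefficients of [g] give an analytic [q]
    agreeing with the quotient elsewhere, and continuity of [q] identifies its value [c 1] with the
    derivative of [g]. *)
Lemma analytic_dd a g w : analytic_at g a -> analytic_at g w -> analytic_at (dd a g) w.
Proof.
move=> Ha Hw; have [E|wa] := eqVneq w a; last first.
  apply: (@analytic_near_eq _ (fun y => (g y - g a) / (y - a))); last first.
    exact: (analytic_divXsub wa (analyticB Hw (analytic_cst (g a) w))).
  apply/nbhs_normcP; exists (normc (w - a)); first by rewrite normc_gt0 subr_eq0.
  move=> y; rewrite /dd; have [->|//] := eqVneq y a.
  by rewrite normc_distC ltxx.
rewrite {w Hw}E.
move: Ha => /analytic_atP [c [e [e0 H]]].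
have c0 : c 0 = g a.
  have := H 0; rewrite normc0 addr0 => /(_ e0) H0.
  have Hc : psum c 0 @ \oo --> c 0; last exact: (cvg_unique _ Hc H0).
  apply: (cvg_seqS (u := fun=> c 0)); last exact: cvg_cst.
  by move=> n; rewrite psumS mul0r addr0.
have dE x : normc x < e -> x != 0 ->
    psum (fun k => c k.+1) x @ \oo --> (g (a + x) - g a) / x.
  move=> xe x0; have HS : (fun n => psum c x n.+1) @ \oo --> g (a + x).
    by rewrite cvg_shiftS; exact: H.
  have K := cvg_mulc (cvg_subc HS (cvg_cst (g a))) (cvg_cst x^-1).
  rewrite (_ : psum _ x = fun n => (psum c x n.+1 - g a) / x); first exact: (K _ _ _).
  by apply/funext => n; rewrite psumS c0 addrC addKr mulrAC divff // mul1r.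
pose q w := if w == a then c 1 else (g w - g a) / (w - a).
have qa : analytic_at q a.
  apply/analytic_atP; exists (fun k => c k.+1), e; split=> [//|x xe].
  rewrite /q; have [->|x0] := eqVneq x 0.
    rewrite addr0 eqxx; apply: (cvg_seqS (u := fun=> c 1)); last exact: cvg_cst.
    by move=> n; rewrite psumS mul0r addr0.
  by rewrite -subr_eq0 [a + x]addrC addrK (negPf x0) [x + a]addrC; exact: dE.
suff dq : g^`()%classic a = c 1 by rewrite /dd dq.
suff [] : derivable g a 1 /\ g^`()%classic a = c 1 by [].
apply: derive1_cvgP; apply/cvg_normcP => d d0.
have /cvg_normcP/(_ _ d0)/nbhs_normcP [r r0 Hr] := analytic_continuous qa.
rewrite /dnbhs /within /=; apply/nbhs_normcP; exists r => // x; rewrite subr0 => xr x0.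
have := Hr (x + a); rewrite /= addrK => /(_ xr).
rewrite /q eqxx -subr_eq0 addrK.
by case: eqP x0 => // ->; rewrite eqxx.
Qed.

End Holomorphic.

(** * Integrals along circles *)

Section PathDerivative.
Variable R : realType.
Implicit Types (F : R -> R[i]) (t : R) (m : R[i]).

(** [R[i]] is normed over itself here, so differentiation along a real parameter is encoded by an
    explicit quotient. *)
Definition path_derive F t m : Prop :=
  (fun h : R => (F (h + t) - F t) / h%:C) @ 0^' --> m.

Lemma divc_real (a b h : R) : (a +i* b) / h%:C = (h^-1 * a) +i* (h^-1 * b).
Proof. by rewrite -fmorphV; apply/eqP; rewrite eq_complex /= !mulr0 subr0 add0r mulrC eqxx mulrC eqxx. Qed.

Lemma is_derive_quotient (f : R -> R) t c :
  is_derive t 1 f c <-> (fun h : R => h^-1 * (f (h + t) - f t)) @ 0^' --> c.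
Proof.
have E : (fun h : R => h^-1 * (f (h + t) - f t)) =
    (fun h : R => h^-1 *: ((f \o shift t) (h *: 1) - f t)).
  by apply/funext => h /=; rewrite [h *: 1]mulr1.
rewrite E; split=> [[df dE]|H].
  by rewrite -dE; exact: df.
split; first exact: (cvgP _ H).
exact: (cvg_lim _ H).
Qed.

Lemma path_derive_complex (x y : R -> R) t (a b : R) :
  is_derive t 1 x a -> is_derive t 1 y b ->
  path_derive (fun s => x s +i* y s) t (a +i* b).
Proof.
move=> /is_derive_quotient xa /is_derive_quotient yb; rewrite /path_derive.
suff -> : (fun h : R => ((x (h + t) +i* y (h + t)) - (x t +i* y t)) / h%:C) =
  (fun h : R => (h^-1 * (x (h + t) - x t)) +i* (h^-1 * (y (h + t) - y t))).
  exact: (cvg_complex xa yb).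
by apply/funext => h; rewrite -divc_real.
Qed.

Lemma path_derive_Re F t m :
  path_derive F t m -> is_derive t 1 (fun s => complex.Re (F s)) (complex.Re m).
Proof.
move=> H; apply/is_derive_quotient.
suff -> : (fun h : R => h^-1 * (complex.Re (F (h + t)) - complex.Re (F t))) =
  (fun h : R => complex.Re ((F (h + t) - F t) / h%:C)) by exact: (cvg_Re H).
by apply/funext => h; case: (F (h + t)) (F t) => a b [c d]; rewrite divc_real.
Qed.

Lemma path_derive_Im F t m :
  path_derive F t m -> is_derive t 1 (fun s => complex.Im (F s)) (complex.Im m).
Proof.
move=> H; apply/is_derive_quotient.
suff -> : (fun h : R => h^-1 * (complex.Im (F (h + t)) - complex.Im (F t))) =
  (fun h : R => complex.Im ((F (h + t) - F t) / h%:C)) by exact: (cvg_Im H).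
by apply/funext => h; case: (F (h + t)) (F t) => a b [c d]; rewrite divc_real.
Qed.

Lemma path_derive_continuous F t m : path_derive F t m -> {for t, continuous F}.
Proof.
move=> H.
have cR : {for t, continuous (fun s => complex.Re (F s))}.
  apply: differentiable_continuous; apply/derivable1_diffP.
  by have [] := path_derive_Re H.
have cI : {for t, continuous (fun s => complex.Im (F s))}.
  apply: differentiable_continuous; apply/derivable1_diffP.
  by have [] := path_derive_Im H.
have E : F = (fun s => complex.Re (F s) +i* complex.Im (F s)).
  by apply/funext => s; case: (F s).
by rewrite E; exact: (cvg_complex cR cI).
Qed.

(** Caratheodory's form of the chain rule: [k w - k (F t) = (w - F t) * q w] with [q] continuous at
    [F t], which avoids dividing by an increment of [F] that may vanish. *)
Lemma path_derive_comp F t m (k : R[i] -> R[i]) l :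
  path_derive F t m -> tangent k (F t) l -> path_derive (fun s => k (F s)) t (m * l).
Proof.
move=> HF [K /nbhs_normcP [e e0 Hk]].
pose q w := if w == F t then l else (k w - k (F t)) / (w - F t).
have qE w : k w - k (F t) = (w - F t) * q w.
  rewrite /q; have [->|wF] := eqVneq w (F t); first by rewrite !subrr mul0r.
  by rewrite mulrC divfK // subr_eq0.
have qc : q @ (F t) --> l.
  apply/(@cvg_normcP R _ (nbhs (F t)) _ q l) => d d0; apply/nbhs_normcP.
  have K1 : 0 < `|K| + 1 by rewrite ltr_wpDl.
  exists (Num.min e (d / (`|K| + 1))); first by rewrite lt_min e0 divr_gt0.
  move=> w; rewrite lt_min => /andP[we]; rewrite ltr_pdivlMr // => wd.
  rewrite /q; have [_|wF] := eqVneq w (F t); first by rewrite subrr normc0.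
  have wF0 : w - F t != 0 by rewrite subr_eq0.
  have -> : (k w - k (F t)) / (w - F t) - l =
     (k w - k (F t) - (w - F t) * l) / (w - F t).
    by rewrite [RHS]mulrBl [_ * l]mulrC mulfK.
  rewrite normcM normcV ltr_pdivrMr ?normc_gt0 //; apply: le_lt_trans (Hk _ we) _.
  rewrite expr2 mulrA ltr_pM2r ?normc_gt0 //; apply: le_lt_trans wd.
  rewrite mulrC ler_wpM2l ?normc_ge0 //; apply: le_trans (ler_norm _) _.
  by rewrite lerDl.
have Fh : (fun h : R => F (h + t)) @ 0^' --> F t.
  have Fc := path_derive_continuous HF.
  have shift0 : (fun h : R => h + t) @ 0^' --> t.
    apply: cvg_within_filter.
    have : (fun h : R => h + t) @ (0 : R) --> 0 + t.
      by apply: cvgD; [exact: cvg_id|exact: cvg_cst].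
    by rewrite add0r.
  exact: (cvg_comp _ _ shift0 Fc).
have qFh : (fun h : R => q (F (h + t))) @ 0^' --> l := cvg_comp _ _ Fh qc.
rewrite /path_derive.
suff -> : (fun h : R => (k (F (h + t)) - k (F t)) / h%:C) =
  (fun h : R => (F (h + t) - F t) / h%:C * q (F (h + t))).
  exact: (cvg_mulc HF qFh).
by apply/funext => h; rewrite qE mulrAC.
Qed.

End PathDerivative.

Section ComplexIntegral.
Variables (R : realType) (a b : R).
Hypothesis ab : a < b.
Implicit Types (F G : R -> R[i]) (t : R) (m : R[i]).
Local Notation mu := (@lebesgue_measure R).

Lemma continuous_itv_integrable (f : R -> R) : continuous f ->
  mu.-integrable `[a, b] (EFin \o f).
Proof.
move=> cf; apply: continuous_compact_integrable; first exact: segment_compact.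
exact: continuous_subspaceT.
Qed.

Lemma continuous_Re F : continuous F -> continuous (fun t => complex.Re (F t)).
Proof. by move=> cF t; exact: (cvg_Re (cF t)). Qed.

Lemma continuous_Im F : continuous F -> continuous (fun t => complex.Im (F t)).
Proof. by move=> cF t; exact: (cvg_Im (cF t)). Qed.

Lemma complex_integralD F G : continuous F -> continuous G ->
  complex_integral a b (fun t => F t + G t) = complex_integral a b F + complex_integral a b G.
Proof.
move=> cF cG; rewrite /complex_integral.
have -> : (fun t => complex.Re (F t + G t)) = (fun t => complex.Re (F t) + complex.Re (G t)).
  by apply/funext => t; case: (F t) (G t) => ? ? [].
have -> : (fun t => complex.Im (F t + G t)) = (fun t => complex.Im (F t) + complex.Im (G t)).
  by apply/funext => t; case: (F t) (G t) => ? ? [].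
rewrite RintegralD ?RintegralD //; apply: continuous_itv_integrable;
  by [exact: continuous_Re|exact: continuous_Im].
Qed.

Lemma complex_integralZ m F : continuous F ->
  complex_integral a b (fun t => m * F t) = m * complex_integral a b F.
Proof.
move=> cF; rewrite /complex_integral.
have iR := continuous_itv_integrable (continuous_Re cF).
have iI := continuous_itv_integrable (continuous_Im cF).
case: m => c d.
have -> : (fun t => complex.Re ((c +i* d) * F t)) =
    (fun t => c * complex.Re (F t) + (- d) * complex.Im (F t)).
  by apply/funext => t; case: (F t) => ? ? /=; rewrite mulNr.
have -> : (fun t => complex.Im ((c +i* d) * F t)) =
    (fun t => c * complex.Im (F t) + d * complex.Re (F t)).
  by apply/funext => t; case: (F t) => ? ?.
have iZ (f : R -> R) r : continuous f -> mu.-integrable `[a, b] (EFin \o (fun t => r * f t)).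
  move=> cf; apply: continuous_itv_integrable => t.
  by apply: cvgM; [exact: cvg_cst|exact: cf].
have cR := continuous_Re cF; have cI := continuous_Im cF.
rewrite !RintegralD //; try exact: iZ.
rewrite !RintegralZl //.
by rewrite mulNr.
Qed.

Lemma complex_integralB F G : continuous F -> continuous G ->
  complex_integral a b (fun t => F t - G t) = complex_integral a b F - complex_integral a b G.
Proof.
move=> cF cG; rewrite -[in RHS]mulN1r -(complex_integralZ (-1) cG).
have cNG : continuous (fun t => -1 * G t) by move=> t; exact: (cvg_mulcl (-1) (cG t)).
rewrite -(complex_integralD cF cNG).
by congr complex_integral; apply/funext => t; rewrite mulN1r.
Qed.

Lemma complex_integral_conj F :  continuous F ->
  complex_integral a b (fun t => (F t)^*) = (complex_integral a b F)^*.
Proof.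
move=> cF; rewrite /complex_integral /=; congr (_ +i* _).
  by congr Rintegral; apply/funext => t; case: (F t).
have -> : (fun t => complex.Im (F t)^*) = (fun t => (-1) * complex.Im (F t)).
  by apply/funext => t; case: (F t) => ? ? /=; rewrite mulN1r.
rewrite RintegralZl ?mulN1r //.
exact/continuous_itv_integrable/continuous_Im.
Qed.

Lemma Rintegral_itv_cst (c : R) : \int[mu]_(t in `[a, b]) c = c * (b - a).
Proof.
rewrite Rintegral_cst //= lebesgue_measure_itv /= lte_fin ab.
by rewrite -EFinB.
Qed.

Lemma complex_integral_cst m : complex_integral a b (fun=> m) = m * (b - a)%:C.
Proof.
by rewrite /complex_integral !Rintegral_itv_cst; case: m => c d; simpc; rewrite /= mulrC.
Qed.

(** The factor 2 comes from bounding real and imaginary parts separately. It is harmless, since the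
    bound only has to show that an error is quadratic. *)
Lemma complex_integral_le F (B : R) : continuous F ->
  (forall t, t \in `[a, b] -> normc (F t) <= B) ->
  normc (complex_integral a b F) <= 2 * (B * (b - a)).
Proof.
move=> cF FB; apply: le_trans (normc_ReIm _) _.
have H (f : R -> R) : continuous f -> (forall t, t \in `[a, b] -> `|f t| <= B) ->
    `|\int[mu]_(t in `[a, b]) f t| <= B * (b - a).
  move=> cf fB; have fi := continuous_itv_integrable cf.
  apply: le_trans (le_normr_Rintegral _ fi) _ => //.
  rewrite -Rintegral_itv_cst; apply: le_Rintegral => //.
  - by apply: continuous_itv_integrable => t; apply: cvg_norm; exact: cf.
  - by apply: continuous_itv_integrable => t; exact: cvg_cst.
rewrite mulr_natl mulr2n; apply: lerD; apply: H.
- exact: continuous_Re.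
- by move=> t /FB; apply: le_trans; exact: normc_Re.
- exact: continuous_Im.
- by move=> t /FB; apply: le_trans; exact: normc_Im.
Qed.

Lemma complex_integral_FTC F G : continuous F -> (forall t, path_derive G t (F t)) ->
  complex_integral a b F = G b - G a.
Proof.
move=> cF dG.
have H (f g : R -> R) : continuous f -> (forall t, is_derive t 1 g (f t)) ->
    \int[mu]_(t in `[a, b]) f t = g b - g a.
  move=> cf dg.
  have cg : continuous g.
    move=> t; apply: differentiable_continuous; apply/derivable1_diffP.
    by have [] := dg t.
  rewrite /Rintegral (@continuous_FTC2 _ f g a b ab) //.
  - exact: continuous_subspaceT.
  - split.
    + by move=> t _; have [] := dg t.
    + exact: cvg_at_right_filter (cg a).
    + exact: cvg_at_left_filter (cg b).
  - by move=> t _; rewrite derive1E; have [_ ->] := dg t.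
rewrite /complex_integral.
have -> := H _ (fun s => complex.Re (G s)) (continuous_Re cF)
             (fun t => path_derive_Re (dG t)).
have -> := H _ (fun s => complex.Im (G s)) (continuous_Im cF)
             (fun t => path_derive_Im (dG t)).
by case: (G b) (G a) => ? ? [].
Qed.

End ComplexIntegral.

(** * The mean value property on circles *)

Section MeanValue.
Variable R : realType.
Implicit Types (k : R[i] -> R[i]) (c w : R[i]) (s t : R).

Definition cis t : R[i] := cos t +i* sin t.
Definition circ c s t : R[i] := c + (s * cos t) +i* (s * sin t).

Lemma circE c s t : circ c s t = c + s%:C * cis t.
Proof. by rewrite /circ /cis; simpc. Qed.

Lemma normc_cis t : normc (cis t) = 1.
Proof. by rewrite /= cos2Dsin2 sqrtr1. Qed.

Lemma circ_dist c s t : normc (circ c s t - c) = `|s|.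
Proof. by rewrite circE addrC addKr normcM normc_cis mulr1 normc_real. Qed.

Lemma circ_period c s : circ c s (2 * pi) = circ c s 0.
Proof. by rewrite /circ mulr_natl cos2pi sin2pi cos0 sin0. Qed.

Lemma circ_path_derive c s t :
  path_derive (circ c s) t ((- (s * sin t)) +i* (s * cos t)).
Proof.
have -> : circ c s = (fun t => (complex.Re c + s * cos t) +i* (complex.Im c + s * sin t)).
  by apply/funext => u; rewrite /circ; case: (c).
apply: path_derive_complex.
  by apply: is_derive_eq; rewrite /= add0r mul1r -[RHS]mulrN.
by apply: is_derive_eq; rewrite /= add0r mul1r.
Qed.

Lemma circ_velocity s t :
  (- (s * sin t)) +i* (s * cos t) = (0 +i* s) * cis t :> R[i].
Proof. by rewrite /cis; simpc. Qed.

Lemma circ_continuous c s : continuous (circ c s).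
Proof. move=> t; exact: (path_derive_continuous (@circ_path_derive c s t)). Qed.

Lemma cis_continuous : continuous cis.
Proof. by move=> t; apply: cvg_complex; [exact: continuous_cos|exact: continuous_sin]. Qed.

Lemma continuous_circ_comp k c s :
  (forall w, normc (w - c) = `|s| -> {for w, continuous k}) ->
  continuous (fun t => k (circ c s t)).
Proof.
move=> ck t; have kt := ck _ (circ_dist c s t).
exact: (cvg_comp _ _ (@circ_continuous c s t) kt).
Qed.

Lemma pi2_gt0 : 0 < 2 * pi :> R.
Proof. by rewrite mulr_gt0 // pi_gt0. Qed.

Lemma integral_cis : complex_integral 0 (2 * pi) cis = 0.
Proof.
rewrite (complex_integral_FTC pi2_gt0 (G := fun t => sin t +i* (- cos t)) cis_continuous).
  by rewrite mulr_natl cos2pi sin2pi cos0 sin0 subrr.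
move=> t; rewrite -[cis t]/(cos t +i* sin t).
by apply: path_derive_complex; apply: is_derive_eq; rewrite opprK.
Qed.

(** For [s != 0] the integrand times [i s] is the derivative of the periodic function
    [t |-> k (circ c s t)]; for [s = 0] it is a constant times [cis]. *)
Lemma circle_mean_derivative k c s :
  (forall w, normc (w - c) = `|s| -> analytic_at k w) ->
  complex_integral 0 (2 * pi) (fun t => cis t * k^`()%classic (circ c s t)) = 0.
Proof.
move=> ka.
have ck' : continuous (fun t => k^`()%classic (circ c s t)).
  by apply: continuous_circ_comp => w /ka kw; exact/analytic_continuous/analytic_derive1.
have cF : continuous (fun t => cis t * k^`()%classic (circ c s t)).
  by move=> t; exact: (cvg_mulc (@cis_continuous t) (ck' t)).
have [s0|s0] := eqVneq s 0.
  have -> : (fun t => cis t * k^`()%classic (circ c s t)) = (fun t => k^`()%classic c * cis t).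
    by apply/funext => t; rewrite s0 circE mul0r addr0 mulrC.
  by rewrite (complex_integralZ 0 (2 * pi) _ cis_continuous) integral_cis mulr0.
have si0 : 0 +i* s != 0 :> R[i] by rewrite eq_complex /= (negPf s0) andbF.
apply: (mulfI si0); rewrite mulr0 -(complex_integralZ 0 (2 * pi) _ cF).
have cF' : continuous (fun t => (0 +i* s) * (cis t * k^`()%classic (circ c s t))).
  by move=> t; exact: (cvg_mulcl _ (cF t)).
rewrite (complex_integral_FTC pi2_gt0 (G := fun t => k (circ c s t)) cF').
  by rewrite circ_period subrr.
move=> t; rewrite mulrA -circ_velocity.
apply: (path_derive_comp (@circ_path_derive c s t)).
exact/analytic_tangent/ka/circ_dist.
Qed.

(* Compactness of the circle makes the local quadratic estimates uniform. *)
Lemma circle_quadratic k c s0 :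
  (forall w, normc (w - c) = `|s0| -> analytic_at k w) ->
  exists C : R, \forall s \near s0, forall t, t \in `[0, 2 * pi] ->
    normc (k (circ c s t) - k (circ c s0 t) -
           (s - s0)%:C * (cis t * k^`()%classic (circ c s0 t))) <= C * (s - s0) ^+ 2.
Proof.
move=> ka.
pose P (i : R * R) t := normc (k (circ c i.1 t) - k (circ c s0 t) -
   (i.1 - s0)%:C * (cis t * k^`()%classic (circ c s0 t))) <= i.2 * (i.1 - s0) ^+ 2.
(* The constant is a second parameter tending to infinity, so one application of compactness makes
   both it and the neighborhood of [s0] uniform in [t]. Locally, half of [e] is spent on moving [t]
   and half on moving [s]. *)
have cover : \forall i \near (filter_prod (nbhs s0) (pinfty_nbhs R)), `[0, 2 * pi] `<=` P i.
  have /compact_near_coveringP := @segment_compact R 0 (2 * pi); apply.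
  move=> t0 _; have [e [K [e0 [_ H]]]] := analytic_C1 (ka _ (circ_dist c s0 t0)).
  have e20 : 0 < e / 2 by rewrite divr_gt0.
  have e_nbhs : nbhs (circ c s0 t0) [set x | normc (x - circ c s0 t0) < e / 2].
    by apply/nbhs_normcP; exists (e / 2).
  exists ([set t | normc (circ c s0 t - circ c s0 t0) < e / 2],
          [set i : R * R | `|i.1 - s0| < e / 2 /\ K < i.2]).
    split; first exact: (@circ_continuous c s0 t0 _ e_nbhs).
    exists ([set s | `|s - s0| < e / 2], [set C | K < C]); last by move=> [? ?] [].
    split=> /=; last by exists K; rewrite num_real.
    by apply/nbhs_ballP; exists (e / 2); [exact: e20|move=> s; rewrite /ball /= distrC].
  move=> [t [s C]] /= [te [se KC]].
  have stE : circ c s t - circ c s0 t = (s - s0)%:C * cis t.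
    by rewrite !circE rmorphB /=; ring.
  have ste : normc (circ c s t - circ c s0 t0) < e.
    have -> : circ c s t - circ c s0 t0 =
      (s - s0)%:C * cis t + (circ c s0 t - circ c s0 t0) by rewrite -stE; ring.
    apply: le_lt_trans (normcD _ _) _.
    by rewrite normcM normc_cis mulr1 normc_real [e]splitr ltrD.
  have te' : normc (circ c s0 t - circ c s0 t0) < e by apply: lt_trans te _; lra.
  have := H _ _ te' ste.
  rewrite stE normcM normc_cis mulr1 normc_real real_normK ?num_real // -mulrA.
  by move/le_trans; apply; rewrite ler_wpM2r ?sqr_ge0 // ltW.
have [[U V] [/= Us0 [C [_ CV]]] UV] := cover.
exists (C + 1); apply: filterS Us0 => s sU t tI.
by apply: (UV (s, C + 1)) => //; split => //; apply: CV; rewrite ltrDl.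
Qed.

Lemma quadratic_constant (M : R -> R[i]) :
  (forall s0, exists C : R, \forall s \near s0, normc (M s - M s0) <= C * (s - s0) ^+ 2) ->
  forall x y, M x = M y.
Proof.
move=> H.
have dM t : path_derive M t 0.
  rewrite /path_derive; apply/cvg_normcP => d d0.
  have [C /nbhs_ballP [e /= e0 HC]] := H t.
  have C1 : 0 < `|C| + 1 by rewrite ltr_wpDl.
  rewrite /dnbhs /within /=; apply/nbhs_ballP.
  exists (Num.min e (d / (`|C| + 1))) => /=; first by rewrite lt_min e0 divr_gt0.
  move=> h; rewrite /ball /= sub0r normrN lt_min => /andP[he]; rewrite ltr_pdivlMr // => hd h0.
  have := HC (h + t); rewrite /ball /= opprD addrA addrAC subrr sub0r normrN => /(_ he).
  rewrite addrK subr0 normcM normcV normc_real => B.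
  rewrite ltr_pdivrMr ?normr_gt0 //; apply: le_lt_trans B _.
  rewrite -[h ^+ 2]real_normK ?num_real // expr2 mulrA ltr_pM2r ?normr_gt0 //.
  apply: le_lt_trans hd; rewrite mulrC ler_wpM2l //; apply: le_trans (ler_norm _) _.
  by rewrite lerDl.
move=> x y.
have ER := @is_derive_0_is_cst R _ x y (fun t => path_derive_Re (dM t)).
have EI := @is_derive_0_is_cst R _ x y (fun t => path_derive_Im (dM t)).
by case: (M x) (M y) ER EI => a b [a' b'] /= -> ->.
Qed.

Theorem circle_mean_value k c (rho : R) : 0 <= rho ->
  (forall w, normc (w - c) <= rho -> analytic_at k w) ->
  complex_integral 0 (2 * pi) (fun t => k (circ c rho t)) = (2 * pi)%:C * k c.
Proof.
move=> rho0 ka.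
(* Clamping the radius to [[0, rho]] defines the mean on the whole line, where a zero derivative
   forces constancy. It is 1-Lipschitz, so quadratic errors remain quadratic. *)
pose clamp (s : R) := Num.max 0 (Num.min rho s).
have clamp_rho s : `|clamp s| <= rho.
  by rewrite ger0_norm /clamp ?le_max ?lexx // ge_max rho0 ge_min lexx.
have clamp_dist s s0 : `|clamp s - clamp s0| <= `|s - s0|.
  have d1 := ler_norm (s - s0).
  have d2 : s0 - s <= `|s - s0| by rewrite distrC ler_norm.
  rewrite ler_norml /clamp; move: `|s - s0| d1 d2 => d d1 d2.
  by case: (leP rho s) => ?; case: (leP rho s0) => ?; case: (leP 0 rho) => ?;
    case: (leP 0 s) => ?; case: (leP 0 s0) => ?; apply/andP; split; lra.
have kc s : continuous (fun t => k (circ c (clamp s) t)).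
  apply: continuous_circ_comp => w ws; apply/analytic_continuous/ka.
  by rewrite ws; exact: clamp_rho.
have ka' s w : normc (w - c) = `|clamp s| -> analytic_at k w.
  by move=> ws; apply: ka; rewrite ws; exact: clamp_rho.
pose M s := complex_integral 0 (2 * pi) (fun t => k (circ c (clamp s) t)).
have Mcst : forall x y, M x = M y.
  apply: quadratic_constant => s0.
  have [C /nbhs_ballP [e /= e0 HC]] := circle_quadratic (ka' s0).
  exists (2 * (`|C| * (2 * pi))); apply/nbhs_ballP; exists e => // s se.
  change (normc (M s - M s0) <= 2 * (`|C| * (2 * pi)) * (s - s0) ^+ 2).
  have cse : ball (clamp s0) e (clamp s).
    by rewrite /ball /= distrC; apply: le_lt_trans (clamp_dist _ _) _; rewrite distrC.
  have B := HC _ cse.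
  have ck' : continuous (fun t => k^`()%classic (circ c (clamp s0) t)).
    apply: continuous_circ_comp => w /ka' kw.
    exact/analytic_continuous/analytic_derive1.
  have cF : continuous (fun t => cis t * k^`()%classic (circ c (clamp s0) t)).
    by move=> t; exact: (cvg_mulc (@cis_continuous t) (ck' t)).
  have cF' : continuous (fun t => (clamp s - clamp s0)%:C *
      (cis t * k^`()%classic (circ c (clamp s0) t))).
    by move=> t; exact: (cvg_mulcl _ (cF t)).
  have ckk : continuous (fun t => k (circ c (clamp s) t) - k (circ c (clamp s0) t)).
    by move=> t; exact: (cvg_subc (kc s t) (kc s0 t)).
  have cFF : continuous (fun t => k (circ c (clamp s) t) - k (circ c (clamp s0) t) -
      (clamp s - clamp s0)%:C * (cis t * k^`()%classic (circ c (clamp s0) t))).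
    by move=> t; exact: (cvg_subc (ckk t) (cF' t)).
  (* The linear term has integral zero by [circle_mean_derivative], so it can be subtracted freely;
     what remains is the quadratic error. *)
  have -> : M s - M s0 = complex_integral 0 (2 * pi) (fun t =>
      k (circ c (clamp s) t) - k (circ c (clamp s0) t) -
      (clamp s - clamp s0)%:C * (cis t * k^`()%classic (circ c (clamp s0) t))).
    rewrite (complex_integralB 0 (2 * pi) ckk cF') (complex_integralZ 0 (2 * pi) _ cF).
    rewrite (circle_mean_derivative (ka' s0)) mulr0 subr0.
    by rewrite (complex_integralB 0 (2 * pi) (kc s) (kc s0)).
  apply: le_trans (complex_integral_le pi2_gt0 cFF B) _.
  rewrite subr0 -[leRHS]mulrA ler_pM2l // [leRHS]mulrAC ler_wpM2r //.
    by rewrite ltW // pi2_gt0.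
  apply: le_trans (ler_wpM2r (sqr_ge0 _) (ler_norm C)) _; rewrite ler_wpM2l //.
  rewrite -[(clamp s - clamp s0) ^+ 2]real_normK ?num_real //.
  by rewrite -[(s - s0) ^+ 2]real_normK ?num_real // lerXn2r ?nnegrE.
have := Mcst rho 0; rewrite /M.
have -> : clamp rho = rho by rewrite /clamp minxx; apply/max_idPr.
have -> : clamp 0 = 0 by rewrite /clamp min_r // maxxx.
move=> ->.
have -> : (fun t => k (circ c 0 t)) = fun=> k c.
  by apply/funext => t; rewrite circE mul0r addr0.
by rewrite (complex_integral_cst pi2_gt0) subr0 mulrC.
Qed.

End MeanValue.

(** * Cauchy's theorem and the basic integrals on one circle *)

Section CircleIntegral.
Variable R : realType.
Implicit Types (k h g : R[i] -> R[i]) (c w a : R[i]) (rho s t : R).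

Lemma conjcM (x y : R[i]) : (x * y)^* = x^* * y^*. Proof. exact: rmorphM. Qed.
Lemma conjcB (x y : R[i]) : (x - y)^* = x^* - y^*. Proof. exact: rmorphB. Qed.
Lemma conjcX (x : R[i]) m : (x ^+ m)^* = x^* ^+ m. Proof. exact: rmorphXn. Qed.
Lemma conjcV (x : R[i]) : x^-1^* = x^*^-1. Proof. exact: fmorphV. Qed.

Lemma conjcKK (x : R[i]) : x^*^* = x. Proof. exact: conjcK. Qed.

(** The form [a + c * w] admits [c = 0], which occurs in [circle_integral_pow] when the pole is the
    centre of the circle. *)
Lemma analytic_div_affine g w0 a c : a + c * w0 != 0 ->
  analytic_at g w0 -> analytic_at (fun w => g w / (a + c * w)) w0.
Proof.
move=> ac0 gw; have [c0|c0] := eqVneq c 0.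
  apply: (analytic_eq _ (analyticZ a^-1 gw)) => w.
  by rewrite c0 mul0r addr0 mulrC.
have wE w : a + c * w = c * (w - (- a / c)) by field; exact: c0.
have w0a : w0 != - a / c.
  by apply: contraNN ac0 => /eqP w0E; rewrite wE {1}w0E subrr mulr0.
apply: (analytic_eq _ (analyticZ c^-1 (analytic_divXsub w0a gw))) => w.
by rewrite wE invfM mulrCA mulrA mulrAC mulrC.
Qed.

Lemma analytic_div_affineX g w0 a c m : a + c * w0 != 0 ->
  analytic_at g w0 -> analytic_at (fun w => g w / (a + c * w) ^+ m) w0.
Proof.
move=> ac0; elim: m g => [|m IH] g gw.
  by apply: (analytic_eq _ gw) => w; rewrite expr0 divr1.
apply: (analytic_eq _ (IH _ (analytic_div_affine ac0 gw))) => w.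
by rewrite exprS invfM mulrA.
Qed.

Lemma analytic_horner (q : {poly R[i]}) w : analytic_at (horner q) w.
Proof.
elim/poly_ind: q => [|q c IH].
  by apply: (analytic_eq _ (analytic_cst 0 w)) => v; rewrite horner0.
apply: (analytic_eq _ (analyticD (analytic_mulXsub 0 IH) (analytic_cst c w))) => v.
by rewrite hornerMXaddC subr0 mulrC.
Qed.

Lemma circle_integralE h c rho : circle_integral h c rho =
  complex_integral 0 (2 * pi) (fun t => h (circ c rho t) * ((0 +i* rho) * cis t)).
Proof.
rewrite /circle_integral; congr complex_integral; apply/funext => t.
by rewrite circ_velocity.
Qed.

Lemma eq_circle_integral h g c rho : 0 <= rho ->
  (forall w, normc (w - c) = rho -> h w = g w) ->
  circle_integral h c rho = circle_integral g c rho.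
Proof.
move=> rho0 hg; rewrite !circle_integralE; congr complex_integral.
by apply/funext => t; rewrite hg // circ_dist ger0_norm.
Qed.

Definition circle_continuous c rho h : Prop :=
  forall w, normc (w - c) = `|rho| -> {for w, continuous h}.

Lemma circle_integrand_continuous h c rho : circle_continuous c rho h ->
  continuous (fun t => h (circ c rho t) * ((0 +i* rho) * cis t)).
Proof.
move=> ch t; have ct : continuous (fun t => (0 +i* rho) * cis t).
  by move=> u; exact: (cvg_mulcl _ (@cis_continuous R u)).
exact: (cvg_mulc (@continuous_circ_comp R h c rho ch t) (ct t)).
Qed.

Lemma circle_integralD h g c rho :
  circle_continuous c rho h -> circle_continuous c rho g ->
  circle_integral (fun w => h w + g w) c rho =
    circle_integral h c rho + circle_integral g c rho.
Proof.
move=> /circle_integrand_continuous ch /circle_integrand_continuous cg.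
rewrite !circle_integralE -(complex_integralD 0 (2 * pi) ch cg).
by congr complex_integral; apply/funext => t; rewrite mulrDl.
Qed.

Lemma circle_integralZ a h c rho : circle_continuous c rho h ->
  circle_integral (fun w => a * h w) c rho = a * circle_integral h c rho.
Proof.
move=> /circle_integrand_continuous ch.
rewrite !circle_integralE -(complex_integralZ 0 (2 * pi) _ ch).
by congr complex_integral; apply/funext => t; rewrite -[LHS]mulrA.
Qed.

(** On the circle [dw = i (w - c) dt], so the integral is the mean of [i (w - c) h w] up to the
    factor [2 pi], and this function vanishes at the centre. *)
Theorem circle_integral_analytic h c rho : 0 <= rho ->
  (forall w, normc (w - c) <= rho -> analytic_at h w) ->
  circle_integral h c rho = 0.
Proof.
move=> rho0 ha; pose k w := (0 +i* 1) * ((w - c) * h w).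
have ka w : normc (w - c) <= rho -> analytic_at k w.
  by move=> /ha hw; exact: (analyticZ _ (analytic_mulXsub c hw)).
have := circle_mean_value rho0 ka; rewrite {2}/k subrr mul0r !mulr0 => <-.
rewrite circle_integralE; congr complex_integral; apply/funext => t.
have wc : circ c rho t - c = rho%:C * cis t by rewrite circE addrAC subrr add0r.
rewrite /k wc.
have -> : 0 +i* rho = (0 +i* 1) * rho%:C :> R[i] by simpc.
by ring.
Qed.

(* On the circle [x = w - c] satisfies [conj x = rho^2 / x], so the integrand
   is the conjugate of a function that is analytic on the whole disc. *)
Lemma circle_integral_pow a c rho m : normc (a - c) < rho ->
  circle_integral (fun w => ((w - a) ^+ m.+1)^-1) c rho =
    if m == 0 then 0 +i* (2 * pi) else 0.
Proof.
move=> ar; have rho0 : 0 < rho by apply: le_lt_trans ar; exact: normc_ge0.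
pose e := a - c; pose r2 := (rho ^+ 2)%:C.
have r20 : r2 != 0 by rewrite /r2 rmorphXn expf_neq0 // eq_complex /= gt_eqF.
(* With [x = w - c], the integrand is [i x / (x - e)^(m+1)]. Replacing [conj x] by [r2 / x] in its
   conjugate gives [k]; the pole is reflected out of the disc because [|e| < rho]. *)
pose k w := - (0 +i* 1) * r2 * ((w - c) ^+ m / (r2 - e^* * (w - c)) ^+ m.+1).
have den0 w : normc (w - c) <= rho -> r2 - e^* * (w - c) != 0.
  move=> wr; rewrite subr_eq0; apply/eqP => E.
  have : normc (e^* * (w - c)) < rho ^+ 2.
    rewrite normcM expr2; apply: le_lt_trans (_ : normc e * rho < _).
      have -> : normc e^* = normc e by rewrite /e; case: (a - c) => u v /=; rewrite sqrrN.
      by rewrite ler_wpM2l ?normc_ge0.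
    by rewrite ltr_pM2r.
  by rewrite -E /r2 normc_real ger0_norm ?sqr_ge0 // ltxx.
have ka w : normc (w - c) <= rho -> analytic_at k w.
  move=> wr; have dw := den0 w wr.
  have dE v : r2 - e^* * (v - c) = (r2 + e^* * c) + (- e^*) * v by ring.
  have pw : analytic_at (fun v => (v - c) ^+ m) w.
    elim: m {k} => [|m IH]; first exact: (analytic_cst 1 w).
    by apply: (analytic_eq _ (analytic_mulXsub c IH)) => v; rewrite exprS.
  rewrite dE in dw.
  apply: (analytic_eq _ (analyticZ (- (0 +i* 1) * r2) (analytic_div_affineX m.+1 dw pw))) => v.
  by rewrite /k dE.
have mv0 := circle_mean_value (ltW rho0) ka.
have ck : continuous (fun t => k (circ c rho t)).
  apply: continuous_circ_comp => w wr; apply/analytic_continuous/ka.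
  by rewrite wr ger0_norm // ltW.
have mv : complex_integral 0 (2 * pi) (fun t => (k (circ c rho t))^*) = ((2 * pi)%:C * k c)^*.
  by rewrite -mv0; exact: (complex_integral_conj 0 (2 * pi) ck).
(* At the centre the factor [(w - c) ^+ m] is zero unless [m = 0], which accounts for the two
   cases. *)
have kc : ((2 * pi)%:C * k c)^* = if m == 0 then 0 +i* (2 * pi) else 0.
  rewrite /k subrr mulr0 subr0 expr0n; case: eqP => [->|_]; last first.
    by rewrite mul0r !mulr0 rmorph0.
  rewrite expr1 mul1r -mulrA divff // mulr1.
  by apply/eqP; rewrite eq_complex /=; apply/andP; split; apply/eqP; ring.
rewrite -kc -mv circle_integralE; congr complex_integral; apply/funext => t.
set x := rho%:C * cis t.
have wc : circ c rho t - c = x by rewrite circE addrAC subrr add0r.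
have wa : circ c rho t - a = x - e by rewrite -wc /e; ring.
have xx : r2 = x * x^*.
  rewrite -sqr_normc normcC /x normcM normc_cis mulr1 normc_real -rmorphXn.
  by rewrite real_normK ?num_real.
have xb0 : x^* != 0.
  by apply: contraNneq r20 => x0; rewrite xx x0 mulr0.
have xe0 : x - e != 0.
  rewrite subr_eq0; apply: contraTneq ar => xe.
  by rewrite -/e -xe /x normcM normc_cis mulr1 normc_real gtr0_norm // ltxx.
have ix : (0 +i* rho) * cis t = (0 +i* 1) * x.
  by rewrite /x mulrA; congr (_ * _); simpc.
rewrite ix /k wc wa; clearbody x.
have -> : r2 - e^* * x = (x^* * (x - e))^*.
  by rewrite conjcM (conjcB x e) conjcKK mulrBr -xx [x * e^*]mulrC.
rewrite -conjcX -conjcV !conjcM conjcKK conjcX.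
have -> : (- (0 +i* 1))^* = 0 +i* 1 :> R[i] by rewrite /=; simpc.
have -> : r2^* = r2 by exact: conjc_real.
rewrite xx [(x^* * _) ^+ _]exprMn !exprSr.
have xbm : x^* ^+ m != 0 by rewrite expf_neq0.
have xem : (x - e) ^+ m != 0 by rewrite expf_neq0.
by move: (x^* ^+ m) ((x - e) ^+ m) xbm xem => p q p0 q0; field; rewrite q0 xe0 xb0 p0.
Qed.

End CircleIntegral.

(** * Contours *)

Section Contour.
Variables (R : realType) (Gamma : seq (R[i] * R)) (S D : set R[i]).
Hypothesis enc : encloses Gamma S D.
Implicit Types (h g : R[i] -> R[i]) (c w a b : R[i]) (p : R[i] * R) (s : seq R[i]).

Definition on_contour w : Prop := exists2 p, p \in Gamma & normc (w - p.1) = p.2.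

Definition contour_integral h : R[i] :=
  \sum_(p <- Gamma) circle_integral h p.1 p.2.

Definition contour_continuous h : Prop :=
  forall w, on_contour w -> {for w, continuous h}.

Lemma contour_radius_gt0 p : p \in Gamma -> 0 < p.2.
Proof. by case: enc => H _ _ _ _; exact: H. Qed.

Lemma contour_circle_continuous h p : contour_continuous h -> p \in Gamma ->
  circle_continuous p.1 p.2 h.
Proof.
move=> ch pG w wp; apply: ch; exists p; first exact: pG.
by rewrite wp gtr0_norm // contour_radius_gt0.
Qed.

Lemma closed_discP c w (rho : R) : closed_disc c rho w <-> normc (w - c) <= rho.
Proof. by rewrite /closed_disc /= normcC lecR. Qed.

Lemma open_discP c w (rho : R) : open_disc c rho w <-> normc (w - c) < rho.
Proof. by rewrite /open_disc /= normcC ltcR. Qed.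

(** Disjointness of the closed discs makes the winding number of the contour about [a] exactly one:
    [a] is strictly outside all other circles. *)
Lemma enclosed_unique a : S a -> exists p, [/\ p \in Gamma, normc (a - p.1) < p.2 &
  forall q, q \in Gamma -> q != p -> q.2 < normc (a - q.1)].
Proof.
case: enc => _ _ disj _ cover Sa; have [p pG /open_discP ap] := cover a Sa.
exists p; split=> [//|//|q qG qp]; rewrite ltNge; apply/negP => aq.
have : (closed_disc q.1 q.2 `&` closed_disc p.1 p.2) a.
  by split; apply/closed_discP => //; exact: ltW.
by rewrite disj.
Qed.

Lemma enclosed_off a w : S a -> on_contour w -> w != a.
Proof.
move=> /enclosed_unique [p [pG ap H]] [q qG wq]; apply/eqP => E; rewrite E in wq.
have [qp|qp] := eqVneq q p; first by rewrite -qp wq ltxx in ap.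
by have := H q qG qp; rewrite wq ltxx.
Qed.

Lemma contour_continuous_analytic h :
  (forall w, on_contour w -> analytic_at h w) -> contour_continuous h.
Proof. by move=> H w wG; exact/analytic_continuous/H. Qed.

Lemma contour_integralD h g : contour_continuous h -> contour_continuous g ->
  contour_integral (fun w => h w + g w) = contour_integral h + contour_integral g.
Proof.
move=> ch cg; rewrite /contour_integral -big_split /=; apply: eq_big_seq => p pG.
by rewrite circle_integralD //; exact: contour_circle_continuous.
Qed.

Lemma contour_integralZ a h : contour_continuous h ->
  contour_integral (fun w => a * h w) = a * contour_integral h.
Proof.
move=> ch; rewrite /contour_integral mulr_sumr; apply: eq_big_seq => p pG.
by rewrite circle_integralZ //; exact: contour_circle_continuous.
Qed.

Lemma contour_continuousZ a h : contour_continuous h ->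
  contour_continuous (fun w => a * h w).
Proof. by move=> ch w wG; exact: (cvg_mulcl a (ch w wG)). Qed.

Lemma contour_continuousD h g : contour_continuous h -> contour_continuous g ->
  contour_continuous (fun w => h w + g w).
Proof. by move=> ch cg w wG; exact: (cvg_addc (ch w wG) (cg w wG)). Qed.

Lemma eq_contour_integral h g : (forall w, on_contour w -> h w = g w) ->
  contour_integral h = contour_integral g.
Proof.
move=> hg; apply: eq_big_seq => p pG; apply: eq_circle_integral.
  by rewrite ltW // contour_radius_gt0.
by move=> w wp; apply: hg; exists p.
Qed.

Lemma contour_integral_analytic h : (forall w, D w -> analytic_at h w) ->
  contour_integral h = 0.
Proof.
move=> ha; rewrite /contour_integral big_seq big1 // => p pG.
apply: circle_integral_analytic; first by rewrite ltW // contour_radius_gt0.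
move=> w wp; apply: ha; case: enc => _ _ _ H _; apply: (H p pG).
exact/closed_discP.
Qed.

Lemma contour_integral_pow a m : S a ->
  contour_integral (fun w => ((w - a) ^+ m.+1)^-1) =
    if m == 0 then 0 +i* (2 * pi) else 0.
Proof.
move=> Sa; have [p [pG ap H]] := enclosed_unique Sa.
have uG : uniq Gamma by case: enc.
rewrite /contour_integral (bigD1_seq p pG uG) /= circle_integral_pow //.
rewrite big_seq_cond big1 ?addr0 // => q /andP[qG qp].
apply: circle_integral_analytic; first by rewrite ltW // contour_radius_gt0.
move=> w wq; have wa0 : - a + 1 * w != 0.
  rewrite mul1r addrC subr_eq0; apply: contraTneq wq => ->.
  by rewrite -ltNge; exact: H.
apply: (analytic_eq _ (analytic_div_affineX m.+1 wa0 (analytic_cst 1 w))) => v.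
by rewrite !mul1r [- a + _]addrC.
Qed.

Definition root_prod s w : R[i] := \prod_(b <- s) (w - b).

Lemma root_prod_neq0 s w : (forall b, b \in s -> S b) -> on_contour w ->
  root_prod s w != 0.
Proof.
move=> sS wG; rewrite /root_prod prodf_seq_neq0; apply/allP => b bs /=.
by rewrite subr_eq0; apply: enclosed_off => //; exact: sS.
Qed.

Lemma analytic_div_root_prod g s w : root_prod s w != 0 ->
  analytic_at g w -> analytic_at (fun v => g v / root_prod s v) w.
Proof.
elim: s g => [|b s IH] g.
  by move=> _ gw; apply: (analytic_eq _ gw) => v; rewrite /root_prod big_nil divr1.
rewrite /root_prod big_cons mulf_eq0 negb_or subr_eq0 => /andP[wb ws] gw.
apply: (analytic_eq _ (IH _ ws (analytic_divXsub wb gw))) => v.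
by rewrite /root_prod big_cons invfM mulrA.
Qed.

(** Partial fractions, through [a - b = (w - b) - (w - a)], remove the factor [w - b] or lower the
    power of [w - a]. The power is kept apart from the list because a root equal to [a] is merged
    into it. *)
Lemma contour_integral_root_prod s a m : S a -> (forall b, b \in s -> S b) ->
  contour_integral (fun w => ((w - a) ^+ m.+1 * root_prod s w)^-1) =
    if (m == 0) && (s == [::]) then 0 +i* (2 * pi) else 0.
Proof.
elim: s a m => [|b s IH] a m Sa sS.
  rewrite andbT -(@contour_integral_pow a m Sa); apply: eq_contour_integral => w _.
  by rewrite /root_prod big_nil mulr1.
rewrite andbF.
have Sb : S b by apply: sS; rewrite mem_head.
have sS' c : c \in s -> S c by move=> cs; apply: sS; rewrite inE cs orbT.
have [ab|ab] := eqVneq a b.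
  rewrite -[RHS](IH a m.+1 Sa sS'); apply: eq_contour_integral => w _.
  by rewrite /root_prod big_cons -ab mulrA -exprSr.
have cont c k s' : S c -> (forall d, d \in s' -> S d) ->
    contour_continuous (fun w => ((w - c) ^+ k * root_prod s' w)^-1).
  move=> Sc Ss'; apply: contour_continuous_analytic => w wG.
  have pw : root_prod (nseq k c ++ s') w != 0.
    apply: root_prod_neq0 wG => d; rewrite mem_cat => /orP[|]; last exact: Ss'.
    by rewrite mem_nseq => /andP[_ /eqP ->].
  apply: (analytic_eq _ (analytic_div_root_prod pw (analytic_cst 1 w))) => v.
  by rewrite /root_prod big_cat /= big_nseq iter_mulr_1 div1r.
have split k : contour_integral (fun w => ((w - a) ^+ k.+1 * root_prod (b :: s) w)^-1) =
   (a - b)^-1 * (contour_integral (fun w => ((w - a) ^+ k.+1 * root_prod s w)^-1) +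
     (-1) * contour_integral (fun w => ((w - a) ^+ k * root_prod (b :: s) w)^-1)).
  have c1 := cont a k.+1 s Sa sS'.
  have c2 := cont a k (b :: s) Sa sS.
  have c3 := @contour_continuousZ (-1) _ c2.
  rewrite -(contour_integralZ (-1) c2) -(contour_integralD c1 c3).
  rewrite -(contour_integralZ _ (contour_continuousD c1 c3)).
  apply: eq_contour_integral => w wG.
  have wa : w - a != 0 by rewrite subr_eq0; exact: enclosed_off wG.
  have wb : w - b != 0 by rewrite subr_eq0; exact: enclosed_off wG.
  have ws := root_prod_neq0 sS' wG.
  have ab' : a - b != 0 by rewrite subr_eq0.
  have wk : (w - a) ^+ k != 0 by rewrite expf_neq0.
  rewrite /root_prod big_cons -/(root_prod s w) exprS.
  by move: (root_prod s w) ((w - a) ^+ k) ws wk => P Q P0 Q0; field; rewrite wa wb ab' P0 Q0.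
elim: m => [|m IHm].
  (* Both integrals have one factor for each root in [s] and one further simple factor. By induction
     their value does not depend on which root that is, so they cancel. *)
  rewrite split (IH a 0) //.
  have -> : contour_integral (fun w => ((w - a) ^+ 0 * root_prod (b :: s) w)^-1) =
     contour_integral (fun w => ((w - b) ^+ 1 * root_prod s w)^-1).
    by apply: eq_contour_integral => w _; rewrite expr0 mul1r /root_prod big_cons expr1.
  by rewrite (IH b 0) // mulN1r subrr mulr0.
by rewrite split IHm (IH a m.+1) // mulr0 addr0 mulr0.
Qed.

(** The value is the residue at infinity, so it depends on a single coefficient. Dividing [d] by one
    linear factor leaves a shorter quotient and a constant over the product, treated by
    [contour_integral_root_prod]. *)
Lemma contour_integral_poly_div (d : {poly R[i]}) s : (forall b, b \in s -> S b) ->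
  (size d <= size s)%N ->
  contour_integral (fun w => d.[w] / root_prod s w) = (0 +i* (2 * pi)) * d`_(size s).-1.
Proof.
elim: s d => [|a s IH] d sS.
  rewrite /= leqn0 size_poly_eq0 => /eqP ->; rewrite coef0 mulr0.
  have c0 : contour_continuous (fun=> 0 : R[i]).
    by apply: contour_continuous_analytic => w _; exact: (analytic_cst 0 w).
  rewrite -[RHS](mul0r (contour_integral (fun=> 0))) -(contour_integralZ 0 c0).
  by apply: eq_contour_integral => w _; rewrite horner0 !mul0r.
move=> /= ds; pose d1 := d %/ ('X - a%:P).
have dE : d = d1 * ('X - a%:P) + d.[a]%:P by rewrite -modp_XsubC -divp_eq.
have Sa : S a by apply: sS; rewrite mem_head.
have sS' c : c \in s -> S c by move=> cs; apply: sS; rewrite inE cs orbT.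
have d1s : (size d1 <= size s)%N.
  by rewrite size_divp ?polyXsubC_eq0 // size_XsubC /= leq_subLR add1n.
have c1 : contour_continuous (fun w => d1.[w] / root_prod s w).
  apply: contour_continuous_analytic => w wG.
  exact: (analytic_div_root_prod (root_prod_neq0 sS' wG) (analytic_horner d1 w)).
have c2 : contour_continuous (fun w => ((w - a) ^+ 1 * root_prod s w)^-1).
  apply: contour_continuous_analytic => w wG.
  apply: (analytic_eq _ (analytic_div_root_prod (root_prod_neq0 sS wG) (analytic_cst 1 w))) => v.
  by rewrite /root_prod big_cons expr1 div1r.
have -> : contour_integral (fun w => d.[w] / root_prod (a :: s) w) =
    contour_integral (fun w => d1.[w] / root_prod s w) +
    d.[a] * contour_integral (fun w => ((w - a) ^+ 1 * root_prod s w)^-1).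
  rewrite -(contour_integralZ _ c2) -(contour_integralD c1 (@contour_continuousZ _ _ c2)).
  apply: eq_contour_integral => w wG.
  have wa : w - a != 0 by rewrite subr_eq0; exact: enclosed_off wG.
  have ws := root_prod_neq0 sS' wG.
  rewrite [in LHS]dE /root_prod big_cons -/(root_prod s w) hornerD hornerM hornerXsubC hornerC.
  by field; rewrite wa ws.
rewrite (IH d1 sS' d1s) (contour_integral_root_prod 0 Sa sS') /=.
case: s {IH sS' c1 c2 sS} ds d1s => [|b s] /= ds d1s.
  move: d1s; rewrite leqn0 size_poly_eq0 => /eqP d10.
  by rewrite d10 coef0 mulr0 add0r [in RHS]dE d10 mul0r add0r coefC /= mulrC.
rewrite mulr0 addr0; congr (_ * _).
rewrite [in RHS]dE coefD coefC /= addr0 mulrBr coefB coefMX /= coefMC.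
have -> : d1`_(size s).+1 = 0 by apply: nth_default.
by rewrite mul0r subr0.
Qed.

End Contour.

(** * The functional calculus *)

Section Resolvent.
Variables (F : closedFieldType) (n : nat) (B : 'M[F]_n.+1).
Local Notation chi := (char_poly B).
Local Notation adjB := (\adj (char_poly_mx B)).

Lemma char_poly_mx_horner w : map_mx (horner_eval w) (char_poly_mx B) = w%:M - B.
Proof.
apply/matrixP => i j; rewrite !mxE /horner_eval hornerD hornerN hornerC.
by rewrite hornerMn hornerX.
Qed.

Lemma invmx_resolvent w j k : chi.[w] != 0 ->
  invmx (w%:M - B) j k = (adjB j k).[w] / chi.[w].
Proof.
move=> cw; have detE : \det (w%:M - B) = chi.[w].
  by rewrite -char_poly_mx_horner det_map_mx.
rewrite /invmx unitmxE unitfE detE cw mxE mulrC.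
by rewrite -char_poly_mx_horner -map_mx_adj mxE.
Qed.

Lemma X_scale_adj : 'X *: adjB = chi%:M + adjB *m map_mx polyC B.
Proof.
rewrite -[chi%:M]mul_adj_mx mulmxBr mul_mx_scalar subrK //.
Qed.

Lemma coef_adjS m j k : (adjB j k)`_m =
  chi`_m.+1 *+ (j == k) + \sum_l (adjB j l)`_m.+1 * B l k.
Proof.
have /matrixP/(_ j k)/(congr1 (fun p : {poly F} => p`_m.+1)) := X_scale_adj.
rewrite [in X in X -> _]mxE coefXM /= => ->.
rewrite [in LHS]mxE coefD [in LHS]mxE coefMn; congr (_ + _).
rewrite [in LHS]mxE coef_sum; apply: eq_bigr => l _.
by rewrite [map_mx _ _ _ _]mxE coefMC.
Qed.

(* Downward induction along the recursion [coef_adjS], which above degree [n]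
   only involves coefficients of higher degree. *)
Lemma coef_adj_eq0 m j k : (n < m)%N -> (adjB j k)`_m = 0.
Proof.
move=> nm.
pose M := \max_(i < n.+1) \max_(l < n.+1) size (adjB i l).
have [d Md] : exists d, (M <= m + d)%N by exists M; exact: leq_addl.
elim: d m j k nm Md => [|d IH] m j k nm Md.
  apply: nth_default; apply: leq_trans (_ : M <= m)%N; last by rewrite -[m]addn0.
  exact: leq_trans (leq_bigmax k) (leq_bigmax (F := fun i => \max_l size (adjB i l)) j).
rewrite coef_adjS nth_default ?size_char_poly // mul0rn add0r big1 // => l _.
by rewrite IH ?mul0r // ?(ltn_trans nm) // addSn -addnS.
Qed.

Lemma size_adj j k : (size (adjB j k) <= n.+1)%N.
Proof. by apply/leq_sizeP => m; exact: coef_adj_eq0. Qed.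

(** Its top coefficients make the adjugate over [chi] behave like the identity over [w] at infinity;
    hence the resolvent integrates to [2 pi i] times the identity. *)
Lemma coef_adj_lead j k : (adjB j k)`_n = (j == k)%:R.
Proof.
rewrite coef_adjS big1 => [|l _]; last by rewrite coef_adj_eq0 ?mul0r.
have := char_poly_monic B; rewrite monicE lead_coefE size_char_poly => /eqP ->.
by rewrite addr0.
Qed.

(** Modulo [chi], multiplying the adjugate by ['X] is the same as multiplying it on the right by
    [B], and this extends to polynomials. *)
Lemma scale_adj_horner (p : {poly F}) : exists S : 'M[{poly F}]_n.+1,
  p *: adjB = chi *: S + adjB *m map_mx polyC (horner_mx B p).
Proof.
elim/poly_ind: p => [|p c [S IH]].
  by exists 0; rewrite scaler0 add0r rmorph0 map_mx0 mulmx0 scale0r.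
exists ('X *: S + map_mx polyC (horner_mx B p)).
rewrite scalerDl [p * _]mulrC -scalerA IH scalerDr [_ *: (chi *: _)]scalerA.
rewrite [_ * chi]mulrC -scalerA scalerDr -!addrA; congr (_ + _).
rewrite scalemxAl X_scale_adj mulmxDl mul_scalar_mx -!addrA; congr (_ + _).
rewrite rmorphD rmorphM /= horner_mx_X horner_mx_C map_mxD mulmxDr -mulmxA -map_mxM.
congr (_ + _).
by rewrite map_scalar_mx mul_mx_scalar.
Qed.

End Resolvent.

Section Matfun.
Variables (R : realType) (n : nat) (B : 'M[R[i]]_n.+1).
Local Notation chi := (char_poly B).
Local Notation adjB := (\adj (char_poly_mx B)).
Implicit Types (h k : R[i] -> R[i]) (w a : R[i]) (O : set R[i]).

(** Listed with algebraic multiplicity, so that the root product of the list is the characteristic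
    polynomial. *)
Definition eigenvalues : seq R[i] := sval (closed_field_poly_normal chi).

Lemma char_poly_eigenvalues : chi = \prod_(a <- eigenvalues) ('X - a%:P).
Proof.
rewrite /eigenvalues; case: closed_field_poly_normal => s /= {1}->.
by rewrite (monicP (char_poly_monic B)) scale1r.
Qed.

Lemma horner_char_poly w : chi.[w] = root_prod eigenvalues w.
Proof.
rewrite {1}char_poly_eigenvalues /root_prod horner_prod.
by apply: eq_bigr => a _; rewrite hornerXsubC.
Qed.

Lemma spectrum_eigenvalues a : spectrum B a <-> a \in eigenvalues.
Proof.
rewrite /spectrum /= eigenvalue_root_char {1}char_poly_eigenvalues.
by rewrite root_prod_XsubC.
Qed.

Lemma size_eigenvalues : size eigenvalues = n.+1.
Proof.
have := size_char_poly B; rewrite {1}char_poly_eigenvalues size_prod_XsubC.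
by move=> [].
Qed.

(** By [scale_adj_horner] the integrand is [G], which is analytic on [D] and integrates to zero,
    plus the entries of the adjugate over [chi] multiplied by [q(B)]. Only the diagonal entries of
    the adjugate contribute. *)
Lemma contour_integral_resolvent Gamma D h k (q : {poly R[i]}) i j :
  encloses Gamma (spectrum B) D ->
  (forall w, h w = q.[w] + chi.[w] * k w) ->
  (forall w, D w -> analytic_at k w) ->
  contour_integral Gamma (fun w => h w * invmx (w%:M - B) i j) =
    (0 +i* (2 * pi)) * horner_mx B q i j.
Proof.
move=> enc hE ka; have [S SE] := scale_adj_horner B q.
have Ss a : a \in eigenvalues -> spectrum B a by move/spectrum_eigenvalues.
have onD w : on_contour Gamma w -> D w.
  case: enc => _ _ _ H _ [p pG wp]; apply: (H p pG); apply/closed_discP.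
  by rewrite wp.
have chi0 w : on_contour Gamma w -> chi.[w] != 0.
  by move=> wG; rewrite horner_char_poly; exact: (root_prod_neq0 enc Ss wG).
pose T l w := (adjB i l).[w] / root_prod eigenvalues w.
have TI l : contour_integral Gamma (T l) = (0 +i* (2 * pi)) * (i == l)%:R.
  rewrite /T (contour_integral_poly_div enc Ss) ?size_eigenvalues ?size_adj //=.
  by rewrite coef_adj_lead.
have Tc l : contour_continuous Gamma (T l).
  apply: contour_continuous_analytic => w wG.
  exact: (analytic_div_root_prod (root_prod_neq0 enc Ss wG) (analytic_horner (adjB i l) w)).
pose G w := (S i j).[w] + (adjB i j).[w] * k w.
have Ga w : D w -> analytic_at G w.
  move=> Dw; apply: analyticD; first exact: (analytic_horner (S i j) w).
  have kw := ka w Dw; elim/poly_ind: (adjB i j) => [|p c IH].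
    by apply: (analytic_eq _ (analytic_cst 0 w)) => v; rewrite horner0 mul0r.
  apply: (analytic_eq _ (analyticD (analytic_mulXsub 0 IH) (analyticZ c kw))) => v.
  by rewrite hornerMXaddC subr0 mulrDl mulrCA mulrA.
have Gc : contour_continuous Gamma G.
  by apply: contour_continuous_analytic => w /onD; exact: Ga.
have sumc (r : seq 'I_n.+1) (f : 'I_n.+1 -> R[i]) :
    contour_continuous Gamma (fun w => \sum_(l <- r) f l * T l w) /\
    contour_integral Gamma (fun w => \sum_(l <- r) f l * T l w) =
      \sum_(l <- r) f l * contour_integral Gamma (T l).
  elim: r => [|l r [IHc IH]].
    have c0 : contour_continuous Gamma (fun=> 0 : R[i]).
      by apply: contour_continuous_analytic => w _; exact: (analytic_cst 0 w).
    have -> : (fun w => \sum_(l <- [::]) f l * T l w) = fun=> 0.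
      by apply/funext => w; rewrite big_nil.
    split; first exact: c0.
    rewrite big_nil -[RHS](mul0r (contour_integral Gamma (fun=> 0))).
    rewrite -(contour_integralZ enc 0 c0).
    by apply: (eq_contour_integral enc) => w _; rewrite mul0r.
  have -> : (fun w => \sum_(l' <- l :: r) f l' * T l' w) =
     (fun w => f l * T l w + \sum_(l' <- r) f l' * T l' w).
    by apply/funext => w; rewrite big_cons.
  have c1 := @contour_continuousZ R Gamma (f l) _ (Tc l).
  split; first exact: (contour_continuousD c1 IHc).
  by rewrite (contour_integralD enc c1 IHc) (contour_integralZ enc _ (Tc l)) IH big_cons.
have [sc sI] := sumc (index_enum 'I_n.+1) (fun l => horner_mx B q l j).
have -> : contour_integral Gamma (fun w => h w * invmx (w%:M - B) i j) =
  contour_integral Gamma (fun w => G w + \sum_l horner_mx B q l j * T l w).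
  apply: (eq_contour_integral enc) => w wG; have cw := chi0 w wG.
  rewrite invmx_resolvent // hE mulrDl /G [(S i j).[w] + _]addrC -addrA addrC.
  congr (_ + _); last by field.
  have /matrixP/(_ i j)/(congr1 (horner_eval w)) := SE.
  rewrite /horner_eval [in X in X -> _]mxE hornerM mulrA => ->.
  rewrite [in LHS]mxE hornerD mulrDl [in LHS]mxE hornerM; congr (_ + _).
    by rewrite mulrAC mulfV // mul1r.
  rewrite [in LHS]mxE horner_sum mulr_suml; apply: eq_bigr => l _.
  by rewrite [map_mx _ _ _ _]mxE hornerM hornerC /T -horner_char_poly [RHS]mulrC mulrAC.
rewrite (contour_integralD enc Gc sc) (contour_integral_analytic enc Ga) add0r sI.
rewrite (bigD1 i) //= TI eqxx mulr1 big1 ?addr0 1?mulrC // => l li.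
by rewrite TI eq_sym (negPf li) !mulr0.
Qed.

End Matfun.

(** * Existence of contours *)

Section EnclosingContour.
Variable R : realType.
Implicit Types (a w : R[i]) (s : seq R[i]) (O : set R[i]).

Lemma uniform_radius (I : eqType) (s : seq I) (P : I -> R -> Prop) :
  (forall a : I, a \in s -> exists2 e : R, 0 < e & forall r, 0 < r <= e -> P a r) ->
  exists2 e : R, 0 < e & forall a : I, a \in s -> forall r, 0 < r <= e -> P a r.
Proof.
elim: s => [|b s IH] H; first by exists 1.
have [e e0 He] : exists2 e : R, 0 < e & forall a : I, a \in s -> forall r, 0 < r <= e -> P a r.
  by apply: IH => a sa; apply: H; rewrite inE sa orbT.
have [d d0 Hd] := H b (mem_head _ _).
exists (Num.min e d); first by rewrite lt_min e0.
move=> a; rewrite inE => /predU1P[->|sa] r /andP[r0]; rewrite le_min => /andP[re rd].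
  by apply: Hd; rewrite r0.
by apply: He => //; rewrite r0.
Qed.

Lemma encloses_exists s O : open O -> (forall a, a \in s -> O a) ->
  exists Gamma : seq (R[i] * R), encloses Gamma [set a | a \in s] O.
Proof.
move=> oO sO.
have [e e0 He] : exists2 e : R, 0 < e & forall a, a \in s -> forall r, 0 < r <= e ->
    closed_disc a r `<=` O.
  apply: uniform_radius => a sa; have /nbhs_normcP [e e0 H] := holo_near oO (sO a sa).
  exists (e / 2); first by rewrite divr_gt0.
  move=> r /andP[_ re] w /closed_discP wr; apply: H; apply: le_lt_trans wr _; lra.
have [d d0 Hd] : exists2 d : R, 0 < d & forall a, a \in s -> forall r, 0 < r <= d ->
    forall b, b \in s -> a != b -> 2 * r < normc (a - b).
  apply: uniform_radius => a sa.
  have [d d0 H] : exists2 d : R, 0 < d & forall b, b \in s -> forall r, 0 < r <= d ->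
      a != b -> 2 * r < normc (a - b).
    apply: uniform_radius => b sb; have [ab|ab] := eqVneq a b; first by exists 1.
    have ab0 : 0 < normc (a - b) by rewrite normc_gt0 subr_eq0.
    (* All circles will share one radius [r], so their closed discs are disjoint once [2 r] is below
       every mutual distance. *)
    exists (normc (a - b) / 3); first by rewrite divr_gt0.
    by move=> r /andP[_ rd] _; lra.
  by exists d => // r rd b sb; exact: H.
pose r := Num.min e d.
have r0 : 0 < r by rewrite lt_min e0.
have re : 0 < r <= e by rewrite r0 ge_min lexx.
have rd : 0 < r <= d by rewrite r0 ge_min lexx orbT.
exists [seq (a, r) | a <- undup s]; split.
- by move=> p /mapP [a _ ->].
- by rewrite map_inj_uniq ?undup_uniq // => a b [].
- move=> p q /mapP [a]; rewrite mem_undup => sa -> /mapP [b]; rewrite mem_undup => sb -> ab.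
  have {}ab : a != b by apply: contraNN ab => /eqP ->.
  apply/seteqP; split => // w [/closed_discP /= wa /closed_discP /= wb].
  have := Hd a sa r rd b sb ab; rewrite ltNge => /negP; apply.
  have -> : a - b = (w - b) - (w - a) by ring.
  by apply: le_trans (normcB _ _) _; rewrite mulr_natl mulr2n lerD.
- by move=> p /mapP [a]; rewrite mem_undup => sa -> /=; exact: He.
- move=> a /= sa; exists (a, r); last by apply/open_discP; rewrite subrr normc0.
  by apply/mapP; exists a; rewrite ?mem_undup.
Qed.

End EnclosingContour.

Section MatfunPoly.
Variables (R : realType) (n : nat) (B : 'M[R[i]]_n.+1).
Local Notation chi := (char_poly B).
Implicit Types (h k g : R[i] -> R[i]) (w a : R[i]) (O : set R[i]) (q : {poly R[i]}).

Theorem matfun_remainder O h k q : open O -> spectrum B `<=` O -> holo O h ->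
  (forall w, h w = q.[w] + chi.[w] * k w) ->
  (forall a, spectrum B a -> analytic_at k a) ->
  matfun h B = horner_mx B q.
Proof.
move=> oO BO hO hE kB; rewrite /matfun.
set Gamma := xget _ _.
(* [xget] meets its specification only if some contour does; small circles about the eigenvalues
   inside [O] provide one. *)
have encG : encloses Gamma (spectrum B) (analytic_at h).
  have [|G EG] := @encloses_exists R (eigenvalues B) O oO.
    by move=> a /spectrum_eigenvalues; exact: BO.
  suff : [set G | encloses G (spectrum B) (analytic_at h)] Gamma by [].
  apply: xgetPex; exists G; case: EG => H1 H2 H3 H4 H5; split=> //.
    by move=> p pG w /(H4 p pG)/hO.
  by move=> a /spectrum_eigenvalues /H5.
clearbody Gamma.
(* The chosen contour may leave [O], so [k] must be analytic wherever [h] is. Off the spectrum this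
   holds because [k] is the quotient [(h - q) / chi]. *)
have ka w : analytic_at h w -> analytic_at k w.
  move=> hw; have [cw|cw] := eqVneq chi.[w] 0.
    by apply: kB; rewrite /spectrum /= eigenvalue_root_char; apply/rootP.
  have cw' : root_prod (eigenvalues B) w != 0 by rewrite -horner_char_poly.
  apply: (analytic_near_eq _ (analytic_div_root_prod cw'
    (analyticB hw (analytic_horner q w)))).
  have /cvg_normcP/(_ (normc chi.[w])) := analytic_continuous (analytic_horner chi w).
  rewrite normc_gt0 => /(_ cw); apply: filterS => v; rewrite -horner_char_poly.
  have [->|cv _] := eqVneq chi.[v] 0; first by rewrite sub0r normc_opp ltxx.
  by rewrite hE addrAC subrr add0r mulrAC mulfV // mul1r.
apply/matrixP => i j; rewrite !mxE.
rewrite -/(contour_integral Gamma (fun w => h w * invmx (w%:M - B) i j)).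
rewrite (contour_integral_resolvent i j encG hE ka) mulKf //.
by rewrite eq_complex /= eqxx /= gt_eqF // pi2_gt0.
Qed.

Lemma matfun_horner q : matfun (horner q) B = horner_mx B q.
Proof.
apply: (@matfun_remainder setT _ (fun=> 0)) => //.
- exact: openT.
- by move=> w _; exact: (analytic_horner q w).
- by move=> w; rewrite mulr0 addr0.
- by move=> a _; exact: (analytic_cst 0 a).
Qed.

End MatfunPoly.

(** * Newton interpolation *)

Section Newton.
Variable R : realType.
Implicit Types (h k g : R[i] -> R[i]) (w a : R[i]) (O : set R[i]) (s : seq R[i]).

(** For nodes [a_1, ..., a_m] this is the divided difference [h[a_1, ..., a_m, w]] as a function of
    [w]. *)
Fixpoint dds s h : R[i] -> R[i] := if s is a :: s' then dds s' (dd a h) else h.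

Fixpoint newton s h : {poly R[i]} :=
  if s is a :: s' then (h a)%:P + ('X - a%:P) * newton s' (dd a h) else 0.

(** Like [ddE] this is a pointwise identity for any function, so it supplies the equation that
    [matfun_remainder] asks for at every [w]. *)
Lemma newtonE s h w : h w = (newton s h).[w] + root_prod s w * dds s h w.
Proof.
elim: s h => [|a s IH] h /=; first by rewrite horner0 add0r /root_prod big_nil mul1r.
rewrite {1}(ddE a h w) (IH (dd a h)) hornerD hornerM hornerXsubC hornerC.
by rewrite /root_prod big_cons mulrDr addrA mulrA.
Qed.

Lemma size_newton s h : (size (newton s h) <= size s)%N.
Proof.
elim: s h => [|a s IH] h /=; first by rewrite size_poly0.
apply: leq_trans (size_polyD _ _) _; rewrite geq_max; apply/andP; split.
  by apply: leq_trans (size_polyC_leq1 _) _.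
have [->|nz] := eqVneq (newton s (dd a h)) 0; first by rewrite mulr0 size_poly0.
by rewrite mulrC size_Mmonic ?monicXsubC // size_XsubC addn2 /= ltnS.
Qed.

Lemma holo_dd O a h : O a -> holo O h -> holo O (dd a h).
Proof. by move=> Oa hO w Ow; exact: (analytic_dd (hO a Oa) (hO w Ow)). Qed.

Lemma holo_dds O s h : (forall a, a \in s -> O a) -> holo O h -> holo O (dds s h).
Proof.
elim: s h => [|a s IH] h sO hO; first exact: hO.
have Oa : O a by apply: sO; rewrite mem_head.
apply: (IH (dd a h) _ (holo_dd Oa hO)) => b bs.
by apply: sO; rewrite inE bs orbT.
Qed.

Theorem matfun_newton n (B : 'M[R[i]]_n.+1) O h : open O -> spectrum B `<=` O ->
  holo O h -> matfun h B = horner_mx B (newton (eigenvalues B) h).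
Proof.
move=> oO BO hO; apply: (matfun_remainder oO BO hO (k := dds (eigenvalues B) h)).
  by move=> w; rewrite horner_char_poly; exact: newtonE.
move=> a Ba; apply: (holo_dds _ hO) (BO a Ba) => b /spectrum_eigenvalues; exact: BO.
Qed.

End Newton.

(** * Algebraic rules of the functional calculus *)

Section MatfunAlgebra.
Variables (R : realType) (n : nat) (A : 'M[R[i]]_n.+1).
Implicit Types (h k g : R[i] -> R[i]) (w a c x : R[i]) (O : set R[i]) (q u v : {poly R[i]}).

Lemma matfun_remainder_in O h k q : open O -> spectrum A `<=` O -> holo O h ->
  (forall w, O w -> h w = q.[w] + (char_poly A).[w] * k w) ->
  (forall a, spectrum A a -> analytic_at k a) ->
  matfun h A = horner_mx A q.
Proof.
move=> oO AO hO hE kA; set chi := char_poly A in hE *.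
(* The equation for [h] may fail outside [O], where the contour may pass. *)
pose k' w := if chi.[w] == 0 then k w else (h w - q.[w]) / chi.[w].
apply: (matfun_remainder oO AO hO (k := k')) => [w|a Aa].
  rewrite /k' -/chi; have [cw|cw] := eqVneq chi.[w] 0; last first.
    by rewrite mulrC divfK // addrC subrK.
  by apply: hE; apply: AO; rewrite /spectrum /= eigenvalue_root_char; apply/rootP.
apply: (analytic_near_eq _ (kA a Aa)).
apply: filterS (holo_near oO (AO a Aa)) => w Ow.
rewrite /k'; have [//|cw] := eqVneq chi.[w] 0.
by rewrite hE // addrAC subrr add0r mulrAC mulfV // mul1r.
Qed.

(** Both [q] and [0] are remainders of the function [q] modulo [chi] near the spectrum, so both
    evaluate to the same matrix. This converts identities between functions into identities between
    matrices. *)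
Lemma horner_mx_eq0_in O q k : open O -> spectrum A `<=` O ->
  (forall w, O w -> q.[w] = (char_poly A).[w] * k w) ->
  (forall a, spectrum A a -> analytic_at k a) ->
  horner_mx A q = 0.
Proof.
move=> oO AO qE kA; rewrite -matfun_horner -[RHS](rmorph0 (horner_mx A)).
apply: (matfun_remainder_in oO AO _ _ kA) => w Ow.
  exact: (analytic_horner q w).
by rewrite horner0 add0r; exact: qE.
Qed.

Lemma analytic_mul_horner q g w : analytic_at g w -> analytic_at (fun y => q.[y] * g y) w.
Proof.
move=> gw; elim/poly_ind: q => [|p c IH].
  by apply: (analytic_eq _ (analytic_cst 0 w)) => v; rewrite horner0 mul0r.
apply: (analytic_eq _ (analyticD (analytic_mulXsub 0 IH) (analyticZ c gw))) => v.
by rewrite hornerMXaddC subr0 mulrDl mulrCA mulrA.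
Qed.

Lemma analytic_div_horner q g w : q.[w] != 0 -> analytic_at g w ->
  analytic_at (fun y => g y / q.[y]) w.
Proof.
move=> qw gw; have [s qE] := closed_field_poly_normal q.
have qsE y : q.[y] = lead_coef q * root_prod s y.
  rewrite {1}qE hornerZ horner_prod; congr (_ * _).
  by apply: eq_bigr => a _; rewrite hornerXsubC.
have : lead_coef q * root_prod s w != 0 by rewrite -qsE.
rewrite mulf_eq0 negb_or => /andP[_ sw].
apply: (analytic_eq _ (analyticZ (lead_coef q)^-1 (analytic_div_root_prod sw gw))) => y.
by rewrite qsE invfM mulrCA.
Qed.

Lemma open_horner_neq0 q : open [set w | q.[w] != 0].
Proof.
rewrite openE => w /= qw.
have /cvg_normcP/(_ (normc q.[w])) := analytic_continuous (analytic_horner q w).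
rewrite normc_gt0 => /(_ qw); apply: filterS => y /=.
by apply: contraTneq => ->; rewrite sub0r normc_opp ltxx.
Qed.

(** The inverse is the Newton interpolant of [1 / v] at the eigenvalues, evaluated at [A]. *)
Lemma horner_mx_unit v : (forall a, spectrum A a -> v.[a] != 0) ->
  horner_mx A v \in unitmx.
Proof.
move=> vA; pose O := [set w : R[i] | v.[w] != 0].
have oO : open O := @open_horner_neq0 v.
have AO : spectrum A `<=` O by move=> a /vA.
pose g w := 1 / v.[w].
have gO : holo O g by move=> w Ow; exact: (analytic_div_horner Ow (analytic_cst 1 w)).
pose s := eigenvalues A; pose k := dds s g; pose q := newton s g.
have kA a : spectrum A a -> analytic_at k a.
  move=> Aa; apply: (holo_dds _ gO) (AO a Aa) => b /spectrum_eigenvalues; exact: AO.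
suff : horner_mx A v *m horner_mx A q = 1%:M by move=> /mulmx1_unit [].
apply/eqP; rewrite -subr_eq0; apply/eqP.
have -> : horner_mx A v *m horner_mx A q - 1%:M = horner_mx A (v * q - 1).
  by rewrite rmorphB rmorphM (rmorph1 (horner_mx A)).
apply: (@horner_mx_eq0_in O _ (fun w => (- v).[w] * k w) oO AO) => [w Ow|a Aa].
  have := newtonE s g w; rewrite -/q -/k -horner_char_poly => gE.
  have -> : (v * q - 1).[w] = v.[w] * (g w - (char_poly A).[w] * k w) - 1.
    by rewrite gE hornerD hornerM hornerN hornerC; ring.
  by rewrite hornerN /g mulrBr mulrCA mulfV // mulr1; ring.
exact: (analytic_mul_horner (- v) (kA a Aa)).
Qed.

(** Each function is replaced by its interpolant at the eigenvalues. The polynomial relation then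
    fails only by [chi] times an analytic function, and [horner_mx_eq0_in] applies. *)
Lemma matfun_linear_relation O f r g u v q : open O -> spectrum A `<=` O ->
  holo O f -> holo O r -> holo O g ->
  (forall w, O w -> v.[w] * f w = u.[w] + q.[w] * g w) ->
  (forall w, O w -> v.[w] * r w = u.[w]) ->
  horner_mx A v *m (matfun f A - matfun r A) = horner_mx A q *m matfun g A.
Proof.
move=> oO AO fO rO gO fE rE; pose s := eigenvalues A.
have sO a : a \in s -> O a by move=> /spectrum_eigenvalues; exact: AO.
rewrite !(@matfun_newton _ _ A O) // -/s.
apply/eqP; rewrite -subr_eq0; apply/eqP.
have -> : horner_mx A v *m (horner_mx A (newton s f) - horner_mx A (newton s r)) -
    horner_mx A q *m horner_mx A (newton s g) =
    horner_mx A (v * (newton s f - newton s r) - q * newton s g).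
  by rewrite rmorphB !rmorphM rmorphB.
pose k w := (v.[w] * dds s r w - v.[w] * dds s f w) + q.[w] * dds s g w.
apply: (@horner_mx_eq0_in O _ k oO AO) => [w Ow|a Aa].
  have fN := newtonE s f w; have rN := newtonE s r w; have gN := newtonE s g w.
  rewrite -horner_char_poly in fN; rewrite -horner_char_poly in rN.
  rewrite -horner_char_poly in gN.
  rewrite hornerD hornerN !hornerM hornerD hornerN.
  have := fE w Ow; rewrite -(rE w Ow) fN rN gN /k => E.
  apply/eqP; rewrite -subr_eq0; apply/eqP; move/eqP: E; rewrite -subr_eq0 => /eqP <-.
  by ring.
have Oa := AO a Aa.
by apply: analyticD; [apply: analyticB|]; apply: analytic_mul_horner;
  [exact: (holo_dds sO rO)|exact: (holo_dds sO fO)|exact: (holo_dds sO gO)].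
Qed.

Lemma horner_mx_affine c x q :
  horner_mx A (q \Po (x *: 'X + c%:P)) = horner_mx (c%:M + x *: A) q.
Proof.
elim/poly_ind: q => [|q d IH]; first by rewrite comp_poly0 !rmorph0.
rewrite comp_polyD comp_polyM comp_polyX comp_polyC !rmorphD !rmorphM /= IH.
rewrite horner_mx_X !horner_mx_C; congr (_ *m _ + _).
by rewrite rmorphD /= horner_mx_C horner_mxZ horner_mx_X addrC.
Qed.

Lemma spectrum_affine c x l : spectrum (c%:M + x *: A) l ->
  exists2 a, spectrum A a & l = c + x * a.
Proof.
move=> /eigenvalueP [y yE y0].
have {}yE : x *: (y *m A) = (l - c) *: y.
  by move: yE; rewrite mulmxDr mul_mx_scalar -scalemxAr scalerBl => <-; rewrite addrC addKr.
have [x0|x0] := eqVneq x 0; last first.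
  exists ((l - c) / x); last by rewrite mulrC divfK // addrC subrK.
  apply/eigenvalueP; exists y => //.
  by rewrite mulrC -scalerA -yE scalerA mulVf // scale1r.
have lc : l = c.
  move: yE; rewrite x0 scale0r => /esym/eqP; rewrite scaler_eq0 (negPf y0) orbF.
  by rewrite subr_eq0 => /eqP.
(* For [x = 0] any eigenvalue of [A] serves, and the positive dimension provides one. *)
have := size_eigenvalues A; case E : (eigenvalues A) => [//|a s] _.
exists a; last by rewrite lc x0 mul0r addr0.
by apply/spectrum_eigenvalues; rewrite E mem_head.
Qed.

(** This moves the parameters from the matrix into the function, so that the functional [h |-> h(A)]
    stays fixed while they vary. *)
Theorem matfun_affine O h c x : open O -> holo O h ->
  (forall a, spectrum A a -> O (c + x * a)) ->
  matfun h (c%:M + x *: A) = matfun (fun w => h (c + x * w)) A.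
Proof.
move=> oO hO AO; set B := c%:M + x *: A.
have BO : spectrum B `<=` O by move=> l /spectrum_affine [a Aa ->]; exact: AO.
pose s := eigenvalues B; pose k := dds s h; pose q := newton s h.
have kO : holo O k.
  by apply: (holo_dds _ hO) => b /spectrum_eigenvalues; exact: BO.
pose O' := [set w | O (c + x * w)].
have oO' : open O' := @open_affine_preimage R O c x oO.
have hO' : holo O' (fun w => h (c + x * w)).
  by move=> w Ow; apply: analytic_affine; exact: hO.
have kO' : holo O' (fun w => k (c + x * w)).
  by move=> w Ow; apply: analytic_affine; exact: kO.
pose aff := x *: 'X + c%:P : {poly R[i]}.
have affE w : aff.[w] = c + x * w by rewrite hornerD hornerZ hornerX hornerC addrC.
pose s' := eigenvalues A; pose k' w := k (c + x * w).
(* Substitution yields a remainder with factor [char_poly B \Po aff]. Expanding its cofactor once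
   more, at the eigenvalues of [A], produces the factor [char_poly A] for every [x], zero included;
   the extra term of [Q] dies by Cayley-Hamilton. *)
pose Q := (q \Po aff) + (char_poly B \Po aff) * newton s' k'.
have s'O a : a \in s' -> O' a by move=> /spectrum_eigenvalues; exact: AO.
have hE w : h (c + x * w) =
    Q.[w] + (char_poly A).[w] * ((char_poly B \Po aff).[w] * dds s' k' w).
  rewrite /Q hornerD hornerM !horner_comp affE mulrCA -addrA -mulrDr.
  by rewrite [(char_poly A).[w]]horner_char_poly -newtonE horner_char_poly; exact: newtonE.
have kA a : spectrum A a ->
    analytic_at (fun w => (char_poly B \Po aff).[w] * dds s' k' w) a.
  by move=> Aa; exact: (analytic_mul_horner _ (holo_dds s'O kO' (AO a Aa))).
rewrite (matfun_remainder oO' AO hO' hE kA) (matfun_newton oO BO hO) -/s -/q /Q.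
rewrite rmorphD rmorphM /= !horner_mx_affine -/B.
by rewrite Cayley_Hamilton mul0r addr0.
Qed.

End MatfunAlgebra.

(** * Interpolation with multiplicities *)

Section Interpolation.
Variable R : realType.
Implicit Types (h g f r : R[i] -> R[i]) (w a zeta : R[i]) (O : set R[i]) (s : seq R[i]).
Implicit Types (d u v : {poly R[i]}).

Definition vanishing m h zeta : Prop := forall j, (j < m)%N -> derive1n j h zeta = 0.

Lemma vanishing_mulXsub O m h a zeta : open O -> holo O h -> O zeta ->
  vanishing m h zeta -> vanishing m (fun w => (w - a) * h w) zeta.
Proof.
move=> oO hO Oz hm [|j] jm; first by have := hm 0%N jm => /= ->; rewrite mulr0.
by rewrite (derive1n_mulXsub a j oO hO Oz) !hm ?mulr0 ?addr0 // ltnW.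
Qed.

Lemma vanishing_mulXsub_self O m h zeta : open O -> holo O h -> O zeta ->
  vanishing m h zeta -> vanishing m.+1 (fun w => (w - zeta) * h w) zeta.
Proof.
move=> oO hO Oz hm [|j] jm; first by rewrite /= subrr mul0r.
by rewrite (derive1n_mulXsub zeta j oO hO Oz) hm // subrr mul0r mulr0 addr0.
Qed.

Lemma vanishingD O m h g zeta : open O -> holo O h -> holo O g -> O zeta ->
  vanishing m h zeta -> vanishing m g zeta -> vanishing m (fun w => h w + g w) zeta.
Proof.
move=> oO hO gO Oz hm gm j jm.
by rewrite (derive1nD j oO hO gO Oz) hm // gm // addr0.
Qed.

Lemma vanishingZ O m c h zeta : open O -> holo O h -> O zeta ->
  vanishing m h zeta -> vanishing m (fun w => c * h w) zeta.
Proof. by move=> oO hO Oz hm j jm; rewrite (derive1nZ c j oO hO Oz) hm // mulr0. Qed.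

Lemma vanishing_eq O m h g zeta : open O -> holo O h -> O zeta ->
  (forall w, O w -> h w = g w) -> vanishing m h zeta -> vanishing m g zeta.
Proof. by move=> oO hO Oz hg hm j jm; rewrite (derive1n_eq j oO hO hg Oz) hm. Qed.

Lemma vanishing_mul_horner O m q h zeta : open O -> holo O h -> O zeta ->
  vanishing m h zeta -> vanishing m (fun w => q.[w] * h w) zeta.
Proof.
move=> oO hO Oz hm; elim/poly_ind: q => [|q c IH].
  apply: (vanishing_eq oO _ Oz _ (vanishingZ 0 oO hO Oz hm)) => w Ow.
    exact: (analyticZ 0 (hO w Ow)).
  by rewrite horner0 !mul0r.
have qO : holo O (fun w => q.[w] * h w) by move=> w Ow; exact: (analytic_mul_horner q (hO w Ow)).
have xqO : holo O (fun w => (w - 0) * (q.[w] * h w)).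
  by move=> w Ow; exact: (analytic_mulXsub 0 (qO w Ow)).
have cO : holo O (fun w => c * h w) by move=> w Ow; exact: (analyticZ c (hO w Ow)).
apply: (vanishing_eq oO _ Oz _ (vanishingD oO xqO cO Oz
  (vanishing_mulXsub 0 oO qO Oz IH) (vanishingZ c oO hO Oz hm))) => w Ow.
  exact: (analyticD (xqO w Ow) (cO w Ow)).
by rewrite hornerMXaddC subr0 mulrDl mulrCA mulrA.
Qed.

Lemma analytic_root_prod_mul s h w : analytic_at h w ->
  analytic_at (fun y => root_prod s y * h y) w.
Proof.
move=> hw; elim: s => [|a s IH].
  by apply: (analytic_eq _ hw) => y; rewrite /root_prod big_nil mul1r.
apply: (analytic_eq _ (analytic_mulXsub a IH)) => y.
by rewrite /root_prod big_cons mulrA.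
Qed.

Lemma vanishing_root_prod O s h zeta : open O -> holo O h -> O zeta ->
  vanishing (count_mem zeta s) (fun w => root_prod s w * h w) zeta.
Proof.
move=> oO hO Oz; elim: s => [//|a s IH].
have sO : holo O (fun w => root_prod s w * h w).
  by move=> w Ow; exact: (analytic_root_prod_mul s (hO w Ow)).
have asO : holo O (fun w => (w - a) * (root_prod s w * h w)).
  by move=> w Ow; exact: (analytic_mulXsub a (sO w Ow)).
apply: (vanishing_eq oO asO Oz) => [w _|].
  by rewrite /root_prod big_cons mulrA.
rewrite /=; have [->|az] := eqVneq a zeta.
  exact: (vanishing_mulXsub_self oO sO Oz IH).
exact: (vanishing_mulXsub a oO sO Oz IH).
Qed.

(** Dividing out one linear factor lowers the order of vanishing by one: Leibniz's rule leaves a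
    factor [j.+1], nonzero in characteristic zero. *)
Lemma vanishing_dvdp m d zeta : vanishing m (horner d) zeta ->
  ('X - zeta%:P) ^+ m %| d.
Proof.
elim: m d => [|m IH] d dm; first by rewrite expr0 dvd1p.
have /factor_theorem [d1 dE] : root d zeta by apply/rootP; exact: (dm 0%N).
rewrite exprSr dE dvdp_mul2r ?polyXsubC_eq0 //; apply: IH => j jm.
have d1O : holo setT (horner d1) by move=> w _; exact: (analytic_horner d1 w).
have := dm j.+1 jm.
have -> : horner d = (fun w => (w - zeta) * d1.[w]).
  by apply/funext => w; rewrite dE hornerM hornerXsubC mulrC.
rewrite (derive1n_mulXsub zeta j openT d1O I) subrr mul0r addr0 => /eqP.
by rewrite mulf_eq0 pnatr_eq0 /= => /eqP.
Qed.

Lemma prod_XsubC_dvdp s d :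
  (forall a, a \in s -> ('X - a%:P) ^+ (count_mem a s) %| d) ->
  \prod_(a <- s) ('X - a%:P) %| d.
Proof.
elim: s d => [|a s IH] d H; first by rewrite big_nil dvd1p.
have aX0 : 'X - a%:P != 0 by rewrite polyXsubC_eq0.
have := H a (mem_head _ _); rewrite /= eqxx exprSr => Ha.
have /dvdpP [d1 dE] : 'X - a%:P %| d by apply: dvdp_trans Ha; exact: dvdp_mulIr.
rewrite big_cons dE mulrC dvdp_mul2r //; apply: IH => c cs.
have [ca|ca] := eqVneq c a.
  by move: Ha; rewrite dE dvdp_mul2r // ca.
have := H c; rewrite inE cs orbT /= eq_sym (negPf ca) add0n dE => /(_ isT).
rewrite Gauss_dvdpl //; apply: coprimep_expl.
by rewrite coprimep_XsubC2 // subr_eq0 eq_sym.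
Qed.

(** Where [v] is nonzero, [u - P] is [v (r - f)] plus the Newton remainder of [v f], and both vanish
    at the nodes with multiplicity. So the node polynomial divides [u - P], whose degree is
    smaller. *)
Lemma interpolant_newton O s u v f : open O -> holo O f -> (forall a, a \in s -> O a) ->
  (forall a, a \in s -> v.[a] != 0) -> (size u <= size s)%N ->
  (forall a, a \in s -> forall j, (j < count_mem a s)%N ->
     derive1n j (ratfun u v) a = derive1n j f a) ->
  u = newton s (fun w => v.[w] * f w).
Proof.
move=> oO fO sO vs us interp.
set g := fun w => v.[w] * f w; set P := newton s g.
have gO : holo O g by move=> w Ow; exact: (analytic_mul_horner v (fO w Ow)).
pose V := [set w : R[i] | v.[w] != 0].
have oV : open V := @open_horner_neq0 R v.
pose OV := O `&` V.
have oOV : open OV by exact: openI.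
have rOV : holo OV (ratfun u v).
  by move=> w [_ Vw]; exact: (analytic_div_horner Vw (analytic_horner u w)).
have fOV : holo OV f by move=> w [Ow _]; exact: fO.
have nfOV : holo OV (fun w => -1 * f w) by move=> w Ow; exact: (analyticZ (-1) (fOV w Ow)).
have eOV : holo OV (fun w => ratfun u v w + -1 * f w).
  by move=> w Ow; exact: (analyticD (rOV w Ow) (nfOV w Ow)).
have kOV : holo OV (dds s g).
  by move=> w [Ow _]; exact: (holo_dds sO gO Ow).
suff : \prod_(a <- s) ('X - a%:P) %| u - P.
  move=> dv; apply/eqP; rewrite -subr_eq0; apply/negP => /negP nz.
  have := dvdp_leq nz dv; rewrite size_prod_XsubC leqNgt => /negP; apply.
  rewrite ltnS; apply: leq_trans (size_polyD _ _) _.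
  by rewrite size_polyN geq_max us size_newton.
apply: prod_XsubC_dvdp => a sa; apply: vanishing_dvdp.
have OVa : OV a by split; [exact: sO|exact: vs].
have e0 : vanishing (count_mem a s) (fun w => ratfun u v w + -1 * f w) a.
  move=> j jm; rewrite (derive1nD j oOV rOV nfOV OVa) (derive1nZ (-1) j oOV fOV OVa).
  by rewrite interp // mulN1r subrr.
have v0 := vanishing_mul_horner v oOV eOV OVa e0.
have k0 := @vanishing_root_prod OV s _ a oOV kOV OVa.
have veOV : holo OV (fun w => v.[w] * (ratfun u v w + -1 * f w)).
  by move=> w Ow; exact: (analytic_mul_horner v (eOV w Ow)).
have rkOV : holo OV (fun w => root_prod s w * dds s g w).
  by move=> w Ow; exact: (analytic_root_prod_mul s (kOV w Ow)).
apply: (vanishing_eq oOV _ OVa _ (vanishingD oOV veOV rkOV OVa v0 k0)) => w Ow.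
  exact: (analyticD (veOV w Ow) (rkOV w Ow)).
have := newtonE s g w; rewrite -/P {1}/g hornerD hornerN => E.
rewrite mulrDr mulN1r mulrN E /ratfun mulrCA mulfV ?mulr1; last by case: Ow.
by rewrite opprD addrA subrK.
Qed.

End Interpolation.

(** * Divided differences along segments *)

Section Jets.
Variable R : realType.
Implicit Types (h g : R[i] -> R[i]) (w a b c : R[i]) (O S : set R[i]).
Implicit Types (T : (R[i] -> R[i]) -> R[i]) (l : seq (R[i] * nat * R[i])).

(* An element [(c, i, a)] of [l] stands for the functional [c h^(i)(a)]. *)
Definition jet_sum l h : R[i] := \sum_(x <- l) x.1.1 * derive1n x.1.2 h x.2.

(** The list is fixed before [h] and its domain, so one representation serves a whole family of
    functions depending on a parameter. *)
Definition jet_represents S T l : Prop :=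
  (forall x, x \in l -> S x.2) /\
  forall O h, open O -> S `<=` O -> holo O h -> T h = jet_sum l h.

Definition is_jet S T : Prop := exists l, jet_represents S T l.

Lemma is_jet_derive S i c : S c -> is_jet S (fun h => derive1n i h c).
Proof.
move=> Sc; exists [:: (1, i, c)]; split=> [x|O h _ _ _].
  by rewrite inE => /eqP ->.
by rewrite /jet_sum big_seq1 mul1r.
Qed.

Lemma is_jet0 S : is_jet S (fun=> 0).
Proof. by exists [::]; split=> // O h _ _ _; rewrite /jet_sum big_nil. Qed.

Lemma is_jetD S T T' : is_jet S T -> is_jet S T' -> is_jet S (fun h => T h + T' h).
Proof.
move=> [l [lS lT]] [l' [l'S l'T]]; exists (l ++ l'); split=> [x|O h oO SO hO].
  by rewrite mem_cat => /orP[/lS|/l'S].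
by rewrite (lT O h oO SO hO) (l'T O h oO SO hO) /jet_sum big_cat.
Qed.

Lemma is_jetZ S c T : is_jet S T -> is_jet S (fun h => c * T h).
Proof.
move=> [l [lS lT]]; exists [seq (c * x.1.1, x.1.2, x.2) | x <- l].
split=> [x /mapP [y /lS Sy ->] //|O h oO SO hO].
rewrite (lT O h oO SO hO) /jet_sum big_map mulr_sumr.
by apply: eq_bigr => x _ /=; rewrite mulrA.
Qed.

Lemma is_jet_eq S T T' : (forall O h, open O -> S `<=` O -> holo O h -> T' h = T h) ->
  is_jet S T -> is_jet S T'.
Proof.
move=> TT' [l [lS lT]]; exists l; split=> [//|O h oO SO hO].
by rewrite (TT' O h oO SO hO); exact: (lT O h oO SO hO).
Qed.

Lemma is_jet_sum S (I : Type) (r : seq I) (T : I -> (R[i] -> R[i]) -> R[i]) :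
  (forall i, is_jet S (T i)) -> is_jet S (fun h => \sum_(i <- r) T i h).
Proof.
move=> TS; elim: r => [|i r IH].
  by apply: (is_jet_eq _ (is_jet0 S)) => O h _ _ _; rewrite big_nil.
by apply: (is_jet_eq _ (is_jetD (TS i) IH)) => O h _ _ _; rewrite big_cons.
Qed.

Lemma derive1_const c : (fun=> c : R[i])^`()%classic = (fun=> 0 : R[i]).
Proof.
apply/funext => w; apply: tangent_derive1; exists 0.
by apply/nbhs_normcP; exists 1 => // y _; rewrite subrr mulr0 subrr normc0 mul0r.
Qed.

Lemma derive1n_0 i w : derive1n i (fun=> 0 : R[i]) w = 0.
Proof. by elim: i => // i IH; rewrite derive1Sn derive1_const. Qed.

(** Leibniz's rule applied to [ddE]. The right-hand side has the form in which [tangent_powX] states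
    its derivative. *)
Lemma derive1n_dd O a h i w : open O -> holo O h -> O a -> O w ->
  derive1n i.+1 h w =
    i.+1%:R * derive1n i (dd a h) w + (w - a) * derive1n i.+1 (dd a h) w.
Proof.
move=> oO hO Oa Ow; have dO := holo_dd Oa hO.
rewrite -(derive1n_mulXsub a i oO dO Ow).
have pO : holo O (fun w => (w - a) * dd a h w).
  by move=> v Ov; exact: (analytic_mulXsub a (dO v Ov)).
have cO : holo O (fun=> h a) by move=> v _; exact: (analytic_cst (h a) v).
rewrite (@derive1n_eq _ O (fun w => h a + (w - a) * dd a h w) _ i.+1 oO _ _ w Ow); last first.
- by move=> v _; rewrite -ddE.
- by move=> v Ov; exact: (analyticD (cO v Ov) (pO v Ov)).
rewrite (derive1nD i.+1 oO cO pO Ow).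
by rewrite derive1Sn derive1_const derive1n_0 add0r.
Qed.

(** [derive1n_dd] is solved for the divided difference: at [b = a] directly, otherwise for its next
    derivative by induction on the order. *)
Lemma is_jet_derive_dd S a b i : S a -> S b ->
  is_jet S (fun h => derive1n i (dd a h) b).
Proof.
move=> Sa Sb; have [E|ba] := eqVneq b a.
  apply: (is_jet_eq _ (is_jetZ (i.+1%:R^-1) (is_jet_derive i.+1 Sa))) => O h oO SO hO.
  rewrite E (derive1n_dd i oO hO (SO a Sa) (SO a Sa)) subrr mul0r addr0 mulKf //.
have ba0 : b - a != 0 by rewrite subr_eq0.
elim: i => [|i IH].
  apply: (is_jet_eq _ (is_jetZ (b - a)^-1
    (is_jetD (is_jet_derive 0 Sb) (is_jetZ (-1) (is_jet_derive 0 Sa))))) => O h _ _ _.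
  by rewrite /= /dd (negPf ba) mulrC mulN1r.
apply: (is_jet_eq _ (is_jetZ (b - a)^-1
  (is_jetD (is_jet_derive i.+1 Sb) (is_jetZ (- i.+1%:R) IH)))) => O h oO SO hO.
rewrite (derive1n_dd i oO hO (SO a Sa) (SO b Sb)) mulNr addrAC subrr add0r.
by rewrite mulKf.
Qed.

Lemma is_jet_dd S a T : S a -> is_jet S T -> is_jet S (fun h => T (dd a h)).
Proof.
move=> Sa [l [lS lT]].
have : is_jet S (fun h => jet_sum l (dd a h)).
  elim: l lS {lT} => [|x l IH] lS.
    by apply: (is_jet_eq _ (is_jet0 S)) => O h _ _ _; rewrite /jet_sum big_nil.
  have Sx : S x.2 by apply: lS; rewrite mem_head.
  have {}IH : is_jet S (fun h => jet_sum l (dd a h)).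
    by apply: IH => y yl; apply: lS; rewrite inE yl orbT.
  apply: (is_jet_eq _ (is_jetD (is_jetZ x.1.1 (is_jet_derive_dd x.1.2 Sa Sx)) IH)).
  by move=> O h _ _ _; rewrite /jet_sum big_cons.
apply: is_jet_eq => O h oO SO hO.
exact: (lT O (dd a h) oO SO (holo_dd (SO a Sa) hO)).
Qed.

(** The left factor [M] collects the matrices [A - a] split off by the recursion. *)
Lemma is_jet_newton n (A M : 'M[R[i]]_n.+1) S s i j : (forall a, a \in s -> S a) ->
  is_jet S (fun h => (M *m horner_mx A (newton s h)) i j).
Proof.
elim: s M => [|a s IH] M sS.
  by apply: (is_jet_eq _ (is_jet0 S)) => O h _ _ _; rewrite rmorph0 mulmx0 mxE.
have Sa : S a by apply: sS; rewrite mem_head.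
have sS' b : b \in s -> S b by move=> bs; apply: sS; rewrite inE bs orbT.
apply: (is_jet_eq _ (is_jetD (is_jetZ (M i j) (is_jet_derive 0 Sa))
   (is_jet_dd Sa (IH (M *m (A - a%:M)) sS')))) => O h _ _ _ /=.
rewrite rmorphD rmorphM rmorphB /= horner_mx_X !horner_mx_C mulmxDr -mulmxA.
by rewrite [LHS]mxE mul_mx_scalar [in LHS]mxE mulrC.
Qed.

(** From here on the contour, which varies with [h], is gone. *)
Lemma is_jet_matfun n (A : 'M[R[i]]_n.+1) i j :
  is_jet (spectrum A) (fun h => matfun h A i j).
Proof.
have sS a : a \in eigenvalues A -> spectrum A a by move/spectrum_eigenvalues.
apply: (is_jet_eq _ (is_jet_newton A 1%:M i j sS)) => O h oO SO hO.
by rewrite mul1mx (matfun_newton oO SO hO).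
Qed.

End Jets.

(** * Removing the nodes one at a time *)

Section MeanValueStep.
Variable R : realType.
Implicit Types (h g : R[i] -> R[i]) (w a b c mu x : R[i]) (s t : R).
Implicit Types (O S Z U : set R[i]).

Lemma tangent_eq g h w l : g =1 h -> tangent g w l -> tangent h w l.
Proof. by move=> /funext ->. Qed.

Lemma tangent_powX g a e tau l q : tangent g (a + tau * e) l ->
  tangent (fun y => y ^+ q.+1 * g (a + y * e)) tau
    (tau ^+ q * (q.+1%:R * g (a + tau * e) + tau * e * l)).
Proof.
move=> gt.
have g0 : tangent (fun y => g (a + y * e)) tau (e * l).
  have : tangent (fun y => g (a + e * y)) tau (e * l).
    by apply: tangent_affine; rewrite [e * tau]mulrC.
  by apply: tangent_eq => y; rewrite [e * y]mulrC.
elim: q => [|q IH].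
  have := tangent_mulXsub 0 g0.
  have -> : g (a + tau * e) + (tau - 0) * (e * l) =
     tau ^+ 0 * (1%:R * g (a + tau * e) + tau * e * l) by ring.
  by apply: tangent_eq => y; rewrite subr0 expr1.
have := tangent_mulXsub 0 IH.
have -> : tau ^+ q.+1 * g (a + tau * e) +
    (tau - 0) * (tau ^+ q * (q.+1%:R * g (a + tau * e) + tau * e * l)) =
    tau ^+ q.+1 * (q.+2%:R * g (a + tau * e) + tau * e * l).
  by rewrite -[q.+2%:R]natr1 exprS; ring.
by apply: tangent_eq => y; rewrite subr0 mulrA -exprS.
Qed.

Lemma tangent_cst c w : tangent (fun=> c) w 0.
Proof.
exists 0; apply/nbhs_normcP; exists 1 => // y _.
by rewrite subrr mulr0 subrr normc0 mul0r.
Qed.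

Lemma tangent_sum (I : eqType) (r : seq I) (f : I -> R[i] -> R[i]) (d : I -> R[i]) w :
  (forall i, i \in r -> tangent (f i) w (d i)) ->
  tangent (fun y => \sum_(i <- r) f i y) w (\sum_(i <- r) d i).
Proof.
elim: r => [|i r IH] H.
  have -> : (fun y => \sum_(i <- [::]) f i y) = (fun=> 0).
    by apply/funext => y; rewrite big_nil.
  by rewrite big_nil; exact: tangent_cst.
have -> : (fun y => \sum_(j <- i :: r) f j y) = (fun y => f i y + \sum_(j <- r) f j y).
  by apply/funext => y; rewrite big_cons.
rewrite big_cons; apply: tangentD; first by apply: H; rewrite mem_head.
by apply: IH => j jr; apply: H; rewrite inE jr orbT.
Qed.

Definition affine_comp s mu g : R[i] -> R[i] := fun w => g ((1 - s)%:C * mu + s%:C * w).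

Variables (S Z U : set R[i]) (T : (R[i] -> R[i]) -> R[i]).
Hypothesis oU : open U.
Hypothesis ZU : Z `<=` U.
Hypothesis SZU : forall s mu c, 0 <= s <= 1 -> Z mu -> S c ->
  U ((1 - s)%:C * mu + s%:C * c).
Hypothesis Zconvex : forall t x y, 0 <= t <= 1 -> Z x -> Z y ->
  Z ((1 - t)%:C * x + t%:C * y).
Hypothesis TS : is_jet S T.

(** Contracting towards [a] scales the coefficient of [w] to [t * s]; the rest, divided by
    [1 - t * s], is a convex combination of [a] and [mu]. If [t * s = 1] the map is the identity and
    any point of [Z] can serve as [mu']. *)
Lemma segment_reparam s t a mu : 0 <= s <= 1 -> 0 <= t <= 1 -> Z a -> Z mu ->
  exists s' mu', [/\ 0 <= s' <= 1, Z mu' & forall w,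
    (1 - s')%:C * mu' + s'%:C * w = a + t%:C * ((1 - s)%:C * mu + s%:C * w - a)].
Proof.
move=> /andP[s0 s1] /andP[t0 t1] Za Zmu.
have ts1 : t * s <= 1 by rewrite mulr_ile1.
have [E|ts] := eqVneq (t * s) 1.
  have tE : t = 1 by apply/eqP; rewrite eq_le t1 -E ler_piMr.
  have sE : s = 1 by rewrite -E tE mul1r.
  exists 1, a; rewrite ler01 lexx; split=> // w.
  by rewrite tE sE subrr -[0%:C]/(0 : R[i]) -[1%:C]/(1 : R[i]); ring.
have d0 : 0 < 1 - t * s by rewrite subr_gt0 lt_neqAle ts.
pose th := t * (1 - s) / (1 - t * s).
exists (t * s), ((1 - th)%:C * a + th%:C * mu); split.
- by rewrite mulr_ge0.
- apply: Zconvex => //; apply/andP; split.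
    by rewrite divr_ge0 ?mulr_ge0 ?subr_ge0.
  by rewrite /th ler_pdivrMr // mul1r mulrBr mulr1 lerD2r.
- move=> w; have E1 : (1 - t * s) * (1 - th) = 1 - t by rewrite /th; field; rewrite gt_eqF.
  have E2 : (1 - t * s) * th = t * (1 - s) by rewrite /th; field; rewrite gt_eqF.
  rewrite mulrDr !mulrA -!rmorphM E1 E2 !rmorphM !rmorphB !rmorph1 /=; ring.
Qed.

Lemma dd_mean_value_step h a i (M : R) : holo U h -> Z a ->
  (forall s mu, 0 <= s <= 1 -> Z mu ->
     complex.Re (T (affine_comp s mu (derive1n i.+1 h))) <= M) ->
  forall s mu, 0 <= s <= 1 -> Z mu ->
     complex.Re (T (affine_comp s mu (derive1n i (dd a h)))) <= M / i.+1%:R.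
Proof.
move=> hU Za hM s mu s01 Zmu.
have [l [lS lT]] := TS.
pose k := dd a h; have kU : holo U k := holo_dd (ZU Za) hU.
pose c0 := (1 - s)%:C * mu; pose e c := c0 + s%:C * c - a.
(* [Y t] is [t^(i+1)] times [T] applied to [k^(i)(a + t (x - a))], and [dY] its
   derivative; writing [T] as a jet extends both to complex [t]. *)
pose Y tau : R[i] := \sum_(x <- l) x.1.1 * s%:C ^+ x.1.2 *
  (tau ^+ (i + x.1.2).+1 * derive1n (i + x.1.2) k (a + tau * e x.2)).
pose dY tau : R[i] := \sum_(x <- l) x.1.1 * s%:C ^+ x.1.2 *
  (tau ^+ (i + x.1.2) * derive1n (i + x.1.2).+1 h (a + tau * e x.2)).
have reparam t : 0 <= t <= 1 -> exists s' mu', [/\ 0 <= s' <= 1, Z mu' & forall w,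
    (1 - s')%:C * mu' + s'%:C * w = a + t%:C * e w].
  by move=> t01; exact: segment_reparam.
have eU t c : 0 <= t <= 1 -> S c -> U (a + t%:C * e c).
  move=> /reparam [s' [mu' [s'01 Zmu' <-]]] Sc; exact: SZU.
have affE t : forall w, a + t%:C * e w = (a + t%:C * (c0 - a)) + (t%:C * s%:C) * w.
  by move=> w; rewrite /e; ring.
(* A derivative of order [j] in [w] brings out [(t s)^j]; its power of [t] accounts for the
   exponents [i + x.1.2] in [Y] and [dY]. *)
have TE t g : 0 <= t <= 1 -> holo U g ->
    T (fun w => g (a + t%:C * e w)) = \sum_(x <- l) x.1.1 *
      ((t%:C * s%:C) ^+ x.1.2 * derive1n x.1.2 g (a + t%:C * e x.2)).
  move=> t01 gU; pose O := [set w | U ((a + t%:C * (c0 - a)) + (t%:C * s%:C) * w)].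
  have oO : open O := @open_affine_preimage R U (a + t%:C * (c0 - a)) (t%:C * s%:C) oU.
  have SO : S `<=` O by move=> c Sc; rewrite /O /= -affE; exact: eU.
  have -> : (fun w => g (a + t%:C * e w)) =
     (fun w => g ((a + t%:C * (c0 - a)) + (t%:C * s%:C) * w)).
    by apply/funext => w; rewrite affE.
  have gO : holo O (fun w => g ((a + t%:C * (c0 - a)) + (t%:C * s%:C) * w)).
    by move=> w Ow; apply: analytic_affine; exact: gU.
  rewrite (lT O _ oO SO gO) /jet_sum; apply: eq_big_seq => x xl; congr (_ * _).
  have Ox := SO _ (lS x xl).
  by rewrite (derive1n_affine x.1.2 oU gU Ox) affE.
have TkE t : 0 <= t <= 1 ->
    Y t%:C = t%:C ^+ i.+1 * T (fun w => derive1n i k (a + t%:C * e w)).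
  move=> t01; rewrite (TE t _ t01 (holo_derive1n i kU)) mulr_sumr.
  apply: eq_bigr => x _.
  have -> : derive1n x.1.2 (derive1n i k) = derive1n (i + x.1.2) k.
    by rewrite /derive1n -iterD addnC.
  by rewrite exprMn -addSn exprD; ring.
have ThE t : 0 <= t <= 1 ->
    dY t%:C = t%:C ^+ i * T (fun w => derive1n i.+1 h (a + t%:C * e w)).
  move=> t01; rewrite (TE t _ t01 (holo_derive1n i.+1 hU)) mulr_sumr.
  apply: eq_bigr => x _.
  have -> : derive1n x.1.2 (derive1n i.+1 h) = derive1n (i + x.1.2).+1 h.
    by rewrite /derive1n -iterD addnC.
  by rewrite exprMn exprD; ring.
have YdY t : 0 <= t <= 1 -> tangent Y t%:C (dY t%:C).
  move=> t01; apply: tangent_sum => x xl; apply: tangentZ.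
  have Ux := eU t x.2 t01 (lS x xl).
  have := derive1n_dd (i + x.1.2) oU hU (ZU Za) Ux; rewrite [a + _]addrC addrK addrC -/k => ->.
  apply: tangent_powX; rewrite derive1nS; apply: analytic_tangent.
  exact: (holo_derive1n (i + x.1.2) kU).
(* The derivative of [phi] is [t^i] times the excess of a quantity bounded by [M] over [M], so [phi]
   does not increase from 0 to 1. As [Y] vanishes at 0, comparing the endpoints is the claim. *)
pose phi t : R := complex.Re (Y t%:C) - M / i.+1%:R * t ^+ i.+1.
have dphi t : 0 <= t <= 1 -> is_derive t 1 phi (complex.Re (dY t%:C) - M * t ^+ i).
  move=> t01.
  have pid : path_derive (fun s : R => s%:C) t 1.
    by apply: (path_derive_complex (y := fun=> 0)); apply: is_derive_eq.
  have := path_derive_Re (path_derive_comp pid (YdY t t01)); rewrite mul1r => dR.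
  have dX : is_derive t 1 (fun t => M / i.+1%:R * t ^+ i.+1) (M * t ^+ i).
    have dXn : is_derive t 1 (fun t => t ^+ i.+1) (i.+1%:R *: t ^+ i *: 1).
      by split; [exact: exprn_derivable|rewrite exp_derive].
    have -> : M * t ^+ i = M / i.+1%:R *: (i.+1%:R *: t ^+ i *: 1).
      by rewrite -![_ *: _]/(_ * _) mulr1 mulrA divfK // pnatr_eq0.
    exact: (is_deriveZ (M / i.+1%:R) dXn).
  exact: (is_deriveB dR dX).
have cphi : {within `[0, 1], continuous phi}.
  apply: continuous_in_subspaceT => t; rewrite inE /= in_itv /= => t01.
  apply: differentiable_continuous; apply/derivable1_diffP.
  by have [] := dphi t t01.
have dphi_oo t : t \in `]0, 1[ -> is_derive t 1 phi (complex.Re (dY t%:C) - M * t ^+ i).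
  by rewrite in_itv /= => /andP[/ltW t0 /ltW t1]; apply: dphi; rewrite t0.
have [c] := MVT ltr01 dphi_oo cphi.
rewrite in_itv /= => /andP[/ltW c0' /ltW c1].
have c01 : 0 <= c <= 1 by rewrite c0'.
rewrite subr0 mulr1 => phiE.
have Re_real (r : R) (y : R[i]) : complex.Re (r%:C * y) = r * complex.Re y.
  by case: y => ? ? /=; rewrite mul0r subr0.
have : phi 1 - phi 0 <= 0.
  rewrite phiE (ThE c c01) -rmorphXn Re_real mulrC -mulrBl mulr_le0_ge0 ?exprn_ge0 //.
  rewrite subr_le0; have [s' [mu' [s'01 Zmu' E]]] := reparam c c01.
  have -> : (fun w => derive1n i.+1 h (a + c%:C * e w)) =
      affine_comp s' mu' (derive1n i.+1 h).
    by apply/funext => w; rewrite /affine_comp E.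
  exact: hM.
rewrite /phi.
have -> : Y (0 : R)%:C = 0.
  by rewrite /Y big1 // => x _; rewrite expr0n /= mul0r mulr0.
rewrite (TkE 1) ?ler01 ?lexx // -rmorphXn !expr1n Re_real mul1r expr0n /= mulr0 mulr1.
rewrite subr0 subr0 subr_le0.
have -> // : (fun w => derive1n i k (a + (1 : R)%:C * e w)) = affine_comp s mu (derive1n i k).
apply/funext => w; rewrite /affine_comp /e /c0 -[(1 : R)%:C]/(1 : R[i]) mul1r.
by rewrite addrC subrK.
Qed.

(** Removing the head node costs the divisor [(j + size zs).+1], the order of the derivative before
    the step; these divisors telescope into the quotient of factorials. *)
Lemma affine_comp_continuation h zs j (M : R) : holo U h ->
  (forall a, a \in zs -> Z a) ->
  (forall s mu, 0 <= s <= 1 -> Z mu ->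
     complex.Re (T (affine_comp s mu (derive1n (j + size zs) h))) <= M) ->
  forall s mu, 0 <= s <= 1 -> Z mu ->
     complex.Re (T (affine_comp s mu (derive1n j (dds zs h)))) <=
       M * j`!%:R / (j + size zs)`!%:R.
Proof.
elim: zs h M => [|a zs IH] h M hU zsZ hM s mu s01 Zmu.
  rewrite /= addn0 mulfK ?pnatr_eq0 -?lt0n ?fact_gt0 //.
  by move: hM; rewrite /= addn0; apply.
have Za : Z a by apply: zsZ; rewrite mem_head.
have zsZ' c : c \in zs -> Z c by move=> cz; apply: zsZ; rewrite inE cz orbT.
have := IH (dd a h) (M / (j + size zs).+1%:R) (holo_dd (ZU Za) hU) zsZ' _ s mu s01 Zmu.
have -> : M / (j + size zs).+1%:R * j`!%:R / (j + size zs)`!%:R =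
    M * j`!%:R / (j + size (a :: zs))`!%:R.
  rewrite /= addnS factS natrM; field.
  by rewrite pnatr_eq0 -lt0n fact_gt0 -!natrD -[1]/(1%:R) -natrD pnatr_eq0.
apply; apply: (dd_mean_value_step hU Za) => s' mu' s'01 Zmu'.
by move: (hM s' mu' s'01 Zmu'); rewrite /= addnS.
Qed.

End MeanValueStep.

(** * Convex hulls and Euclidean norms *)

Section ConvexHull.
Variable R : realType.
Implicit Types (a w x y mu : R[i]) (t : R) (S X : set R[i]) (s : seq R[i]).

Lemma convex_setP X : @convex_set R (Rcomplex R) X <->
  forall t x y, 0 <= t <= 1 -> X x -> X y -> X ((1 - t)%:C * x + t%:C * y).
Proof.
have convE (l : {i01 R}) x y : conv l (x : convex_lmodType (Rcomplex R)) y =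
    (l%:num)%:C * x + (1 - l%:num)%:C * y.
  by case: x y => [a b] [c d]; apply/eqP; rewrite eq_complex /=; apply/andP; split;
    apply/eqP; rewrite !mul0r ?subr0 ?addr0.
split=> H.
  move=> t x y /andP[t0 t1] Xx Xy.
  have := H y x (Itv01 t0 t1); rewrite !inE => /(_ Xy Xx).
  by rewrite convE /= addrC.
move=> x y l; rewrite !inE => Xx Xy; rewrite convE addrC.
by apply: H => //; apply/andP; split.
Qed.

Lemma conv_hull_convex S t x y : 0 <= t <= 1 -> conv_hull S x -> conv_hull S y ->
  conv_hull S ((1 - t)%:C * x + t%:C * y).
Proof.
move=> t01 Sx Sy X [cX SX]; move/convex_setP: (cX); apply=> //.
  by apply: Sx; split.
by apply: Sy; split.
Qed.

Lemma sub_conv_hull S : S `<=` conv_hull S.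
Proof. exact: sub_gen_smallest. Qed.

Lemma conv_hull_min S X :
  (forall t x y, 0 <= t <= 1 -> X x -> X y -> X ((1 - t)%:C * x + t%:C * y)) ->
  S `<=` X -> conv_hull S `<=` X.
Proof. by move=> /convex_setP cX SX; exact: smallest_sub. Qed.

Lemma conv_hull_mono S X : S `<=` X -> conv_hull S `<=` conv_hull X.
Proof.
move=> SX; apply: conv_hull_min; first by move=> *; exact: conv_hull_convex.
by move=> x /SX; exact: sub_conv_hull.
Qed.

Definition segment_pt a (p : R * R[i]) : R[i] := (1 - p.1)%:C * a + p.1%:C * p.2.

(** The union of the segments from [a] to the smaller hull is already convex. It is the continuous
    image of a product, whence compactness by induction. *)
Lemma conv_hull_cons a b s : conv_hull [set w | w \in [:: a, b & s]] =
  segment_pt a @` (`[0, 1]%classic `*` conv_hull [set w | w \in b :: s]).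
Proof.
set K := conv_hull [set w | w \in b :: s].
have Kb : K b by apply: sub_conv_hull; rewrite /= mem_head.
apply/seteqP; split; last first.
  move=> _ [[t mu] [/= t01 Kmu] <-]; apply: conv_hull_convex.
  - by move: t01; rewrite in_itv.
  - by apply: sub_conv_hull; rewrite /= mem_head.
  - by move: Kmu; apply: conv_hull_mono => w /= ws; rewrite inE ws orbT.
apply: conv_hull_min => [tau _ _ tau01 [[t1 m1] [/= t101 Km1] <-] [[t2 m2] [/= t201 Km2] <-]|].
  move: t101 t201; rewrite /segment_pt !in_itv /= => /andP[t10 t11] /andP[t20 t21].
  have /andP[tau0 tau1] := tau01.
  have tau1' : 0 <= 1 - tau by rewrite subr_ge0.
  pose T := (1 - tau) * t1 + tau * t2.
  have T0 : 0 <= T by rewrite addr_ge0 ?mulr_ge0.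
  have T1 : T <= 1.
    rewrite -[1](subrK tau) -[X in _ <= _ + X]mulr1 -[X in _ <= X + _]mulr1.
    by apply: lerD; rewrite ler_wpM2l.
  have RE : (1 - tau)%:C * ((1 - t1)%:C * a + t1%:C * m1) +
      tau%:C * ((1 - t2)%:C * a + t2%:C * m2) =
      (1 - T)%:C * a + (((1 - tau) * t1)%:C * m1 + (tau * t2)%:C * m2).
    by rewrite /T !(rmorphM, rmorphB, rmorphD, rmorph1) /=; ring.
  (* [T] is the total weight away from [a]. If it is zero the point is [a] itself; otherwise
     dividing by it gives a convex combination of [m1] and [m2]. *)
  rewrite RE; have [TE|Tn0] := eqVneq T 0.
    have /andP[/eqP E1 /eqP E2] : ((1 - tau) * t1 == 0) && (tau * t2 == 0).
      by rewrite -paddr_eq0 ?mulr_ge0 // -/T TE.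
    exists (0, m1); first by split=> //=; rewrite in_itv /= lexx ler01.
    by rewrite TE E1 E2 /= -[(0 : R)%:C]/(0 : R[i]) !mul0r !addr0.
  pose th := tau * t2 / T.
  have th01 : 0 <= th <= 1.
    have Tgt0 : 0 < T by rewrite lt_def Tn0.
    apply/andP; split; first by rewrite divr_ge0 ?mulr_ge0.
    by rewrite /th ler_pdivrMr // mul1r lerDr mulr_ge0.
  exists (T, (1 - th)%:C * m1 + th%:C * m2).
    by split; [rewrite /= in_itv /= T0|exact: conv_hull_convex].
  have E1 : T * (1 - th) = (1 - tau) * t1 by rewrite /th mulrBr mulr1 mulrC divfK // /T; ring.
  have E2 : T * th = tau * t2 by rewrite /th mulrC divfK.
  by rewrite /segment_pt /= [T%:C * _]mulrDr !mulrA -!rmorphM E1 E2.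
move=> w /=; rewrite inE => /predU1P[->|ws].
  exists (0, b); first by split=> //=; rewrite in_itv /= lexx ler01.
  by rewrite /segment_pt /= subr0 -[(1 : R)%:C]/(1 : R[i]) -[(0 : R)%:C]/(0 : R[i]) mul1r mul0r addr0.
exists (1, w); last first.
  by rewrite /segment_pt /= subrr -[(1 : R)%:C]/(1 : R[i]) -[(0 : R)%:C]/(0 : R[i]) mul1r mul0r add0r.
by split; [rewrite /= in_itv /= lexx ler01|exact: sub_conv_hull].
Qed.

Lemma segment_pt_continuous a : continuous (segment_pt a).
Proof.
move=> p.
have c1 : (fun q : R * R[i] => q.1%:C) @ p --> p.1%:C.
  by apply: cvg_real_complex; exact: cvg_fst.
have c2 : (fun q : R * R[i] => (1 - q.1)%:C) @ p --> (1 - p.1)%:C.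
  apply: cvg_real_complex; apply: cvgB; [exact: cvg_cst|exact: cvg_fst].
have c3 : (fun q : R * R[i] => q.2) @ p --> p.2 by exact: cvg_snd.
exact: (cvg_addc (cvg_mulc c2 (cvg_cst a)) (cvg_mulc c1 c3)).
Qed.

Lemma conv_hull_compact a s : compact (conv_hull [set w | w \in a :: s]).
Proof.
elim: s a => [|b s IH] a.
  suff -> : conv_hull [set w | w \in [:: a]] = [set a] by exact: compact_set1.
  apply/seteqP; split; last by move=> _ ->; apply: sub_conv_hull; rewrite /= mem_head.
  apply: conv_hull_min => [t _ _ _ -> ->|w]; last by rewrite /= inE => /eqP.
  by rewrite /= -mulrDl -rmorphD subrK mul1r.
rewrite conv_hull_cons; apply: continuous_compact.
  by apply: continuous_subspaceT; exact: segment_pt_continuous.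
by apply: compact_setX; [exact: segment_compact|exact: IH].
Qed.

End ConvexHull.

Section Norm2.
Variables (R : realType) (n : nat).
Implicit Types x y : 'cV[R[i]]_n.

Lemma norm2E x : norm2 x = Num.sqrt (\sum_(k < n) normc (x k 0) ^+ 2).
Proof. by rewrite /norm2; congr Num.sqrt; apply: eq_bigr => k _; rewrite normcC. Qed.

Lemma norm2_ge0 x : 0 <= norm2 x. Proof. exact: sqrtr_ge0. Qed.

Lemma sqr_norm2 x : norm2 x ^+ 2 = \sum_(k < n) normc (x k 0) ^+ 2.
Proof. by rewrite norm2E sqr_sqrtr // sumr_ge0 // => k _; exact: sqr_ge0. Qed.

Lemma norm2Z (c : R) x : 0 <= c -> norm2 (c%:C *: x) = c * norm2 x.
Proof.
move=> c0; rewrite !norm2E -[in RHS](ger0_norm c0) -sqrtr_sqr -sqrtrM ?sqr_ge0 //.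
congr Num.sqrt; rewrite mulr_sumr; apply: eq_bigr => k _.
by rewrite mxE normcM normc_real exprMn real_normK ?num_real.
Qed.

(** Cauchy-Schwarz, by expanding a sum of squares in which each vector is scaled by the norm of the
    other. *)
Lemma Re_dot_le x y :
  complex.Re (\sum_(k < n) (x k 0)^* * y k 0) <= norm2 x * norm2 y.
Proof.
have : complex.Re (\sum_(k < n) (x k 0)^* * y k 0) <=
    \sum_(k < n) normc (x k 0) * normc (y k 0).
  apply: le_trans (ler_norm _) _; apply: le_trans (normc_Re _) _.
  apply: le_trans (normc_sum _ _ _) _; apply: ler_sum => k _.
  by rewrite normcM; case: (x k 0) => a b /=; rewrite sqrrN.
move/le_trans; apply.
set X := norm2 x; set Y := norm2 y.
have X0 : 0 <= X := norm2_ge0 x; have Y0 : 0 <= Y := norm2_ge0 y.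
have key : 2 * (X * Y) * (\sum_(k < n) normc (x k 0) * normc (y k 0)) <= 2 * (X * Y) * (X * Y).
  have : 0 <= \sum_(k < n) (Y * normc (x k 0) - X * normc (y k 0)) ^+ 2.
    by apply: sumr_ge0 => k _; exact: sqr_ge0.
  have -> : \sum_(k < n) (Y * normc (x k 0) - X * normc (y k 0)) ^+ 2 =
     Y ^+ 2 * (\sum_(k < n) normc (x k 0) ^+ 2) +
     X ^+ 2 * (\sum_(k < n) normc (y k 0) ^+ 2) -
       2 * (X * Y) * (\sum_(k < n) normc (x k 0) * normc (y k 0)).
    clearbody X Y; rewrite !mulr_sumr -big_split -sumrB /=.
    by apply: eq_bigr => k _; ring.
  rewrite -!sqr_norm2 -/X -/Y.
  by rewrite subr_ge0 => /le_trans; apply; rewrite le_eqVlt; apply/orP; left; apply/eqP; ring.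
have [XY|XY] := eqVneq (X * Y) 0; last first.
  have XY0 : 0 < 2 * (X * Y) by rewrite mulr_gt0 // lt_def XY mulr_ge0.
  by rewrite -(ler_pM2l XY0).
rewrite XY; have zero (v : 'cV[R[i]]_n) : norm2 v = 0 -> forall k, normc (v k 0) = 0.
  move=> v0 k; have := sqr_norm2 v; rewrite v0 expr0n /= => /esym/eqP.
  rewrite psumr_eq0 => [|i _]; last exact: sqr_ge0.
  by move=> /allP /(_ k (mem_index_enum _)) /=; rewrite sqrf_eq0 => /eqP.
move/eqP: XY; rewrite mulf_eq0 => /orP[] /eqP /zero z0; rewrite big1 // => k _.
  by rewrite z0 mul0r.
by rewrite z0 mulr0.
Qed.

Lemma dot_self x : \sum_(k < n) (x k 0)^* * x k 0 = (norm2 x ^+ 2)%:C.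
Proof.
rewrite sqr_norm2 rmorph_sum; apply: eq_bigr => k _ /=.
by rewrite mulrC -[(x k 0)^*]/(conjc (x k 0)) -sqr_normc normcC rmorphXn.
Qed.

End Norm2.

(** * The error bound *)

Section Bound.
Variables (R : realType) (n : nat) (A : 'M[R[i]]_n.+1).
Implicit Types (h g : R[i] -> R[i]) (w a c mu : R[i]) (t : R) (U Z : set R[i]).

Lemma is_jet_mulmx m p (X : 'M[R[i]]_(m, n.+1)) (Y : 'M[R[i]]_(n.+1, p)) i j :
  is_jet (spectrum A) (fun h => (X *m matfun h A *m Y) i j).
Proof.
have H : is_jet (spectrum A) (fun h => \sum_l Y l j * (\sum_k X i k * matfun h A k l)).
  by apply: is_jet_sum => l; apply: is_jetZ; apply: is_jet_sum => k; apply: is_jetZ;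
    exact: is_jet_matfun.
apply: (is_jet_eq _ H) => O h _ _ _; rewrite mxE; apply: eq_bigr => l _.
by rewrite mulrC mxE.
Qed.

(** [F] is the explicit jet formula. Its continuity at a point can be read off, whereas [matfun]
    involves an arbitrary choice of contour for each parameter. *)
Lemma affine_comp_jet_continuous U (T : (R[i] -> R[i]) -> R[i]) (S : set R[i]) h :
  open U -> holo U h -> is_jet S T ->
  exists F : R * R[i] -> R[i],
    (forall p, (forall c, S c -> U ((1 - p.1)%:C * p.2 + p.1%:C * c)) ->
      T (affine_comp p.1 p.2 h) = F p /\ {for p, continuous F}).
Proof.
move=> oU hU [l [lS lT]].
exists (fun p => \sum_(x <- l) x.1.1 *
  (p.1%:C ^+ x.1.2 * derive1n x.1.2 h ((1 - p.1)%:C * p.2 + p.1%:C * x.2))).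
move=> p pU; split.
  pose O := [set w | U ((1 - p.1)%:C * p.2 + p.1%:C * w)].
  have oO : open O := @open_affine_preimage R U _ _ oU.
  have hO : holo O (affine_comp p.1 p.2 h).
    by move=> w Ow; apply: analytic_affine; exact: hU.
  rewrite (lT O _ oO pU hO) /jet_sum; apply: eq_big_seq => x xl; congr (_ * _).
  exact: (derive1n_affine x.1.2 oU hU (pU _ (lS x xl))).
have c1 : (fun q : R * R[i] => q.1%:C) @ p --> p.1%:C.
  by apply: cvg_real_complex; exact: cvg_fst.
have c2 : (fun q : R * R[i] => (1 - q.1)%:C) @ p --> (1 - p.1)%:C.
  apply: cvg_real_complex; apply: cvgB; [exact: cvg_cst|exact: cvg_fst].
have c3 : (fun q : R * R[i] => q.2) @ p --> p.2 by exact: cvg_snd.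
have cX m : (fun q : R * R[i] => q.1%:C ^+ m) @ p --> p.1%:C ^+ m.
  elim: m => [|m IH].
    have -> : (fun q : R * R[i] => q.1%:C ^+ 0) = fun=> 1 by apply/funext => q; rewrite expr0.
    by rewrite expr0; exact: cvg_cst.
  have -> : (fun q : R * R[i] => q.1%:C ^+ m.+1) = (fun q => q.1%:C * q.1%:C ^+ m).
    by apply/funext => q; rewrite exprS.
  by rewrite exprS; exact: (cvg_mulc c1 IH).
elim: l lS {lT} => [|x l IH] lS.
  have -> : (fun p : R * R[i] => \sum_(x <- [::]) x.1.1 * (p.1%:C ^+ x.1.2 *
      derive1n x.1.2 h ((1 - p.1)%:C * p.2 + p.1%:C * x.2))) = fun=> 0.
    by apply/funext => q; rewrite big_nil.
  exact: cvg_cst.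
have {}IH := IH (fun y yl => lS y (mem_behead (s := x :: l) yl)).
have Sx : S x.2 by apply: lS; rewrite mem_head.
have cx : (fun q : R * R[i] => (1 - q.1)%:C * q.2 + q.1%:C * x.2) @ p -->
    (1 - p.1)%:C * p.2 + p.1%:C * x.2.
  exact: (cvg_addc (cvg_mulc c2 c3) (cvg_mulc c1 (cvg_cst x.2))).
have dx := analytic_continuous (holo_derive1n x.1.2 hU (pU _ Sx)).
have cdx := cvg_comp _ _ cx dx.
have cterm := cvg_mulcl x.1.1 (cvg_mulc (cX x.1.2) cdx).
set G := (X in {for p, continuous X}).
suff -> : G = (fun q : R * R[i] => x.1.1 * (q.1%:C ^+ x.1.2 *
      derive1n x.1.2 h ((1 - q.1)%:C * q.2 + q.1%:C * x.2)) +
    \sum_(y <- l) y.1.1 * (q.1%:C ^+ y.1.2 *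
      derive1n y.1.2 h ((1 - q.1)%:C * q.2 + q.1%:C * y.2))).
  exact: (cvg_addc (cterm _ _) IH).
by apply/funext => q; rewrite /G big_cons.
Qed.

End Bound.

(** * The norm estimate and the attained maximum *)

Section MaximumPrinciple.
Variables (R : realType) (n p : nat) (A : 'M[R[i]]_n.+1).
Variables (C0 : 'M[R[i]]_(p, n.+1)) (b : 'cV[R[i]]_n.+1).
Variables (U : set R[i]) (zs : seq R[i]) (g : R[i] -> R[i]).
Local Notation Z := (conv_hull [set w | w \in zs]).
Hypothesis zs0 : zs != [::].
Hypothesis oU : open U.
Hypothesis hullU : conv_hull (spectrum A `|` [set w | w \in zs]) `<=` U.
Hypothesis gU : holo U g.

Let ZU : Z `<=` U.
Proof.
apply: (subset_trans _ hullU); apply: conv_hull_mono => w ws; by right.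
Qed.

Let SZU t mu c : 0 <= t <= 1 -> Z mu -> spectrum A c ->
  U ((1 - t)%:C * mu + t%:C * c).
Proof.
move=> t01 Zmu Ac; apply: hullU; apply: conv_hull_convex => //.
  by move: Zmu; apply: conv_hull_mono => w ws; right.
by apply: sub_conv_hull; left.
Qed.

Let F (h : R[i] -> R[i]) : 'cV[R[i]]_p := C0 *m matfun h A *m b.

Let value_matfun h t mu : holo U h -> 0 <= t <= 1 -> Z mu ->
  C0 *m matfun h (((1 - t)%:C * mu)%:M + t%:C *: A) *m b = F (affine_comp t mu h).
Proof.
move=> hU t01 Zmu; rewrite (matfun_affine oU hU) // => a Aa; exact: SZU.
Qed.

(** Pairing with the vector [V0] itself gives its squared norm on one side and, by Cauchy-Schwarz,
    its norm times the bound on the other; one norm cancels. *)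
Lemma norm2_dds_le (m : R) :
  (forall t mu, 0 <= t <= 1 -> Z mu ->
    norm2 (C0 *m matfun (derive1n (size zs) g) (((1 - t)%:C * mu)%:M + t%:C *: A) *m b) <= m) ->
  norm2 (C0 *m matfun (dds zs g) A *m b) <= m / (size zs)`!%:R.
Proof.
move=> bnd; set V0 := C0 *m _ *m b.
pose T h : R[i] := \sum_(k < p) (V0 k 0)^* * F h k 0.
have TS : is_jet (spectrum A) T.
  by apply: is_jet_sum => k; apply: is_jetZ; exact: is_jet_mulmx.
have gN := holo_derive1n (size zs) gU.
have hyp t mu : 0 <= t <= 1 -> Z mu ->
    complex.Re (T (affine_comp t mu (derive1n (0 + size zs) g))) <= norm2 V0 * m.
  move=> t01 Zmu; apply: le_trans (Re_dot_le _ _) _.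
  by rewrite ler_wpM2l ?norm2_ge0 // -(value_matfun gN t01 Zmu); exact: bnd.
have [z0 z0s] : exists z0, z0 \in zs.
  by case: zs zs0 => // a s _; exists a; rewrite mem_head.
have Zz0 : Z z0 by apply: sub_conv_hull.
have zsZ a : a \in zs -> Z a by move=> azs; apply: sub_conv_hull.
have l01 : 0 <= (1 : R) <= 1 by rewrite ler01 lexx.
have := affine_comp_continuation oU ZU SZU (@conv_hull_convex R _) TS gU zsZ hyp l01 Zz0.
(* At parameter 1 the affine map is the identity, so any node may stand for [mu]. *)
have -> : affine_comp 1 z0 (derive1n 0 (dds zs g)) = dds zs g.
  by apply/funext => w; rewrite /affine_comp subrr -[(1 : R)%:C]/(1 : R[i])
    -[(0 : R)%:C]/(0 : R[i]) mul0r add0r mul1r.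
rewrite /T dot_self /= mulr1 expr2 -mulrA.
have [->|V00] := eqVneq (norm2 V0) 0.
  have m0 : 0 <= m by apply: le_trans (bnd 1 z0 l01 Zz0); exact: norm2_ge0.
  by rewrite divr_ge0.
by rewrite ler_pM2l // lt_def V00 norm2_ge0.
Qed.

Lemma norm2_matfun_max h : holo U h ->
  exists t mu, [/\ 0 <= t <= 1, Z mu & forall s nu, 0 <= s <= 1 -> Z nu ->
    norm2 (C0 *m matfun h (((1 - s)%:C * nu)%:M + s%:C *: A) *m b) <=
    norm2 (C0 *m matfun h (((1 - t)%:C * mu)%:M + t%:C *: A) *m b)].
Proof.
move=> hU.
have /choice [f fE] : forall k : 'I_p, exists f : R * R[i] -> R[i], forall q,
    (forall c, spectrum A c -> U ((1 - q.1)%:C * q.2 + q.1%:C * c)) ->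
    F (affine_comp q.1 q.2 h) k 0 = f q /\ {for q, continuous f}.
  by move=> k; exact: (affine_comp_jet_continuous oU hU (is_jet_mulmx A C0 b k 0)).
pose D : set (R * R[i]) := `[0, 1]%classic `*` Z.
have DU q : D q -> forall c, spectrum A c -> U ((1 - q.1)%:C * q.2 + q.1%:C * c).
  by case=> q1 q2 c Ac; apply: SZU => //; move: q1; rewrite /= in_itv.
(* Built from the jets [f], so that it is defined and continuous near each point of [D]; it agrees
   with the norm of the matrix expression on [D]. *)
pose phi q : R := Num.sqrt (\sum_(k < p) normc (f k q) ^+ 2).
have phiE q : D q ->
    phi q = norm2 (C0 *m matfun h (((1 - q.1)%:C * q.2)%:M + q.1%:C *: A) *m b).
  move=> Dq; have [q1 q2] := Dq.
  have t01 : 0 <= q.1 <= 1 by move: q1; rewrite /= in_itv.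
  rewrite (value_matfun hU t01 q2).
  rewrite norm2E /phi; congr Num.sqrt; apply: eq_bigr => k _.
  by have [-> _] := fE k q (DU q Dq).
have phic : {within D, continuous phi}.
  apply: continuous_in_subspaceT => q; rewrite inE => Dq.
  have ck k : (fun q => normc (f k q) ^+ 2) @ q --> normc (f k q) ^+ 2.
    have [_ cf] := fE k q (DU q Dq).
    have cn : (fun q => normc (f k q)) @ q --> normc (f k q).
      move/cvg_normcP: cf => cf; apply/cvgrPdist_lt => e /cf; apply: filterS => y.
      apply: le_lt_trans.
      have h1 := normcD (f k q - f k y) (f k y); rewrite subrK normc_distC in h1.
      have h2 := normcD (f k y - f k q) (f k q); rewrite subrK in h2.
      by rewrite ler_norml; apply/andP; split; lra.
    by rewrite expr2; under eq_fun do rewrite expr2; exact: cvgM.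
  apply: continuous_comp; last exact: sqrt_continuous.
  by apply: cvg_big => [|k _]; [exact: add_continuous|exact: ck].
have cD : compact D.
  apply: compact_setX; first exact: segment_compact.
  by case: zs zs0 => // a s _; exact: conv_hull_compact.
have D0 : D !=set0.
  have [z0 z0s] : exists z0, z0 \in zs.
    by case: zs zs0 => // a s _; exists a; rewrite mem_head.
  by exists (0, z0); split; [rewrite /= in_itv /= lexx ler01|exact: sub_conv_hull].
have [[t mu]] := compact_EVT_max D0 cD phic; rewrite inE => Dq max.
have [t01' Zmu] := Dq.
have t01 : 0 <= t <= 1 by move: t01'; rewrite /= in_itv.
exists t, mu; split; [exact: t01|exact: Zmu|move=> s nu s01 Znu].
have Ds : D (s, nu) by split; [rewrite /= in_itv|exact: Znu].
by have := max (s, nu); rewrite inE (phiE _ Ds) (phiE _ Dq); apply.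
Qed.

End MaximumPrinciple.

Theorem corollary13 (R : realType) (n N L M : nat) (A : 'M[R[i]]_n)
    (z : N.-tuple R[i]) (f : R[i] -> R[i]) (U : set R[i])
    (u v : {poly R[i]}) (b : 'cV[R[i]]_n) :
  (0 < N)%N ->
  open U ->
  conv_hull (spectrum A `|` [set w | w \in z]) `<=` U ->
  (forall w, U w -> analytic_at f w) ->
  (size u <= L.+1)%N -> (size v <= M.+1)%N -> (L <= N - 1)%N ->
  interpolates (ratfun u v) f z ->
  (forall k : 'I_N, v.[tnth z k] != 0) ->
  (forall lambda, spectrum A lambda -> v.[lambda] != 0) ->
  let bound (t : R) (mu : R[i]) : R :=
    norm2 (matfun (Omega z) A *m invmx (matfun (horner v) A) *m
      ((N`!)%:R^-1 *: matfun (derive1n N (fun w => v.[w] * f w))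
        (((1 - t)%:C * mu)%:M + t%:C *: A)) *m b) in
  let bounds : set R :=
    [set s | exists t mu, [/\ 0 <= t <= 1,
      conv_hull [set w | w \in z] mu & s = bound t mu]] in
  exists m : R, [/\ bounds m, ubound bounds m &
    norm2 ((matfun f A - matfun (ratfun u v) A) *m b) <= m].
Proof.
(* The functional calculus above is developed in positive dimension; in dimension 0 all norms are
   zero, and [0 < N] makes the set of bounds nonempty. *)
case: n A b => [|n'] A b N0 oU hullU fU us vs LN interp vz vA bound bounds.
  have norm0 (x : 'cV[R[i]]_0) : norm2 x = 0 by rewrite /norm2 big_ord0 sqrtr0.
  exists 0; split; last by rewrite norm0.
    exists 0, (tnth z (Ordinal N0)); rewrite lexx ler01 /bound norm0; split=> //.
    by apply: sub_conv_hull; rewrite /= mem_tnth.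
  by move=> _ [t [mu [_ _ ->]]]; rewrite /bound norm0.
have Oz : Omega z = horner (\prod_(a <- z) ('X - a%:P)).
  apply/funext => w; rewrite horner_prod /Omega big_tuple.
  by apply: eq_bigr => k _; rewrite hornerXsubC.
set q := \prod_(a <- z) ('X - a%:P) in Oz.
have qE w : q.[w] = root_prod z w.
  by rewrite /q /root_prod horner_prod; apply: eq_bigr => a _; rewrite hornerXsubC.
pose C0 := horner_mx A q *m invmx (horner_mx A v).
pose g w := v.[w] * f w.
have gU : holo U g by move=> w Uw; exact: (analytic_mul_horner v (fU w Uw)).
have zs0 : (z : seq _) != [::] by rewrite -size_eq0 size_tuple -lt0n.
have zU a : a \in (z : seq _) -> U a.
  by move=> az; apply: hullU; apply: sub_conv_hull; right.
have AU : spectrum A `<=` U by move=> a Aa; apply: hullU; apply: sub_conv_hull; left.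
have boundE t mu : bound t mu = (N`!%:R)^-1 * norm2 (C0 *m
    matfun (derive1n (size z) g) (((1 - t)%:C * mu)%:M + t%:C *: A) *m b).
  rewrite /bound Oz !matfun_horner size_tuple -/C0 -scalemxAr -scalemxAl.
  have -> : (N`!%:R)^-1 = ((N`!%:R)^-1 : R)%:C :> R[i] by rewrite fmorphV rmorph_nat.
  by rewrite norm2Z // invr_ge0.
have gN := holo_derive1n (size z) gU.
have [t [mu [t01 Zmu max]]] := norm2_matfun_max C0 b zs0 oU hullU gN.
exists (bound t mu); split.
- by exists t, mu; split; [exact: t01|exact: Zmu|].
- move=> _ [s [nu [s01 Znu ->]]]; rewrite !boundE.
  have i0 : 0 <= (N`!%:R : R)^-1 by rewrite invr_ge0.
  exact: (ler_wpM2l i0 (max s nu s01 Znu)).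
have -> : matfun f A - matfun (ratfun u v) A = C0 *m matfun (dds z g) A.
  have vz' a : a \in (z : seq _) -> v.[a] != 0.
    by move=> /tnthP [k ->]; exact: vz.
  have uE : u = newton z g.
    apply: (interpolant_newton oU fU zU vz') => //.
    rewrite size_tuple; apply: leq_trans us _; rewrite (leq_ltn_trans LN) //.
    by rewrite subn1 ltn_predL.
  (* On this set, which still contains the spectrum, [ratfun u v] is analytic along with [f]. *)
  pose O := U `&` [set w : R[i] | v.[w] != 0].
  have oO : open O by apply: openI => //; exact: (@open_horner_neq0 R v).
  have AO : spectrum A `<=` O by move=> a Aa; split; [exact: AU|exact: vA].
  have rel := @matfun_linear_relation R n' A O f (ratfun u v) (dds z g) u v q oO AO.
  have {}rel : horner_mx A v *m (matfun f A - matfun (ratfun u v) A) =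
      horner_mx A q *m matfun (dds z g) A.
    apply: rel => [w [Uw _]|w [_ vw]|w [Uw _]|w _|w [_ vw]].
    - exact: fU.
    - exact: (analytic_div_horner vw (analytic_horner u w)).
    - exact: (holo_dds zU gU Uw).
    - by rewrite uE qE -newtonE.
    - by rewrite /ratfun mulrCA mulfV // mulr1.
  have uv := horner_mx_unit vA.
  (* The relation has [v(A)] on the left of the difference, while the bound has its inverse to the
     right of [Omega(A)]; commutation reconciles the two. *)
  have comm : horner_mx A v *m horner_mx A q = horner_mx A q *m horner_mx A v.
    by rewrite -[LHS](rmorphM (horner_mx A)) mulrC; exact: rmorphM.
  rewrite -[LHS](mulKmx uv) rel /C0 !mulmxA; congr (_ *m _).
  by apply: (row_free_inj (A := horner_mx A v)); rewrite ?row_free_unit //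
    -!mulmxA mulVmx // mulmx1 -comm mulKmx.
rewrite boundE mulrC -[N in N`!](size_tuple z).
by apply: (norm2_dds_le zs0 oU hullU gU) => s nu; exact: max.
Qed.
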